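(* Let $n\ge 5$ and consider the equation $$\Delta^2 u = u^p,\qquad u>0 \ \text{ in } \mathbb{R}^n. \qquad (\mathrm{E})$$ (1) If $n\le 8$ and $1<p<\infty$, then (E) has no stable solution. (2) If $9\le n\le 19$, there exists $\varepsilon_n>0$ such that for every $1<p<\frac{n}{n-8}+\varepsilon_n$, (E) has no stable solution. (3) If $n\ge 20$ and $1<p<1+\frac{8p^*}{n-4}$, then (E) has no stable solution, where $p^*$ (depending on $n$) is the smallest real root greater than $\frac{n-4}{n-8}$ of the algebraic equation in $x$ $$\begin{aligned} & 512(2-n)x^6+4(n^3-60n^2 +720n-1344)x^5-2(13n^3-424n^2+3064n-5408)x^4\\ & +2(27n^3-572n^2 + 3264n-5440)x^3- (49n^3-772n^2 +3776n-5888)x^2\\ & +4(5n^3-66n^2+288n-416)x-3(n^3 -12n^2 + 48 n - 64) = 0. \end{aligned}$$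
   Context: Solutions are classical (pointwise, $u\in C^4(\mathbb{R}^n)$) and positive. A solution $u$ of $\Delta^2u=u^p$, $u>0$ in $\mathbb{R}^n$ is called stable if $$\Lambda_u(\varphi):=\int_{\mathbb{R}^n}|\Delta\varphi|^2\,dx-p\int_{\mathbb{R}^n}u^{p-1}\varphi^2\,dx\ \ge 0\quad\text{for all }\varphi\in H^2(\mathbb{R}^n).$$ *)

(* Defs.v *)
From HB Require Import structures.
From mathcomp Require Import all_boot all_order all_algebra.
From mathcomp Require Import all_classical all_reals all_analysis.

Set Implicit Arguments.
Unset Strict Implicit.
Unset Printing Implicit Defensive.
Import Order.TTheory GRing.Theory Num.Theory.
Import numFieldNormedType.Exports.

Local Open Scope classical_set_scope.
Local Open Scope ring_scope.

(* R^n is 'rV[R]_n. The library has no measure on it: below it gets the Borel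
   sigma-algebra (generated by the coordinates) and the iterated product of the
   one-dimensional Lebesgue measure. *)

Definition measure_rV_display : measure_display -> measure_display.
Proof. exact. Qed.

Section borel_rV.
Context {R : realType}.
Variable n : nat.

Definition coor_rV (i : 'I_n) (x : 'rV[R]_n) : measurableTypeR R := x 0 i.

Let rV_set0 : g_sigma_preimage coor_rV set0.
Proof. exact: sigma_algebra0. Qed.

Let rV_setC A : g_sigma_preimage coor_rV A -> g_sigma_preimage coor_rV (~` A).
Proof. exact: sigma_algebraC. Qed.

Let rV_bigcup (F : (set 'rV[R]_n)^nat) :
  (forall i, g_sigma_preimage coor_rV (F i)) ->
  g_sigma_preimage coor_rV (\bigcup_i (F i)).
Proof. exact: sigma_algebra_bigcup. Qed.

HB.instance Definition _ := @isMeasurable.Build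
  (measure_rV_display (R.-ocitv.-measurable).-sigma) 'rV[R]_n
  (g_sigma_preimage coor_rV) rV_set0 rV_setC rV_bigcup.

Lemma measurable_coor_rV (i : 'I_n) : measurable_fun setT (coor_rV i).
Proof.
move=> _ Y mY; rewrite setTI; apply: sub_sigma_algebra => /=.
rewrite -bigcup_seq/=; exists i => /=; first by rewrite mem_index_enum.
by exists Y => //; rewrite setTI.
Qed.

Lemma measurable_fun_rVP d (T : measurableType d) (f : T -> 'rV[R]_n) :
  (forall i, measurable_fun setT (coor_rV i \o f)) -> measurable_fun setT f.
Proof.
move=> mf _ A mA; rewrite setTI.
pose G : set (set 'rV[R]_n) := [set B | measurable (f @^-1` B)].
suff : measurable `<=` G by apply.
apply: smallest_sub.
  split => [|B|F]; rewrite /G/=.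
  - by rewrite preimage_set0.
  - by rewrite setTD preimage_setC => mB; exact: measurableC.
  - by move=> mF; rewrite preimage_bigcup; exact: bigcup_measurable.
move=> B; rewrite -bigcup_seq/= => -[i _ [Y mY <-]].
by rewrite /G/= setTI -comp_preimage -[X in measurable X]setTI; exact: mf.
Qed.

End borel_rV.

Section lebesgue_rV.
Context {R : realType}.
Local Open Scope ereal_scope.

Definition cons_rV n (x : measurableTypeR R * 'rV[R]_n) : 'rV[R]_n.+1 :=
  row_mx (const_mx x.1 : 'rV_1) x.2.

Lemma coor_cons0 n (x : measurableTypeR R * 'rV[R]_n) :
  coor_rV ord0 (cons_rV x) = x.1.
Proof.
rewrite /coor_rV /cons_rV.
have -> : ord0 = lshift n (ord0 : 'I_1) by exact/val_inj.
by rewrite (row_mxEl (const_mx x.1 : 'rV_1) x.2) mxE.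
Qed.

Lemma coor_consS n (x : measurableTypeR R * 'rV[R]_n) (i : 'I_n) :
  coor_rV (lift ord0 i) (cons_rV x) = coor_rV i x.2.
Proof.
rewrite /coor_rV /cons_rV.
have -> : lift ord0 i = rshift 1 i by exact/val_inj.
by rewrite (row_mxEr (const_mx x.1 : 'rV_1) x.2).
Qed.

Lemma measurable_cons_rV n : measurable_fun setT (@cons_rV n).
Proof.
apply: measurable_fun_rVP => i; have [j ->|->] := unliftP ord0 i.
  rewrite (_ : _ \o _ = coor_rV j \o snd); last first.
    by apply/funext => x /=; rewrite coor_consS.
  by apply: measurableT_comp; [exact: measurable_coor_rV|exact: measurable_snd].
rewrite (_ : _ \o _ = fst); last by apply/funext => x /=; rewrite coor_cons0.
exact: measurable_fst.
Qed.

Section step.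
Variables (n : nat) (m : {sigma_finite_measure set 'rV[R]_n -> \bar R}).

Definition lebesgue_rVS : set 'rV[R]_n.+1 -> \bar R :=
  pushforward (@lebesgue_measure R \x m) (@cons_rV n).

Let lebesgue_rVS0 : lebesgue_rVS set0 = 0.
Proof. by rewrite /lebesgue_rVS /pushforward preimage_set0 measure0. Qed.

Let lebesgue_rVS_ge0 A : 0 <= lebesgue_rVS A.
Proof. by rewrite /lebesgue_rVS /pushforward; exact: measure_ge0. Qed.

Let lebesgue_rVS_sigma_additive : semi_sigma_additive lebesgue_rVS.
Proof.
move=> F mF tF mUF; rewrite /lebesgue_rVS /pushforward preimage_bigcup.
apply: measure_semi_sigma_additive.
- by move=> i; rewrite -[X in measurable X]setTI; exact: measurable_cons_rV.
- apply/trivIsetP => /= i j _ _ ij; rewrite -preimage_setI.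
  by move/trivIsetP : tF => /(_ _ _ _ _ ij) ->//; rewrite preimage_set0.
- rewrite -preimage_bigcup -[X in measurable X]setTI.
  exact: measurable_cons_rV.
Qed.

HB.instance Definition _ := isMeasure.Build _ _ _ lebesgue_rVS
  lebesgue_rVS0 lebesgue_rVS_ge0 lebesgue_rVS_sigma_additive.

Definition uncons_rV (x : 'rV[R]_n.+1) : measurableTypeR R * 'rV[R]_n :=
  (coor_rV ord0 x, \row_i coor_rV (lift ord0 i) x)%R.

Lemma cons_rVK : cancel (@cons_rV n) uncons_rV.
Proof.
case=> a v; rewrite /uncons_rV coor_cons0; congr (_, _).
by apply/rowP => i; rewrite mxE coor_consS.
Qed.

Lemma measurable_uncons_rV : measurable_fun setT uncons_rV.
Proof.
apply: measurable_fun_pair => /=; first exact: measurable_coor_rV.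
apply: measurable_fun_rVP => i.
rewrite (_ : _ \o _ = coor_rV (lift ord0 i)); first exact: measurable_coor_rV.
by apply/funext => x; rewrite /= /coor_rV mxE.
Qed.

Let lebesgue_rVS_sigma_finite : sigma_finite setT lebesgue_rVS.
Proof.
have /sigma_finiteP[F [TF ndF Foo]] := sigma_finiteT (@lebesgue_measure R).
have /sigma_finiteP[G [TG ndG Goo]] := sigma_finiteT m.
exists (fun k => uncons_rV @^-1` (F k `*` G k)) => [|k].
  apply/seteqP; split=> // x _.
  have [i _ Fi] : (\bigcup_i F i) (uncons_rV x).1 by rewrite -TF.
  have [j _ Gj] : (\bigcup_i G i) (uncons_rV x).2 by rewrite -TG.
  exists (maxn i j) => //; split.
  - by move: Fi; exact/subsetPset/ndF/leq_maxl.
  - by move: Gj; exact/subsetPset/ndG/leq_maxr.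
have [mFk Fk] := Foo k; have [mGk Gk] := Goo k; split.
  rewrite -[X in measurable X]setTI; apply: measurable_uncons_rV => //.
  exact: measurableX.
rewrite /lebesgue_rVS /pushforward -comp_preimage.
rewrite (_ : _ \o _ = id); last by apply/funext => x; exact: cons_rVK.
by rewrite preimage_id product_measure1E// lte_mul_pinfty// ge0_fin_numE.
Qed.

HB.instance Definition _ := Measure_isSigmaFinite.Build _ _ _ lebesgue_rVS
  lebesgue_rVS_sigma_finite.

End step.

Fixpoint lebesgue_rV n : {sigma_finite_measure set 'rV[R]_n -> \bar R} :=
  match n with
  | 0 => \d_(0%R : 'rV[R]_0)
  | k.+1 => lebesgue_rVS (lebesgue_rV k)
  end.

Lemma lebesgue_rV_box n (A : 'I_n -> set (measurableTypeR R)) :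
  (forall i, measurable (A i)) ->
  lebesgue_rV n [set x | forall i, A i (coor_rV i x)] =
  \prod_(i < n) lebesgue_measure (A i).
Proof.
elim: n A => [|n IHn] A mA.
  by rewrite big_ord0 /= diracE mem_set// => -[].
rewrite big_ord_recl -IHn => [|i]; last exact: mA.
rewrite /= /lebesgue_rVS /pushforward.
set B := [set x | forall i, A (lift ord0 i) (coor_rV i x)].
rewrite (_ : _ @^-1` _ = A ord0 `*` B); last first.
  apply/seteqP; split=> -[a v] /=.
    move=> h; split=> [|i]/=; first by have := h ord0; rewrite coor_cons0.
    by have := h (lift ord0 i); rewrite coor_consS.
  move=> [/= ha hv] i; have [j ->|->] := unliftP ord0 i.
    by rewrite coor_consS; exact: hv.
  by rewrite coor_cons0.
rewrite product_measure1E//.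
rewrite (_ : B = \bigcap_(i in [set: 'I_n]) (coor_rV i @^-1` A (lift ord0 i))).
  apply: fin_bigcap_measurable => // i _.
  by rewrite -[X in measurable X]setTI; exact: measurable_coor_rV.
by apply/seteqP; split=> [x h i _|x h i]; exact: h.
Qed.

End lebesgue_rV.

Section calculus.
Context {R : realType} {n : nat}.
Implicit Types (f g h u phi psi : 'rV[R]_n -> R) (s : seq 'I_n).

Definition partial (i : 'I_n) f : 'rV[R]_n -> R :=
  fun x => 'D_(delta_mx 0 i) f x.

Definition partials s f : 'rV[R]_n -> R := foldr partial f s.

Definition laplacian f : 'rV[R]_n -> R :=
  fun x => \sum_(i < n) partial i (partial i f) x.

Definition class_C (k : nat) f : Prop :=
  forall s, (size s <= k)%N ->
    continuous (partials s f) /\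
    ((size s < k)%N ->
      forall i x, derivable (partials s f) x (delta_mx 0 i)).

Definition test_function psi : Prop :=
  (forall k, class_C k psi) /\ compact (closure [set x | psi x != 0]).

Definition L2 f : Prop :=
  measurable_fun setT f /\ finite_norm (lebesgue_rV n) 2%:E f.

(* Only used for f and g in L2, where both integrands are integrable. *)
Definition weak_partials s f g : Prop :=
  forall psi, test_function psi ->
    \int[lebesgue_rV n]_x (f x * partials s psi x) =
    (-1) ^+ size s * \int[lebesgue_rV n]_x (g x * psi x).

Definition sobolev (k : nat) f : Prop :=
  L2 f /\
  forall s, (size s <= k)%N -> exists2 g, L2 g & weak_partials s f g.

(* h represents the Laplacian of an H^2 function f; it is unique up to a null
   set. *)
Definition weak_laplacian f h : Prop :=
  exists2 D : 'I_n -> 'rV[R]_n -> R,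
    forall i, L2 (D i) /\ weak_partials [:: i; i] f (D i) &
    h = (fun x => \sum_(i < n) D i x).

Definition solution (p : R) u : Prop :=
  [/\ class_C 4 u, forall x, 0 < u x &
      forall x, laplacian (laplacian u) x = u x `^ p].

(* The first integral is finite; if the second one is not, the value is -oo. *)
Definition Lambda (p : R) u phi h : \bar R :=
  (\int[lebesgue_rV n]_x (`|h x| ^+ 2)%:E -
   p%:E * \int[lebesgue_rV n]_x (u x `^ (p - 1) * phi x ^+ 2)%:E)%E.

Definition stable (p : R) u : Prop :=
  forall phi h, sobolev 2 phi -> weak_laplacian phi h ->
    (0 <= Lambda p u phi h)%E.

End calculus.

Definition no_stable_solution (R : realType) (n : nat) (p : R) : Prop :=
  ~ exists2 u : 'rV[R]_n -> R, solution p u & stable p u.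

Section exponent.
Context {R : realType}.
Variable d : nat.
Let n : R := d%:R.

Definition pstar_poly (x : R) : R :=
    512 * (2 - n) * x ^+ 6
  + 4 * (n ^+ 3 - 60 * n ^+ 2 + 720 * n - 1344) * x ^+ 5
  - 2 * (13 * n ^+ 3 - 424 * n ^+ 2 + 3064 * n - 5408) * x ^+ 4
  + 2 * (27 * n ^+ 3 - 572 * n ^+ 2 + 3264 * n - 5440) * x ^+ 3
  - (49 * n ^+ 3 - 772 * n ^+ 2 + 3776 * n - 5888) * x ^+ 2
  + 4 * (5 * n ^+ 3 - 66 * n ^+ 2 + 288 * n - 416) * x
  - 3 * (n ^+ 3 - 12 * n ^+ 2 + 48 * n - 64).

Definition is_pstar (x : R) : Prop :=
  [/\ (n - 4) / (n - 8) < x, pstar_poly x = 0 &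
      forall y, (n - 4) / (n - 8) < y -> pstar_poly y = 0 -> x <= y].

End exponent.

(* Main.v *)
(* Let v = - Lap u and l^2 = 2 / (p + 1).
   (1) Testing stability with u times a cutoff at scale R bounds the integral of
   u^(p+1) + v^2 over the ball of radius R by C R^(n - 4(p+1)/(p-1)).
   (2) w = l u^((p+1)/2) - v is subharmonic where it is positive, and (1) leaves no
   room for a nonzero nonnegative subharmonic function: l u^((p+1)/2) <= v.
   (3) Testing stability with v (1+|x|^2)^(-tau/2) times a cutoff, and computing
   Lap (Lap v), gives an upper bound for the integral of u^(p-2) |grad u|^2 v with
   weight (1+|x|^2)^(-tau).  A Hardy-type integration by parts together with (2)
   bounds the same integral from below, up to a constant, by the weighted integral
   I of u^(2p); the error terms from the cutoff are absorbed in I, up to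
   R^(-4-2tau) times the quantity of (1).  If the two constants are in the right
   order, letting R go to infinity makes I vanish as soon as
   n < 2 tau + 8 p / (p - 1).
   (4) A small tau settles p up to slightly above n / (n - 8).  For n >= 20, the
   polynomial is negative at 1 + sqrt (16 / (5 n)), which therefore bounds p^* from
   above, and the tau with n = 2 tau + 8 + (n - 4) / (1 + sqrt (16 / (5 n))) serves
   for all the remaining p. *)

Require Import Defs.
From HB Require Import structures.
From mathcomp Require Import all_boot all_order all_algebra.
From mathcomp Require Import all_classical all_reals all_analysis.
From mathcomp Require Import measurable_realfun zify ring lra.

Set Implicit Arguments.
Unset Strict Implicit.
Unset Printing Implicit Defensive.
Import Order.TTheory GRing.Theory Num.Theory.
Import numFieldNormedType.Exports.

Local Open Scope classical_set_scope.
Local Open Scope ring_scope.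

(** Without a weight the argument stops at n < 8 p / (p - 1), that is p < n / (n - 8): beyond it
    R^(-4) times the energy of v no longer tends to 0. A weight behaving like |x|^(-tau) gains 2 tau
    in this count, but its derivatives enter at leading order and leave a multiple 9 tau^2 / [Kt] of
    the very integral that should vanish. This cost is quadratic in tau, so for n >= 5 a small tau
    is always affordable. The test function contains v because Lap (Lap v) = p u^(p-1) v - p (p-1)
    u^(p-2) |grad u|^2: the first term cancels the potential term of the stability inequality, and
    only the gradient integral remains. The polynomial enters only through its signs at (n - 4) / (n
    - 8) and at 1 + sqrt (16 / (5 n)). At 1 + y, with y of order n^(-1/2), it is - 3 n^3 y^2 + 8 n^2
    to leading order, so its zero is near y^2 = 8 / (3 n); the larger 16 / (5 n) leaves room for all
    n >= 20. Nothing is known about u at infinity, so every integrand carries a cutoff, and an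
    integration by parts is a divergence added to a pointwise inequality. *)

Section measurability.
Context {R : realType} {n : nat}.

(** * Borel measurability of open sets and continuous functions *)

Lemma rV_norm_le (x : 'rV[R]_n) (M : R) :
  0 <= M -> (forall i, `|x 0 i| <= M) -> `|x| <= M.
Proof.
move=> M0 xM; rewrite /Num.Def.normr/= mx_normrE.
by apply: bigmax_le => //= -[i j] _; rewrite ord1.
Qed.

Lemma rV_coord_le_norm (x : 'rV[R]_n) i : `|x 0 i| <= `|x|.
Proof.
rewrite [leRHS]/Num.Def.normr/= mx_normrE.
by apply/bigmax_geP; right => /=; exists (0, i).
Qed.

Lemma measurable_box (A : 'I_n -> set (measurableTypeR R)) : (forall i, measurable (A i)) ->
  measurable [set x : 'rV[R]_n | forall i, A i (coor_rV i x)].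
Proof.
move=> mA; rewrite (_ : [set _ | _] =
    \bigcap_(i in [set: 'I_n]) (coor_rV i @^-1` A i)).
  apply: fin_bigcap_measurable => // i _.
  by rewrite -[X in measurable X]setTI; exact: measurable_coor_rV.
by apply/seteqP; split=> [x h i _|x h i]; exact: h.
Qed.

(** The norm is the sup norm, so boxes with rational centre and radius exhaust an open set, and each
    is cut out by conditions on single coordinates. Radii run through all rationals; a nonpositive
    one gives empty intervals. *)
Lemma open_measurable_rV (U : set 'rV[R]_n) : open U -> measurable U.
Proof.
move=> oU.
pose box (c : 'rV[rat]_n * rat) := [set x : 'rV[R]_n | forall i,
  ball (ratr (c.1 0 i) : R) (ratr c.2 : R) (coor_rV i x)].
have -> : U = \bigcup_(c in [set c | box c `<=` U]) box c.
  apply/seteqP; split=> [x Ux|x [c /= cU cx]]; last exact: cU.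
  have /nbhs_ballP[e /= e0 xeU] := open_nbhs_nbhs (conj oU Ux).
  have e2 : 0 < e / 2 by lra.
  have /rat_in_itvoo[q] := e2.
  rewrite in_itv/= => /andP[q0 qe].
  have h i : exists a : rat, (ratr a : R) \in `](x 0 i - ratr q), (x 0 i + ratr q)[.
    by apply: rat_in_itvoo; lra.
  have [a ha] := choice h.
  exists (\row_i a i, q) => /=.
    move=> y yc; apply: xeU; rewrite mx_norm_ball /ball_ /=.
    have := yc; have xa i := ha i.
    move=> yb; apply: (@le_lt_trans _ _ (2 * ratr q)); last by lra.
    apply: rV_norm_le; first by lra.
    move=> i; have := yb i; rewrite /ball /= /coor_rV /= mxE.
    have := xa i; rewrite in_itv/= !mxE => /andP[h1 h2].
    rewrite !ltr_norml => /andP[h3 h4].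
    by rewrite ler_norml; apply/andP; split; lra.
  move=> i; rewrite /ball /= /coor_rV mxE.
  have := ha i; rewrite in_itv/= => /andP[h1 h2].
  by rewrite ltr_norml; apply/andP; split; lra.
rewrite bigcup_mkcond.
apply: countable_bigcupT_measurable => [|c]; first exact: countableP.
case: ifPn => // _.
apply: (@measurable_box (fun i => ball (ratr (c.1 0 i) : R) (ratr c.2 : R))) => i.
apply: measurable_realfun.open_measurable.
have [c0|c0] := ltP 0 (ratr c.2 : R); first exact: ball_open.
rewrite (_ : ball _ _ = set0); first exact: open0.
apply/seteqP; split => [y yb|y []//].
have h : `|(ratr (c.1 0 i) : R) - y| < ratr c.2 by exact: yb.
by have := le_lt_trans (normr_ge0 _) h; rewrite ltNge c0.
Qed.

Lemma continuous_measurable_rV (f : 'rV[R]_n -> R) :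
  continuous f -> measurable_fun setT f.
Proof.
move=> /continuousP cf; apply: (measurability _ (RGenOpens.measurableE R)).
move=> _ [_ [a [b ->] <-]]; rewrite setTI.
by apply: open_measurable_rV; exact/cf/interval_open.
Qed.

End measurability.

(** * Integration of continuous functions with bounded support *)

Section bounded_support.
Context {R : realType} {n : nat}.
Implicit Types f g : 'rV[R]_n -> R.

(** Vanishing beyond a cube, rather than compactness of a closure: sums, products and derivatives
    inherit it at once. *)
Definition bsupp f := exists M : R, forall (x : 'rV[R]_n) (i : 'I_n), M < `|x 0 i| -> f x = 0.

Definition cbs f := continuous f /\ bsupp f.

Definition cube (M : R) := [set x : 'rV[R]_n | forall i, `|x 0 i| <= M].

Lemma measurable_cube M : measurable (cube M).
Proof.
rewrite (_ : cube M = [set x | forall i : 'I_n, `[- M, M]%classic (coor_rV i x)]).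
  by apply: (@measurable_box _ _ (fun=> `[- M, M]%classic)) => i.
by apply/seteqP; split=> x h i; have := h i; rewrite /= in_itv/= ler_norml.
Qed.

Lemma cube_measure M : 0 <= M -> lebesgue_rV n (cube M) = ((M *+ 2) ^+ n)%:E.
Proof.
move=> M0; rewrite (_ : cube M =
    [set x | forall i : 'I_n, `[- M, M]%classic (coor_rV i x)]).
  rewrite (@lebesgue_rV_box _ n (fun=> `[- M, M]%classic))//.
  under eq_bigr do rewrite lebesgue_measure_itv/= lte_fin.
  have [MM|MM] := ltP (- M) M.
    rewrite prodEFin; congr EFin; rewrite prodr_const card_ord.
    by congr (_ ^+ _); rewrite opprK mulr2n.
  have -> : M = 0 by lra.
  case: n => [|k]; first by rewrite big_ord0 expr0.
  by rewrite big_ord_recl mul0e mul0rn expr0n.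
by apply/seteqP; split=> x h i; have := h i; rewrite /= in_itv/= ler_norml.
Qed.

Lemma compact_cube M : compact (cube M).
Proof.
rewrite (_ : cube M = [set v : 'rV[R]_n | forall i, `[- M, M]%classic (v ord0 i)]).
  by apply: (@rV_compact _ _ (fun=> `[- M, M]%classic)) => i; exact: segment_compact.
by apply/seteqP; split=> x h i; have := h i; rewrite /= in_itv/= ler_norml.
Qed.

Lemma continuous_bounded_cube f M : continuous f ->
  exists2 B, 0 <= B & forall x, cube M x -> `|f x| <= B.
Proof.
move=> cf.
have : compact (f @` cube M).
  apply: continuous_compact; last exact: compact_cube.
  exact: continuous_subspaceT.
move=> /compact_bounded[B [_ hB]]; exists (Num.max (B + 1) 0).
  by rewrite le_max lexx orbT.
move=> x Mx; rewrite le_max; apply/orP; left.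
by apply: hB; [lra|exists x].
Qed.

Lemma cbs_bounded f : cbs f -> exists2 B, 0 <= B & forall x, `|f x| <= B.
Proof.
move=> [cf [M hM]]; have [B B0 hB] := continuous_bounded_cube M cf.
exists B => // x; have [Mx|] := pselect (cube M x); first exact: hB.
move=> /existsNP[i /negP]; rewrite -ltNge => /hM ->.
by rewrite normr0.
Qed.

Lemma cbs_bound_indic f : cbs f -> exists M B, [/\ 0 <= M, 0 <= B &
  forall x, `|f x| <= B * \1_(cube M) x].
Proof.
move=> cbf; have [B B0 hB] := cbs_bounded cbf.
move: (cbf) => [_ [M hM]]; exists (Num.max M 0), B; split => //.
  by rewrite le_max lexx orbT.
move=> x; rewrite indicE; have [Mx|] := pselect (cube (Num.max M 0) x).
  by rewrite mem_set// mulr1.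
move=> xM; rewrite memNset// mulr0; move/existsNP: xM => [i /negP].
by rewrite -ltNge gt_max => /andP[/hM -> _]; rewrite normr0.
Qed.

Lemma cbs_integrable f : cbs f -> (lebesgue_rV n).-integrable setT (EFin \o f).
Proof.
move=> cbf; have [M [B [M0 B0 hB]]] := cbs_bound_indic cbf.
have mc := measurable_cube M.
apply: (@le_integrable _ _ _ _ _ measurableT _ (fun x => (B * \1_(cube M) x)%:E)).
- by apply/measurable_EFinP; apply: continuous_measurable_rV; exact: cbf.1.
- by move=> x _ /=; rewrite lee_fin (le_trans (hB x))// ler_norm.
- apply/integrableP; split.
    by apply/measurable_EFinP; apply: measurable_funM => //; exact: measurable_indic.
  under eq_integral.
    move=> x _; rewrite gee0_abs; last by rewrite lee_fin mulr_ge0// indicE.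
    rewrite EFinM; over.
  rewrite ge0_integralZl//; last first.
  - by apply/measurable_EFinP; exact: measurable_indic.
  by rewrite integral_indic// setIT [X in (_ * X < _)%E](cube_measure M0) ltry.
Qed.

End bounded_support.

Section continuity.
Context {T : topologicalType} {R : realType}.
Implicit Types f g : T -> R.

Lemma cont_add f g : continuous f -> continuous g ->
  continuous (fun x => f x + g x).
Proof. by move=> cf cg x; apply: continuousD; [exact: cf|exact: cg]. Qed.

Lemma cont_mul f g : continuous f -> continuous g ->
  continuous (fun x => f x * g x).
Proof. by move=> cf cg x; apply: continuousM; [exact: cf|exact: cg]. Qed.

Lemma cont_cst (c : R) : continuous (fun _ : T => c).
Proof. by move=> x; exact: cst_continuous. Qed.

Lemma cont_opp f : continuous f -> continuous (fun x => - f x).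
Proof. by move=> cf x; apply: continuousN; exact: cf. Qed.

Lemma cont_exp f k : continuous f -> continuous (fun x => f x ^+ k).
Proof.
move=> cf; elim: k => [|k IH]; first exact: cont_cst.
rewrite (_ : (fun x => _) = fun x => f x * f x ^+ k); first exact: cont_mul.
by apply/funext => x; rewrite exprS.
Qed.

Lemma cont_sum (integ : Type) (r : seq integ) (F : integ -> T -> R) :
  (forall i, continuous (F i)) -> continuous (fun x => \sum_(i <- r) F i x).
Proof.
move=> cF; elim: r => [|i r IH].
  by under eq_fun do rewrite big_nil; exact: cont_cst.
by under eq_fun do rewrite big_cons; exact: cont_add.
Qed.

Lemma cont_norm f : continuous f -> continuous (fun x => `|f x|).
Proof.
by move=> cf x; apply: (continuous_comp (cf x)); exact: norm_continuous.
Qed.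

End continuity.

(* Locked, as grad2, lap, wt and cutoff below, to keep conversion from unfolding it. *)
HB.lock Definition integ (R : realType) (n : nat) (f : 'rV[R]_n -> R) : R :=
  \int[lebesgue_rV n]_x f x.

Section integral.
Context {R : realType} {n : nat}.
Implicit Types f g : 'rV[R]_n -> R.

Lemma integE f : integ f = \int[lebesgue_rV n]_x f x.
Proof. by rewrite integ.unlock. Qed.

Lemma bsupp_add f g : bsupp f -> bsupp g -> bsupp (fun x => f x + g x).
Proof.
move=> [M hM] [N hN]; exists (Num.max M N) => x i.
by rewrite gt_max => /andP[/hM -> /hN ->]; rewrite addr0.
Qed.

Lemma bsupp_mulr f g : bsupp f -> bsupp (fun x => f x * g x).
Proof. by move=> [M hM]; exists M => x i /hM ->; rewrite mul0r. Qed.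

Lemma bsupp_mull f g : bsupp g -> bsupp (fun x => f x * g x).
Proof. by move=> [M hM]; exists M => x i /hM ->; rewrite mulr0. Qed.

Lemma bsupp_opp f : bsupp f -> bsupp (fun x => - f x).
Proof. by move=> [M hM]; exists M => x i /hM ->; rewrite oppr0. Qed.

Lemma bsupp0 : bsupp (fun _ : 'rV[R]_n => 0 : R).
Proof. by exists 0. Qed.

Lemma bsupp_sum (J : Type) (r : seq J) (F : J -> 'rV[R]_n -> R) :
  (forall i, bsupp (F i)) -> bsupp (fun x => \sum_(i <- r) F i x).
Proof.
move=> cF; elim: r => [|i r IH].
  by under eq_fun do rewrite big_nil; exact: bsupp0.
by under eq_fun do rewrite big_cons; exact: bsupp_add.
Qed.

Lemma bsupp_exp f k : bsupp f -> bsupp (fun x => f x ^+ k.+1).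
Proof. by move=> [M hM]; exists M => x i /hM ->; rewrite expr0n. Qed.

Lemma bsupp_norm f : bsupp f -> bsupp (fun x => `|f x|).
Proof. by move=> [M hM]; exists M => x i /hM ->; rewrite normr0. Qed.

Lemma cbs_add f g : cbs f -> cbs g -> cbs (fun x => f x + g x).
Proof. by move=> [? ?] [? ?]; split; [exact: cont_add|exact: bsupp_add]. Qed.

Lemma cbs_opp f : cbs f -> cbs (fun x => - f x).
Proof. by move=> [? ?]; split; [exact: cont_opp|exact: bsupp_opp]. Qed.

Lemma cbs_mull f g : continuous f -> cbs g -> cbs (fun x => f x * g x).
Proof. by move=> ? [? ?]; split; [exact: cont_mul|exact: bsupp_mull]. Qed.

Lemma cbs_scale c f : cbs f -> cbs (fun x => c * f x).
Proof. by apply: cbs_mull; exact: cont_cst. Qed.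

Lemma cbs_exp f k : cbs f -> cbs (fun x => f x ^+ k.+1).
Proof. by move=> [? ?]; split; [exact: cont_exp|exact: bsupp_exp]. Qed.

Lemma cbs_sum (J : Type) (r : seq J) (F : J -> 'rV[R]_n -> R) :
  (forall i, cbs (F i)) -> cbs (fun x => \sum_(i <- r) F i x).
Proof.
by move=> cF; split; [apply: cont_sum|apply: bsupp_sum] => i; have [] := cF i.
Qed.

Lemma I_add f g : cbs f -> cbs g -> integ (fun x => f x + g x) = integ f + integ g.
Proof. by move=> cf cg; rewrite !integE RintegralD//; exact: cbs_integrable. Qed.

Lemma I_scale c f : cbs f -> integ (fun x => c * f x) = c * integ f.
Proof. by move=> cf; rewrite !integE RintegralZl//; exact: cbs_integrable. Qed.

Lemma I_opp f : cbs f -> integ (fun x => - f x) = - integ f.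
Proof.
move=> cf; rewrite -mulN1r -I_scale//; congr integ.
by apply/funext => x; rewrite mulN1r.
Qed.

Lemma I_sub f g : cbs f -> cbs g -> integ (fun x => f x - g x) = integ f - integ g.
Proof. by move=> cf cg; rewrite I_add ?I_opp//; exact: cbs_opp. Qed.

Lemma I_sum (J : Type) (r : seq J) (F : J -> 'rV[R]_n -> R) :
  (forall i, cbs (F i)) ->
  integ (fun x => \sum_(i <- r) F i x) = \sum_(i <- r) integ (F i).
Proof.
move=> cF; elim: r => [|i r IH].
  rewrite big_nil; under eq_fun do rewrite big_nil.
  by rewrite !integE /Rintegral integral0_eq.
under eq_fun do rewrite big_cons.
by rewrite big_cons I_add ?IH//; exact: cbs_sum.
Qed.

Lemma I_le f g : cbs f -> cbs g -> (forall x, f x <= g x) -> integ f <= integ g.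
Proof.
by move=> cf cg fg; rewrite !integE; apply: le_Rintegral => //; exact: cbs_integrable.
Qed.

Lemma I_ge0 f : (forall x, 0 <= f x) -> 0 <= integ f.
Proof. by move=> f0; rewrite integE; exact: Rintegral_ge0. Qed.

Lemma I_EFin f : cbs f -> (\int[lebesgue_rV n]_x (f x)%:E)%E = (integ f)%:E.
Proof.
move=> cf; rewrite !integE /Rintegral fineK//.
by apply: integrable_fin_num => //; exact: cbs_integrable.
Qed.

(** By continuity f stays above half of its value on a small box with corner at the given point, and
    the box has positive measure. *)
Lemma I_gt0 f : cbs f -> (forall x, 0 <= f x) -> (exists x, 0 < f x) ->
  0 < integ f.
Proof.
move=> cf f0 [x fx]; pose c := f x / 2.
have c0 : 0 < c by rewrite /c; lra.
have : \forall y \near x, c < f y.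
  have cfx : f y @[y --> x] --> f x := cf.1 x.
  by have /cvgr_gt := cfx; apply; rewrite /c; lra.
move=> /nbhs_ballP[e /= e0 he].
pose A := [set y : 'rV[R]_n | forall i : 'I_n,
   `[x 0 i, (x 0 i + e / 2)]%classic (coor_rV i y)].
have mA : measurable A.
  by apply: (@measurable_box _ _ (fun i => `[x 0 i, (x 0 i + e / 2)]%classic)).
have muA : lebesgue_rV n A = ((e / 2) ^+ n)%:E.
  rewrite /A (@lebesgue_rV_box _ n
    (fun i => `[x 0 i, (x 0 i + e / 2)]%classic))//.
  rewrite (eq_bigr (fun=> (e / 2)%:E)).
    by rewrite prodEFin prodr_const card_ord.
  move=> i _; rewrite lebesgue_measure_itv/= lte_fin ltrDl divr_gt0//.
  by congr EFin; ring.
have fA y : A y -> c <= f y.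
  move=> Ay; apply/ltW/he; rewrite mx_norm_ball /ball_ /=.
  apply: (@le_lt_trans _ _ (e / 2)); last by lra.
  apply: rV_norm_le; first by lra.
  move=> i; have := Ay i; rewrite /= in_itv/= /coor_rV !mxE => /andP[h1 h2].
  by rewrite ler_norml; apply/andP; split; lra.
rewrite -lte_fin -I_EFin//.
apply: (@lt_le_trans _ _ (\int[lebesgue_rV n]_x (c * \1_A x)%:E)%E).
  under eq_integral do rewrite EFinM.
  rewrite ge0_integralZl//; last 2 first.
  - by apply/measurable_EFinP; exact: measurable_indic.
  - by rewrite lee_fin ltW.
  rewrite integral_indic// setIT [X in (_ * X)%E]muA -EFinM lte_fin.
  by rewrite mulr_gt0// exprn_gt0// divr_gt0.
apply: ge0_le_integral => //.
- by move=> y _; rewrite lee_fin mulr_ge0// ltW.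
- by apply/measurable_EFinP; apply: measurable_funM => //; exact: measurable_indic.
- by apply/measurable_EFinP; apply: continuous_measurable_rV; exact: cf.1.
- move=> y _; rewrite lee_fin indicE.
  have [Ay|Ay] := pselect (A y).
    by rewrite mem_set// mulr1; exact: fA.
  by rewrite memNset// mulr0.
Qed.

Lemma I_le_meas f M B : cbs f -> 0 <= M -> 0 <= B -> (forall x, 0 <= f x) ->
  (forall x, f x <= B * \1_(cube M) x) -> integ f <= B * (M *+ 2) ^+ n.
Proof.
move=> cf M0 B0 f0 fB; have mc := @measurable_cube R n M.
rewrite -lee_fin -I_EFin//.
have -> : (B * (M *+ 2) ^+ n)%:E =
    (\int[lebesgue_rV n]_x (B * \1_(cube M) x)%:E)%E.
  under eq_integral do rewrite EFinM.
  rewrite ge0_integralZl//; last first.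
    by apply/measurable_EFinP; exact: measurable_indic.
  by rewrite integral_indic// setIT [X in (_ * X)%E](cube_measure M0) EFinM.
apply: ge0_le_integral => //.
- by move=> y _; rewrite lee_fin.
- by apply/measurable_EFinP; apply: continuous_measurable_rV; exact: cf.1.
- by apply/measurable_EFinP; apply: measurable_funM => //; exact: measurable_indic.
- by move=> y _; rewrite lee_fin.
Qed.

End integral.

(** * Fubini and the vanishing integral of a derivative *)

Section one_dimension.
Context {R : realType}.

Lemma integral_derive_bsupp (g dg : R -> R) (M : R) :
  (forall a : R, is_derive a 1 g (dg a)) -> continuous dg ->
  (forall a, M < `|a| -> g a = 0) -> (forall a, M < `|a| -> dg a = 0) ->
  (\int[@lebesgue_measure R]_a (dg a)%:E = 0)%E.
Proof.
move=> dgP cdg g0 dg0; pose N : R := Num.max M 0 + 1.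
have N0 : 0 < N by rewrite /N ltr_wpDl// le_max lexx orbT.
have MN : M < N by rewrite /N ltr_pwDr// le_max lexx.
rewrite (_ : (\int[_]_a _)%E =
    (\int[lebesgue_measure]_(a in `[(- N)%R, N]) (dg a)%:E)%E); last first.
  rewrite [RHS]integral_mkcond; apply: eq_integral => a _; rewrite patchE.
  case: ifPn => //; rewrite notin_setE/= in_itv/= => /negP.
  rewrite -ler_norml -ltNge => Na; rewrite dg0//.
  exact: lt_trans Na.
rewrite (@continuous_FTC2 _ _ g)//.
- by rewrite g0 ?g0 ?subee// ?normrN gtr0_norm.
- by lra.
- exact: continuous_subspaceT.
- split.
  + by move=> a _; exact: ex_derive.
  + apply: cvg_at_right_filter; apply: differentiable_continuous.
    exact/derivable1_diffP/ex_derive.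
  + apply: cvg_at_left_filter; apply: differentiable_continuous.
    exact/derivable1_diffP/ex_derive.
- by move=> a _; rewrite derive1E; exact: derive_val.
Qed.

End one_dimension.

Section fubini.
Context {R : realType} {n : nat}.
Implicit Type f : 'rV[R]_n.+1 -> R.

Lemma cons_rVE0 (a : R) (y : 'rV[R]_n) : cons_rV (a, y) 0 ord0 = a.
Proof. exact: (@coor_cons0 R n (a, y)). Qed.

Lemma cons_rVES (a : R) (y : 'rV[R]_n) j : cons_rV (a, y) 0 (lift ord0 j) = y 0 j.
Proof. exact: (@coor_consS R n (a, y) j). Qed.

Lemma rV_subE m (x y : 'rV[R]_m) i : (x - y) 0 i = x 0 i - y 0 i.
Proof. by rewrite !mxE. Qed.

Lemma rV_addE m (x y : 'rV[R]_m) i : (x + y) 0 i = x 0 i + y 0 i.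
Proof. by rewrite !mxE. Qed.

Lemma rV_scaleE m c (x : 'rV[R]_m) i : (c *: x) 0 i = c * x 0 i.
Proof. by rewrite !mxE. Qed.

Lemma continuous_rV (T : normedModType R) m (F : T -> 'rV[R]_m) :
  (forall x e, 0 < e -> \forall y \near x, forall i, `|F x 0 i - F y 0 i| <= e) ->
  continuous F.
Proof.
move=> h x; apply: (@cvgrPdist_le _ _ _ (nbhs x) (nbhs_filter x) F (F x)).2.
move=> e e0; apply: filterS (h x e e0) => y hy.
by apply: rV_norm_le => [|i]; [exact: ltW|rewrite rV_subE].
Qed.

Lemma near_dist_le (T : normedModType R) (x : T) e :
  0 < e -> \forall y \near x, `|x - y| <= e.
Proof.
move=> e0; apply: (@cvgrPdist_le _ _ _ (nbhs x) (nbhs_filter x) id x).1 => //.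
Qed.

Lemma cons_rV_cont1 (y : 'rV[R]_n) : continuous (fun a : R => cons_rV (a, y)).
Proof.
apply: continuous_rV => a e e0.
apply: filterS (near_dist_le a e0) => b hb i.
have [j ->|->] := unliftP ord0 i.
  by rewrite !cons_rVES subrr normr0 ltW.
by rewrite !cons_rVE0.
Qed.

Lemma cons_rV_cont2 (a : R) : continuous (fun y : 'rV[R]_n => cons_rV (a, y)).
Proof.
apply: continuous_rV => y e e0.
apply: filterS (near_dist_le y e0) => z hz i.
have [j ->|->] := unliftP ord0 i.
  by rewrite !cons_rVES -rV_subE (le_trans _ hz)// rV_coord_le_norm.
by rewrite !cons_rVE0 subrr normr0 ltW.
Qed.

Let g f (z : measurableTypeR R * 'rV[R]_n) : \bar R := (f (cons_rV z))%:E.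

Let integrable_cons f : cbs f ->
  (@lebesgue_measure R \x lebesgue_rV n)%E.-integrable setT (g f).
Proof.
move=> cf; have := cbs_integrable cf => /integrableP[mf foo].
have mg : measurable_fun setT (g f).
  apply: (measurableT_comp (f := EFin \o f)) => //; exact: measurable_cons_rV.
apply/integrableP; split => //.
move: foo; rewrite /= ge0_integral_pushforward//.
  exact: measurable_cons_rV.
exact: (measurableT_comp (@abse_measurable R setT) mf).
Qed.

Let I_cons f : cbs f -> (integ f)%:E =
  (\int[@lebesgue_measure R \x lebesgue_rV n]_z g f z)%E.
Proof.
move=> cf; have := cbs_integrable cf => /integrableP[mf foo].
rewrite -I_EFin//= (@integral_pushforward _ _ _ _ _ _ _ _ setT (EFin \o f))//.
  exact: measurable_cons_rV.
exact: integrable_cons.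
Qed.

Lemma I_slice0 f : cbs f ->
  (forall y : 'rV[R]_n, \int[@lebesgue_measure R]_a (f (cons_rV (a, y)))%:E = 0)%E ->
  integ f = 0.
Proof.
move=> cf h; apply: EFin_inj; rewrite I_cons//.
rewrite -integral21_prod_meas1; last exact: integrable_cons.
by apply: integral0_eq => y _; exact: h.
Qed.

Lemma I_sliceS f : cbs f ->
  (forall a : R, integ (fun y : 'rV[R]_n => f (cons_rV (a, y))) = 0) ->
  integ f = 0.
Proof.
move=> cf h; apply: EFin_inj; rewrite I_cons//.
rewrite -integral12_prod_meas1; last exact: integrable_cons.
apply: integral0_eq => a _; rewrite /fubini_F /g I_EFin ?h//; split.
  move=> y; apply: continuous_comp; [exact: cons_rV_cont2|exact: cf.1].
have [_ [M hM]] := cf; exists M => x i hi; apply: (hM _ (lift ord0 i)).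
by rewrite cons_rVES.
Qed.

End fubini.

Section divergence.
Context {R : realType}.

Lemma is_derive_line n (f : 'rV[R]_n -> R) (i : 'I_n) x t :
  derivable f (x + t *: delta_mx 0 i) (delta_mx 0 i) ->
  is_derive t 1 (fun s => f (x + s *: delta_mx 0 i))
    (partial i f (x + t *: delta_mx 0 i)).
Proof.
rewrite /partial /derivable /derive => df.
have E : (fun h : R => h^-1 *: (((fun s => f (x + s *: delta_mx 0 i)) \o shift t)
    (h *: (1 : R)) - (fun s => f (x + s *: delta_mx 0 i)) t)) =
  (fun h : R => h^-1 *: ((f \o shift (x + t *: delta_mx 0 i))
    (h *: delta_mx 0 i) - f (x + t *: delta_mx 0 i))).
  apply/funext => h /=; congr (_ *: (f _ - _)).
  by rewrite [h *: 1]mulr1 scalerDl addrCA addrA.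
apply: DeriveDef; rewrite /derivable /derive E //.
Qed.

(** Induction on the dimension, along the iterated product that defines the measure. A derivative in
    a later coordinate is treated on the slices with fixed first coordinate; one in the first
    coordinate integrates to 0 on every line, by the fundamental theorem of calculus. *)
Lemma I_partial n (f : 'rV[R]_n -> R) (i : 'I_n) : cbs f -> cbs (partial i f) ->
  (forall x, derivable f x (delta_mx 0 i)) -> integ (partial i f) = 0.
Proof.
elim: n f i => [f []//|n IH f i cf cdf df].
have : (exists j : 'I_n, i = lift ord0 j) \/ i = ord0.
  by have [j ->|->] := unliftP ord0 i; [left; exists j|right].
move=> ij; move: ij cdf df => [[j ->]|->] cdf df.
  apply: I_sliceS => // a.
  have consD y h : cons_rV (a, h *: delta_mx 0 j + y) =
      h *: delta_mx 0 (lift ord0 j) + cons_rV (a, y).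
    apply/rowP => k; rewrite rV_addE rV_scaleE.
    have [l ->|->] := unliftP ord0 k.
      by rewrite !cons_rVES rV_addE rV_scaleE !mxE (inj_eq lift_inj).
    by rewrite !cons_rVE0 mxE /= mulr0 add0r.
  have Q y : (fun h : R => h^-1 *: (((fun y => f (cons_rV (a, y))) \o shift y)
        (h *: delta_mx 0 j) - f (cons_rV (a, y)))) =
      (fun h : R => h^-1 *: ((f \o shift (cons_rV (a, y)))
        (h *: delta_mx 0 (lift ord0 j)) - f (cons_rV (a, y)))).
    by apply/funext => h /=; rewrite consD.
  have E1 y : partial (lift ord0 j) f (cons_rV (a, y)) =
      partial j (fun y => f (cons_rV (a, y))) y.
    by rewrite /partial /derive Q.
  under eq_fun do rewrite E1.
  have bs g : cbs g -> cbs (fun y => g (cons_rV (a, y))).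
    move=> cg; split.
      move=> y; apply: continuous_comp; [exact: cons_rV_cont2|exact: cg.1].
    have [_ [M hM]] := cg; exists M => x k hk; apply: (hM _ (lift ord0 k)).
    by rewrite cons_rVES.
  apply: IH; first exact: bs.
    rewrite (_ : partial _ _ = (fun y => partial (lift ord0 j) f (cons_rV (a, y)))).
      exact: bs.
    by apply/funext => y; rewrite E1.
  by move=> y; rewrite /derivable Q; exact: df.
apply: I_slice0 => // y; have [_ [M hM]] := cf; have [_ [N hN]] := cdf.
have consE b : cons_rV (b, y) = cons_rV (0, y) + b *: delta_mx 0 ord0.
  apply/rowP => k; rewrite rV_addE rV_scaleE.
  have [l ->|->] := unliftP ord0 k.
    by rewrite !cons_rVES mxE /= mulr0 addr0.
  by rewrite !cons_rVE0 mxE /= mulr1 add0r.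
apply: (@integral_derive_bsupp _ (fun a => f (cons_rV (a, y))) _ (Num.max M N)).
- move=> a; under eq_fun do rewrite consE.
  by rewrite (consE a); apply: (@is_derive_line n.+1 f ord0 (cons_rV (0, y)) a); exact: df.
- move=> b; apply: (@continuous_comp _ _ _ (fun b => cons_rV (b, y))).
    exact: cons_rV_cont1.
  exact: cdf.1.
- move=> a; rewrite gt_max => /andP[Ma _]; apply: (hM _ ord0).
  by rewrite cons_rVE0.
- move=> a; rewrite gt_max => /andP[_ Na]; apply: (hN _ ord0).
  by rewrite cons_rVE0.
Qed.

End divergence.

(** * Calculus of C^k functions *)

Section classC.
Context {R : realType} {n : nat}.
Implicit Types (f g h : 'rV[R]_n -> R) (k : nat).
Notation "''e_' i" := (delta_mx 0 i : 'rV[R]_n).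

Lemma partials_rcons s i f : partials (rcons s i) f = partials s (partial i f).
Proof. by rewrite /partials -cats1 foldr_cat. Qed.

Record Ck k f : Prop := MkCk { CkP : class_C k f }.

Lemma Ck0 f : Ck 0 f <-> continuous f.
Proof.
split => [[/(_ [::] isT)[]//]|cf]; split=> s; rewrite leqn0 size_eq0 => /eqP ->.
by split.
Qed.

(** Recursive form of the class, which turns the closure properties into inductions on k. In
    [partials] the last index of the list is differentiated first, hence the induction from the
    right end. *)
Lemma CkS k f : Ck k.+1 f <-> continuous f /\
  forall i, (forall x, derivable f x 'e_i) /\ Ck k (partial i f).
Proof.
split=> [[Cf]|[cf Cf]].
  split=> [|i]; first by have [] := Cf [::] isT.
  split=> [x|]; first by have [_ /(_ isT)] := Cf [::] isT; exact.
  split=> s sk; have := Cf (rcons s i); rewrite size_rcons partials_rcons ltnS.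
  by move=> /(_ sk)[? h]; split.
split; elim/last_ind => [_|s i _]; first by split => // _ i x; exact: (Cf i).1.
rewrite size_rcons partials_rcons ltnS => sk.
by have [_ [/(_ s sk)[? h]]] := Cf i; split.
Qed.

Lemma Ck_le j k f : (j <= k)%N -> Ck k f -> Ck j f.
Proof.
move=> jk [Cf]; split=> s sj; have [? h] := Cf s (leq_trans sj jk); split => // ?.
by apply: h; exact: leq_trans jk.
Qed.

Lemma Ck_cont k f : Ck k f -> continuous f.
Proof. by move/(Ck_le (leq0n _))/Ck0. Qed.

Lemma Ck_derivable k f i x : Ck k.+1 f -> derivable f x 'e_i.
Proof. by move/CkS => [_ /(_ i)[]]. Qed.

Lemma Ck_partial k f i : Ck k.+1 f -> Ck k (partial i f).
Proof. by move/CkS => [_ /(_ i)[]]. Qed.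

Lemma partial_add f g i x : derivable f x 'e_i -> derivable g x 'e_i ->
  partial i (fun x => f x + g x) x = partial i f x + partial i g x.
Proof. exact: deriveD. Qed.

Lemma partial_opp f i x : derivable f x 'e_i ->
  partial i (fun x => - f x) x = - partial i f x.
Proof. exact: deriveN. Qed.

Lemma partial_mul f g i x : derivable f x 'e_i -> derivable g x 'e_i ->
  partial i (fun x => f x * g x) x = f x * partial i g x + g x * partial i f x.
Proof. exact: deriveM. Qed.

Lemma partial_cst (c : R) i x : partial i (fun _ : 'rV[R]_n => c) x = 0.
Proof. exact: derive_cst. Qed.

Lemma Ck_cst k (c : R) : Ck k (fun _ : 'rV[R]_n => c).
Proof.
elim: k c => [|k IH] c; first by apply/Ck0; exact: cont_cst.
apply/CkS; split=> [|i]; first exact: cont_cst.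
split=> [x|]; first exact: derivable_cst.
by rewrite (_ : partial _ _ = fun=> 0)//; apply/funext => x; exact: partial_cst.
Qed.

Lemma Ck_add k f g : Ck k f -> Ck k g ->
  Ck k (fun x => f x + g x).
Proof.
elim: k f g => [|k IH] f g.
  by move=> /Ck0 ? /Ck0 ?; apply/Ck0; exact: cont_add.
move=> Cf Cg; apply/CkS; split=> [|i].
  by apply: cont_add; [exact: Ck_cont Cf|exact: Ck_cont Cg].
split=> [x|].
  by apply: derivableD; [exact: Ck_derivable Cf|exact: Ck_derivable Cg].
rewrite (_ : partial _ _ = fun x => partial i f x + partial i g x).
  by apply: IH; exact: Ck_partial.
by apply/funext => x; apply: partial_add;
  [exact: Ck_derivable Cf|exact: Ck_derivable Cg].
Qed.

Lemma Ck_mul k f g : Ck k f -> Ck k g ->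
  Ck k (fun x => f x * g x).
Proof.
elim: k f g => [|k IH] f g.
  by move=> /Ck0 ? /Ck0 ?; apply/Ck0; exact: cont_mul.
move=> Cf Cg; apply/CkS; split=> [|i].
  by apply: cont_mul; [exact: Ck_cont Cf|exact: Ck_cont Cg].
split=> [x|].
  by apply: derivableM; [exact: Ck_derivable Cf|exact: Ck_derivable Cg].
rewrite (_ : partial _ _ = fun x => f x * partial i g x + g x * partial i f x).
  apply: Ck_add; apply: IH.
  - exact: Ck_le (leqnSn k) Cf.
  - exact: Ck_partial Cg.
  - exact: Ck_le (leqnSn k) Cg.
  - exact: Ck_partial Cf.
by apply/funext => x; apply: partial_mul;
  [exact: Ck_derivable Cf|exact: Ck_derivable Cg].
Qed.

Lemma Ck_opp k f : Ck k f -> Ck k (fun x => - f x).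
Proof.
move=> Cf; rewrite (_ : (fun x => _) = fun x => (-1) * f x).
  by apply: Ck_mul => //; exact: Ck_cst.
by apply/funext => x; rewrite mulN1r.
Qed.

Lemma Ck_sub k f g : Ck k f -> Ck k g ->
  Ck k (fun x => f x - g x).
Proof. by move=> Cf Cg; apply: Ck_add => //; exact: Ck_opp. Qed.

Lemma Ck_scale k c f : Ck k f -> Ck k (fun x => c * f x).
Proof. by move=> Cf; apply: Ck_mul => //; exact: Ck_cst. Qed.

Lemma Ck_exp k f m : Ck k f -> Ck k (fun x => f x ^+ m).
Proof.
move=> Cf; elim: m => [|m IH]; first exact: Ck_cst.
rewrite (_ : (fun x => _) = fun x => f x * f x ^+ m); first exact: Ck_mul.
by apply/funext => x; rewrite exprS.
Qed.

Lemma Ck_sum k (J : Type) (r : seq J) (F : J -> 'rV[R]_n -> R) :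
  (forall i, Ck k (F i)) -> Ck k (fun x => \sum_(i <- r) F i x).
Proof.
move=> cF; elim: r => [|i r IH].
  by under eq_fun do rewrite big_nil; exact: Ck_cst.
by under eq_fun do rewrite big_cons; exact: Ck_add.
Qed.

Lemma is_derive_coord (j i : 'I_n) x :
  is_derive x 'e_i (fun x : 'rV[R]_n => x 0 j) (i == j)%:R.
Proof.
have did : derivable (id : 'rV[R]_n -> 'rV[R]_n) x 'e_i by exact: derivable_id.
apply: DeriveDef; first by have /derivable_mxP := did; exact.
have := derive_mx did; rewrite derive_id => /matrixP/(_ 0 j).
by rewrite !mxE eqxx /= eq_sym => <-.
Qed.

Lemma cont_coord (j : 'I_n) : continuous (fun x : 'rV[R]_n => x 0 j).
Proof. exact: coord_continuous. Qed.

Lemma Ck_coord k (j : 'I_n) : Ck k (fun x : 'rV[R]_n => x 0 j).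
Proof.
case: k => [|k]; first by apply/Ck0; exact: cont_coord.
apply/CkS; split=> [|i]; first exact: cont_coord.
split=> [x|]; first exact: (@ex_derive _ _ _ _ _ _ _ (is_derive_coord j i x)).
rewrite (_ : partial _ _ = fun=> (i == j)%:R); first exact: Ck_cst.
by apply/funext => x; exact: (@derive_val _ _ _ _ _ _ _ (is_derive_coord j i x)).
Qed.

Lemma line_quotient f x v :
  (fun h : R => h^-1 *: (((fun s => f (s *: v + x)) \o shift 0) (h *: (1 : R)) -
     f (0 *: v + x))) =
  (fun h : R => h^-1 *: ((f \o shift x) (h *: v) - f x)).
Proof.
by apply/funext => h /=; rewrite scale0r add0r addr0 [h *: 1]mulr1.
Qed.

(** A directional derivative is the derivative at 0 of the restriction to a line, so the chain rule
    in one variable suffices. *)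
Lemma is_derive_comp (F : R -> R) f x v d df :
  is_derive (f x) 1 F d -> is_derive x v f df ->
  is_derive x v (fun x => F (f x)) (d * df).
Proof.
move=> FP fP.
have lP : is_derive (0 : R) 1 (fun s : R => f (s *: v + x)) df.
  by apply: DeriveDef; rewrite /derivable /derive line_quotient; case: fP.
have : is_derive (0 : R) 1 (F \o (fun s : R => f (s *: v + x))) (d * df).
  by apply: is_derive1_comp => //; rewrite scale0r add0r.
move=> [h1 h2]; apply: DeriveDef.
  by move: h1; rewrite /derivable (line_quotient (fun x => F (f x))).
by move: h2; rewrite /derive (line_quotient (fun x => F (f x))).
Qed.

(** Class C^k relative to a set containing the values of the inner function: the positive half-line
    for real powers, the whole line for truncated ones. *)
Fixpoint Cd k (D : set R) (F : R -> R) : Prop :=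
  (forall y, D y -> {for y, continuous F}) /\
  if k is k'.+1 then
    exists2 F', (forall y, D y -> is_derive y 1 F (F' y)) & Cd k' D F'
  else True.

Lemma Ck_comp k D F f : Cd k D F -> Ck k f -> (forall x, D (f x)) ->
  Ck k (fun x => F (f x)).
Proof.
move=> + + Df; elim: k F => [|k IH] F /= [cF].
  move=> _ /Ck0 cf; apply/Ck0 => x.
  by apply: continuous_comp; [exact: cf|exact: cF].
move=> [F' dF CF'] Cf; apply/CkS; split=> [x|i].
  by apply: continuous_comp; [exact: (Ck_cont Cf)|exact: cF].
have dFf x : is_derive x 'e_i (fun x => F (f x)) (F' (f x) * partial i f x).
  apply: is_derive_comp; first exact: dF.
  by apply: DeriveDef => //; exact: Ck_derivable Cf.
split=> [x|]; first exact: (@ex_derive _ _ _ _ _ _ _ (dFf x)).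
rewrite (_ : partial _ _ = fun x => F' (f x) * partial i f x).
  apply: Ck_mul; last exact: Ck_partial.
  by apply: IH => //; exact: Ck_le Cf.
by apply/funext => x; exact: (@derive_val _ _ _ _ _ _ _ (dFf x)).
Qed.

Lemma partial_comp F f i x d : is_derive (f x) 1 F d -> derivable f x 'e_i ->
  partial i (fun x => F (f x)) x = d * partial i f x.
Proof.
move=> dF df; have dfP : is_derive x 'e_i f (partial i f x) by exact: DeriveDef.
exact: (@derive_val _ _ _ _ _ _ _ (is_derive_comp dF dfP)).
Qed.

Lemma derivable_comp F f i x d : is_derive (f x) 1 F d -> derivable f x 'e_i ->
  derivable (fun x => F (f x) : R) x 'e_i.
Proof.
move=> dF df; have dfP : is_derive x 'e_i f (partial i f x) by exact: DeriveDef.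
exact: (@ex_derive _ _ _ _ _ _ _ (is_derive_comp dF dfP)).
Qed.

Lemma bsupp_partial f i : bsupp f -> bsupp (partial i f).
Proof.
move=> [M hM]; exists M => x j xj.
rewrite /partial (_ : 'D_'e_i f x = 'D_'e_i (fun=> 0) x); first exact: derive_cst.
apply: near_eq_derive.
have cj : continuous (fun y : 'rV[R]_n => `|y 0 j|).
  by apply: cont_norm; exact: cont_coord.
have /cvgr_gt/(_ _ xj) := cj x.
by apply: filterS => y /hM.
Qed.

End classC.

(** * Real powers and truncated powers of one variable *)

Section one_variable.
Context {R : realType}.

Lemma is_derive1_cont (F : R -> R) (y d : R) :
  is_derive y 1 F d -> {for y, continuous F}.
Proof.
by move=> h; apply: differentiable_continuous; apply/derivable1_diffP/ex_derive.
Qed.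

Lemma is_derive_powR_scale (c a y : R) : 0 < y ->
  is_derive y 1 (fun y => c * y `^ a) (c * a * y `^ (a - 1)).
Proof.
move=> y0; have := is_derive1_powR a y0 => h.
have := @is_deriveZ _ _ _ _ c y 1 _ h.
by rewrite -mulrA.
Qed.

Lemma Cd_powR k (c a : R) : Cd k [set y | 0 < y] (fun y => c * y `^ a).
Proof.
elim: k c a => [|k IH] c a /=.
  split => // y y0; apply: is_derive1_cont; exact: is_derive_powR_scale.
split; first by move=> y y0; apply: is_derive1_cont; exact: is_derive_powR_scale.
exists (fun y => c * a * y `^ (a - 1)); last exact: IH.
by move=> y y0; exact: is_derive_powR_scale.
Qed.

(** Truncated power, of class C^(m-1) for m > 0: a cube is the cheapest one usable under a
    Laplacian. *)
Definition ppow (m : nat) (y : R) : R := Num.max 0 y ^+ m.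

Lemma ppow_ge0 m y : 0 <= ppow m y.
Proof. by rewrite exprn_ge0// le_max lexx. Qed.

Lemma ppow_pos m y : 0 <= y -> ppow m y = y ^+ m.
Proof. by move=> y0; rewrite /ppow max_r. Qed.

Lemma ppow_neg m y : y <= 0 -> ppow m.+1 y = 0.
Proof. by move=> y0; rewrite /ppow max_l// expr0n. Qed.

Lemma cont_max0 : continuous (fun y : R => Num.max 0 y).
Proof.
rewrite (_ : (fun y => _) = fun y : R => 2^-1 * (y + `|y|)).
  apply: cont_mul; first exact: cont_cst.
  apply: cont_add; first by move=> x; exact: cvg_id.
  by apply: cont_norm => x; exact: cvg_id.
by apply/funext => y; rewrite maxr_absE add0r sub0r normrN mulrC.
Qed.

Lemma ppow_cont m : continuous (ppow m).
Proof. by apply: cont_exp; exact: cont_max0. Qed.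

Lemma is_derive_ppow m (y : R) : is_derive y 1 (ppow m.+2) (m.+2%:R * ppow m.+1 y).
Proof.
have [y0|y0|->] := ltrgt0P y.
- rewrite ppow_pos ?ltW//.
  apply: (near_eq_is_derive (f := fun y : R => y ^+ m.+2)).
  + near=> z; rewrite ppow_pos//.
    by apply/ltW; near: z; exact: lt_nbhsr.
  + apply: DeriveDef; first exact: exprn_derivable.
    by rewrite exp_derive [LHS]mulr1.
- rewrite ppow_neg ?ltW// mulr0.
  apply: (near_eq_is_derive (f := fun y : R => 0 : R)).
  near=> z; rewrite ppow_neg//.
  by apply/ltW; near: z; exact: lt_nbhsl.
rewrite ppow_neg// mulr0.
(* At the corner the difference quotient is at most |h|^(m+1) in absolute value, hence at most |h|
   once |h| <= 1. *)
have H : (fun h : R => h^-1 *: ((ppow m.+2 \o shift 0) (h *: (1 : R)) - ppow m.+2 0))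
    @ 0^' --> (0 : R).
  apply/cvgrPdist_le => e e0; near=> h.
  have h1 : `|h| <= 1 by near: h; apply: dnbhs0_le.
  have he : `|h| <= e by near: h; apply: dnbhs0_le.
  have h0 : h != 0 by near: h; exact: nbhs_dnbhs_neq.
  rewrite /= (ppow_neg _ (lexx 0)) subr0 addr0 sub0r normrN [h *: 1]mulr1 normrM.
  rewrite normfV ler_pdivrMl ?normr_gt0//.
  rewrite /ppow normrX ger0_norm ?le_max ?lexx//.
  have hm : Num.max 0 h <= `|h| by rewrite ge_max normr_ge0 ler_norm.
  have hm0 : 0 <= Num.max 0 h by rewrite le_max lexx.
  rewrite exprS; apply: ler_pM => //; first exact: exprn_ge0.
  apply: le_trans he; rewrite exprS; apply: (@le_trans _ _ (Num.max 0 h * 1)).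
    by apply: ler_wpM2l => //; apply: exprn_ile1 => //; exact: le_trans h1.
  by rewrite mulr1.
apply: DeriveDef; first by apply/cvg_ex; exists 0.
exact/cvg_lim.
Unshelve. all: by end_near. Qed.

Lemma Cd_ppow k (c : R) m : (k < m)%N -> Cd k setT (fun y => c * ppow m y).
Proof.
have cont c' m' y : {for y, continuous (fun y => c' * ppow m' y)}.
  by apply: cont_mul; [exact: cont_cst|exact: ppow_cont].
elim: k c m => [c m _|k IH c [//|m] km].
  by split=> // y _; exact: cont.
split=> [y _|]; first exact: cont.
case: m km => // m km.
exists (fun y => c * m.+2%:R * ppow m.+1 y); last exact: IH.
move=> y _; have := @is_deriveZ _ _ _ _ c y 1 _ (is_derive_ppow m y).
by rewrite -mulrA.
Qed.

End one_variable.

(** * Gradient products, Laplacians and Green's formula *)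

HB.lock Definition grad2 (R : realType) (n : nat) (f g : 'rV[R]_n -> R)
  (x : 'rV[R]_n) : R := \sum_(i < n) partial i f x * partial i g x.

HB.lock Definition lap (R : realType) (n : nat) (f : 'rV[R]_n -> R)
  (x : 'rV[R]_n) : R := laplacian f x.

Section operators.
Context {R : realType} {n : nat}.
Implicit Types (f g h : 'rV[R]_n -> R) (k : nat) (x : 'rV[R]_n).

Lemma grad2E f g x : grad2 f g x = \sum_(i < n) partial i f x * partial i g x.
Proof. by rewrite grad2.unlock. Qed.

Lemma lapE f x : lap f x = \sum_(i < n) partial i (partial i f) x.
Proof. by rewrite lap.unlock. Qed.

Lemma laplacianE f : laplacian f = lap f.
Proof. by apply/funext => x; rewrite lap.unlock. Qed.

Lemma grad2_fE f g : grad2 f g = fun x => \sum_(i < n) partial i f x * partial i g x.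
Proof. by apply/funext => x; exact: grad2E. Qed.

Lemma lap_fE f : lap f = fun x => \sum_(i < n) partial i (partial i f) x.
Proof. by apply/funext => x; exact: lapE. Qed.

Lemma Ck_grad2 k f g : Ck k.+1 f -> Ck k.+1 g -> Ck k (grad2 f g).
Proof.
by move=> Cf Cg; rewrite grad2_fE; apply: Ck_sum => i; apply: Ck_mul; exact: Ck_partial.
Qed.

Lemma Ck_lap k f : Ck k.+2 f -> Ck k (lap f).
Proof.
by move=> Cf; rewrite lap_fE; apply: Ck_sum => i; apply: Ck_partial; exact: Ck_partial.
Qed.

Lemma grad2C f g x : grad2 f g x = grad2 g f x.
Proof. by rewrite !grad2E; apply: eq_bigr => i _; rewrite mulrC. Qed.

Lemma grad2_ge0 f x : 0 <= grad2 f f x.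
Proof. by rewrite grad2E; apply: sumr_ge0 => i _; rewrite -expr2 sqr_ge0. Qed.

Lemma grad2_mull f g h x : Ck 1 f -> Ck 1 g ->
  grad2 (fun x => f x * g x) h x = f x * grad2 g h x + g x * grad2 f h x.
Proof.
move=> Cf Cg; rewrite !grad2E !mulr_sumr -big_split/=; apply: eq_bigr => i _.
rewrite partial_mul; [ring|exact: Ck_derivable Cf|exact: Ck_derivable Cg].
Qed.

Lemma grad2_mulr f g h x : Ck 1 f -> Ck 1 g ->
  grad2 h (fun x => f x * g x) x = f x * grad2 h g x + g x * grad2 h f x.
Proof. by move=> Cf Cg; rewrite grad2C grad2_mull// ![grad2 h _ _]grad2C. Qed.

Lemma grad2_addl f g h x : Ck 1 f -> Ck 1 g ->
  grad2 (fun x => f x + g x) h x = grad2 f h x + grad2 g h x.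
Proof.
move=> Cf Cg; rewrite !grad2E -big_split/=; apply: eq_bigr => i _.
rewrite partial_add; [ring|exact: Ck_derivable Cf|exact: Ck_derivable Cg].
Qed.

Lemma grad2_addr f g h x : Ck 1 f -> Ck 1 g ->
  grad2 h (fun x => f x + g x) x = grad2 h f x + grad2 h g x.
Proof. by move=> Cf Cg; rewrite grad2C grad2_addl// ![grad2 h _ _]grad2C. Qed.

Lemma grad2_cstl c h x : grad2 (fun=> c) h x = 0.
Proof. by rewrite !grad2E big1// => i _; rewrite partial_cst mul0r. Qed.

Lemma grad2_cstr c h x : grad2 h (fun=> c) x = 0.
Proof. by rewrite grad2C grad2_cstl. Qed.

Lemma grad2_scalel c f h x : Ck 1 f ->
  grad2 (fun x => c * f x) h x = c * grad2 f h x.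
Proof.
move=> Cf; rewrite grad2_mull//; last exact: Ck_cst.
by rewrite grad2_cstl mulr0 addr0.
Qed.

Lemma grad2_scaler c f h x : Ck 1 f ->
  grad2 h (fun x => c * f x) x = c * grad2 h f x.
Proof. by move=> Cf; rewrite grad2C grad2_scalel// grad2C. Qed.

Lemma grad2_oppl f h x : Ck 1 f -> grad2 (fun x => - f x) h x = - grad2 f h x.
Proof.
move=> Cf; rewrite !grad2E -sumrN; apply: eq_bigr => i _.
by rewrite partial_opp ?mulNr//; exact: Ck_derivable Cf.
Qed.

Lemma grad2_oppr f h x : Ck 1 f -> grad2 h (fun x => - f x) x = - grad2 h f x.
Proof. by move=> Cf; rewrite grad2C grad2_oppl// grad2C. Qed.

Lemma grad2_compl (F : R -> R) f h x d : is_derive (f x) 1 F d -> Ck 1 f ->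
  grad2 (fun x => F (f x)) h x = d * grad2 f h x.
Proof.
move=> dF Cf; rewrite !grad2E mulr_sumr; apply: eq_bigr => i _.
by rewrite (partial_comp dF) ?mulrA//; exact: Ck_derivable Cf.
Qed.

Lemma grad2_CS f g x : grad2 f g x ^+ 2 <= grad2 f f x * grad2 g g x.
Proof.
set a := grad2 f f x; set b := grad2 f g x; set c := grad2 g g x.
have q t : 0 <= a * t ^+ 2 + 2 * b * t + c.
  rewrite (_ : _ + _ = \sum_(i < n) (t * partial i f x + partial i g x) ^+ 2).
    by apply: sumr_ge0 => i _; exact: sqr_ge0.
  rewrite /a /b /c !grad2E mulr_sumr !mulr_suml -!big_split/=.
  by apply: eq_bigr => i _; ring.
have a0 : 0 <= a := grad2_ge0 f x.
have [a_eq0|an0] := eqVneq a 0.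
  have [->|bn0] := eqVneq b 0; first by rewrite a_eq0 mul0r expr0n.
  (* For a = 0 the quadratic is affine, and at this t it equals -1. *)
  have := q (- (c + 1) / (2 * b)); rewrite a_eq0 mul0r add0r.
  rewrite (_ : 2 * b * _ = - (c + 1)); last by field.
  by move=> ?; exfalso; lra.
have {}a0 : 0 < a by rewrite lt_neqAle eq_sym an0.
have := q (- b / a).
rewrite (_ : _ + c = (a * c - b ^+ 2) / a); last by field; lra.
by rewrite pmulr_lge0 ?invr_gt0// subr_ge0.
Qed.

Lemma lap_add f g x : Ck 2 f -> Ck 2 g ->
  lap (fun x => f x + g x) x = lap f x + lap g x.
Proof.
move=> Cf Cg; rewrite !lapE -big_split/=; apply: eq_bigr => i _.
rewrite (_ : partial i (fun x => f x + g x) =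
    fun x => partial i f x + partial i g x).
  by rewrite partial_add//; apply: (@Ck_derivable _ _ 0); exact: Ck_partial.
by apply/funext => y; rewrite partial_add//;
  [exact: Ck_derivable Cf|exact: Ck_derivable Cg].
Qed.

Lemma lap_mul f g x : Ck 2 f -> Ck 2 g ->
  lap (fun x => f x * g x) x =
  f x * lap g x + g x * lap f x + 2 * grad2 f g x.
Proof.
move=> Cf Cg; have C1 := @Ck_le _ _ 1 2 _ isT.
have df := fun i y => @Ck_derivable R n 1 f i y Cf.
have dg := fun i y => @Ck_derivable R n 1 g i y Cg.
have ddf i y : derivable (partial i f) y (delta_mx 0 i).
  by apply: (@Ck_derivable _ _ 0); exact: Ck_partial.
have ddg i y : derivable (partial i g) y (delta_mx 0 i).
  by apply: (@Ck_derivable _ _ 0); exact: Ck_partial.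
rewrite !lapE !grad2E !mulr_sumr -!big_split/=; apply: eq_bigr => i _.
rewrite (_ : partial i (fun x => f x * g x) =
    fun x => f x * partial i g x + g x * partial i f x).
  have C1f : Ck 1 f := @Ck_le _ _ 1 2 _ isT Cf.
  have C1g : Ck 1 g := @Ck_le _ _ 1 2 _ isT Cg.
  have d1 := @Ck_derivable R n 0 _ i x (Ck_mul C1f (Ck_partial i Cg)).
  have d2 := @Ck_derivable R n 0 _ i x (Ck_mul C1g (Ck_partial i Cf)).
  rewrite (partial_add d1 d2).
  rewrite (partial_mul (df i x) (ddg i x)).
  rewrite (partial_mul (dg i x) (ddf i x)).
  move: (f x) (g x) (partial i f x) (partial i g x) (partial i (partial i f) x)
    (partial i (partial i g) x) => a b c d e t.
  by ring.
by apply/funext => y; rewrite partial_mul.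
Qed.

Lemma lap_cst c x : lap (fun=> c) x = 0.
Proof.
rewrite !lapE big1// => i _.
rewrite (_ : partial i (fun=> c) = fun=> 0); first exact: partial_cst.
by apply/funext => y; exact: partial_cst.
Qed.

Lemma lap_scale c f x : Ck 2 f ->
  lap (fun x => c * f x) x = c * lap f x.
Proof.
move=> Cf; rewrite lap_mul//; last exact: Ck_cst.
by rewrite lap_cst grad2_cstl !mulr0 !addr0.
Qed.

Lemma lap_opp f x : Ck 2 f ->
  lap (fun x => - f x) x = - lap f x.
Proof.
move=> Cf; rewrite (_ : (fun x => - f x) = fun x => (-1) * f x).
  by rewrite lap_scale// mulN1r.
by apply/funext => y; rewrite mulN1r.
Qed.

Lemma lap_comp (F F' : R -> R) (d : R) f x :
  (forall y, is_derive (f y) 1 F (F' (f y))) -> is_derive (f x) 1 F' d ->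
  Ck 2 f ->
  lap (fun x => F (f x)) x = F' (f x) * lap f x + d * grad2 f f x.
Proof.
move=> dF dF' Cf; have df := fun i y => @Ck_derivable R n 1 f i y Cf.
have ddf i y : derivable (partial i f) y (delta_mx 0 i).
  by apply: (@Ck_derivable _ _ 0); exact: Ck_partial.
rewrite !lapE !grad2E !mulr_sumr -!big_split/=; apply: eq_bigr => i _.
rewrite (_ : partial i (fun x => F (f x)) = fun x => F' (f x) * partial i f x).
  rewrite partial_mul//; last exact: derivable_comp dF' _.
  by rewrite (partial_comp dF')//; ring.
by apply/funext => y; rewrite (partial_comp (dF y)).
Qed.

Lemma bsupp_lap f : bsupp f -> bsupp (lap f).
Proof. by move=> bf; rewrite lap_fE; apply: bsupp_sum => i; do 2 apply: bsupp_partial. Qed.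

Lemma bsupp_grad2l f g : bsupp f -> bsupp (grad2 f g).
Proof.
by move=> bf; rewrite grad2_fE; apply: bsupp_sum => i; apply: bsupp_mulr; exact: bsupp_partial.
Qed.

Lemma bsupp_grad2r f g : bsupp g -> bsupp (grad2 f g).
Proof.
by move=> bf; rewrite grad2_fE; apply: bsupp_sum => i; apply: bsupp_mull; exact: bsupp_partial.
Qed.

Lemma partial_ibp f g i : Ck 1 f -> Ck 1 g -> bsupp f \/ bsupp g ->
  integ (fun x => f x * partial i g x) = - integ (fun x => partial i f x * g x).
Proof.
move=> Cf Cg bfg.
have cf := Ck_cont Cf; have cg := Ck_cont Cg.
have cdf := Ck_cont (Ck_partial i Cf); have cdg := Ck_cont (Ck_partial i Cg).
have c1 : cbs (fun x => f x * partial i g x).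
  split; first exact: cont_mul.
  by case: bfg => h; [apply: bsupp_mulr|apply: bsupp_mull; exact: bsupp_partial].
have c2 : cbs (fun x => partial i f x * g x).
  split; first exact: cont_mul.
  by case: bfg => h; [apply: bsupp_mulr; exact: bsupp_partial|apply: bsupp_mull].
apply/eqP; rewrite -addr_eq0 -I_add//; apply/eqP.
rewrite (_ : (fun x => _) = partial i (fun x => f x * g x)); last first.
  apply/funext => x; rewrite partial_mul; first by ring.
    exact: Ck_derivable Cf.
  exact: Ck_derivable Cg.
have C : Ck 1 (fun x => f x * g x) by exact: Ck_mul.
have b : bsupp (fun x => f x * g x).
  by case: bfg => h; [exact: bsupp_mulr|exact: bsupp_mull].
apply: I_partial.
- by split => //; exact: Ck_cont C.
- by split; [exact: Ck_cont (Ck_partial i C)|exact: bsupp_partial].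
- by move=> x; exact: Ck_derivable C.
Qed.

(** The divergence of f grad g. Its integral is 0 as soon as one factor has bounded support, so any
    multiple of it may be added to an integrand: this is how all later integrations by parts are
    carried out. *)
Definition green f g x := f x * lap g x + grad2 f g x.

Lemma cbs_green f g : Ck 1 f -> Ck 2 g -> bsupp f \/ bsupp g -> cbs (green f g).
Proof.
move=> Cf Cg bfg; split.
  apply: cont_add; last exact: Ck_cont (Ck_grad2 Cf (@Ck_le _ _ 1 2 _ isT Cg)).
  by apply: cont_mul; [exact: Ck_cont Cf|exact: Ck_cont (Ck_lap Cg)].
apply: bsupp_add.
  by case: bfg => h; [exact: bsupp_mulr|apply: bsupp_mull; exact: bsupp_lap].
by case: bfg => h; [exact: bsupp_grad2l|exact: bsupp_grad2r].
Qed.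

Lemma I_green f g : Ck 1 f -> Ck 2 g -> bsupp f \/ bsupp g -> integ (green f g) = 0.
Proof.
move=> Cf Cg bfg; have C1g := @Ck_le _ _ 1 2 _ isT Cg.
have cf := Ck_cont Cf.
have bfg' i : bsupp f \/ bsupp (partial i g).
  by case: bfg => h; [left|right; exact: bsupp_partial].
have c1 i : cbs (fun x => f x * partial i (partial i g) x).
  split.
    by apply: cont_mul => //; exact: Ck_cont (Ck_partial i (Ck_partial i Cg)).
  by case: bfg => h; [exact: bsupp_mulr|apply: bsupp_mull; do 2 apply: bsupp_partial].
have c2 i : cbs (fun x => partial i f x * partial i g x).
  split.
    apply: cont_mul; [exact: Ck_cont (Ck_partial i Cf)|].
    exact: Ck_cont (Ck_partial i C1g).
  by case: bfg => h; [apply: bsupp_mulr|apply: bsupp_mull]; exact: bsupp_partial.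
rewrite (_ : green f g = fun x => \sum_(i < n) (f x * partial i (partial i g) x +
    partial i f x * partial i g x)); last first.
  by apply/funext => x; rewrite /green lapE grad2E mulr_sumr -big_split.
rewrite I_sum; last by move=> i; exact: cbs_add.
rewrite big1// => i _; rewrite I_add// partial_ibp ?addNr//.
exact: Ck_partial.
Qed.

End operators.

(** * Stability for classical test functions *)

Section stability.
Context {R : realType} {n : nat}.
Implicit Types (phi u : 'rV[R]_n -> R).

Lemma L2_cbs phi : cbs phi -> L2 phi.
Proof.
move=> cphi; split; first by apply: continuous_measurable_rV; exact: cphi.1.
have c2 := cbs_exp 1 (conj (cont_norm cphi.1) (bsupp_norm cphi.2)).
rewrite /finite_norm unlock; apply: poweR_lty.
rewrite (eq_integral (fun x => (`|phi x| ^+ 2)%:E)).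
  by rewrite (I_EFin c2) ltry.
by move=> x _; rewrite /= powR_mulrn// normr_id.
Qed.

(** Integration by parts removes the outermost derivative of [psi] first, so the derivatives reach
    [phi] in reverse order; [rev s] records this and spares the symmetry of second derivatives. *)
Lemma weak_partials_cbs phi s : (size s <= 2)%N -> Ck 2 phi -> bsupp phi ->
  weak_partials s phi (partials (rev s) phi).
Proof.
move=> s2 Cphi bphi psi [Cpsi _].
have Ct k : Ck k psi by split.
have C1 := @Ck_le _ _ 1 2 _ isT Cphi.
case: s s2 => [|i [|j [|//]]] _ /=.
- by rewrite expr0 mul1r.
- have := @partial_ibp _ _ _ _ i C1 (Ct 1%N) (or_introl bphi).
  by rewrite !integE expr1 mulN1r.
- rewrite expr2 mulrNN !mul1r.
  have h1 := @partial_ibp _ _ _ _ i C1 (Ck_partial j (Ct 2)) (or_introl bphi).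
  rewrite !integE in h1; rewrite h1.
  have h2 := @partial_ibp _ _ _ _ j (Ck_partial i Cphi) (Ct 1%N)
    (or_introl (bsupp_partial i bphi)).
  by rewrite !integE in h2; rewrite h2 opprK.
Qed.

(** The point where stability on H^2 is exploited: a C^2 function with bounded support lies in H^2,
    its classical derivatives being its weak ones. *)
Lemma stable_ibp p u phi : stable p u -> continuous u -> (forall x, 0 < u x) ->
  Ck 2 phi -> bsupp phi ->
  p * integ (fun x => u x `^ (p - 1) * phi x ^+ 2) <=
  integ (fun x => lap phi x ^+ 2).
Proof.
move=> st cu u0 Cphi bphi.
have L2p s : (size s <= 2)%N -> L2 (partials s phi).
  case: s => [|i [|j [|//]]] _ /=; apply: L2_cbs; split => //.
  - exact: Ck_cont Cphi.
  - exact: Ck_cont (Ck_partial i Cphi).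
  - exact: bsupp_partial.
  - exact: Ck_cont (Ck_partial i (Ck_partial j Cphi)).
  - by do 2 apply: bsupp_partial.
have := st phi (laplacian phi); rewrite /Lambda.
rewrite laplacianE.
have cl : cbs (lap phi).
  by split; [exact: Ck_cont (Ck_lap Cphi)|exact: bsupp_lap].
have cp : cbs (fun x => u x `^ (p - 1) * phi x ^+ 2).
  apply: cbs_mull; last by apply: cbs_exp; split => //; exact: Ck_cont Cphi.
  have C0 : Ck 0 u by apply/Ck0.
  have := Ck_comp (Cd_powR 0 1 (p - 1)) C0 u0.
  by under eq_fun do rewrite mul1r; exact: Ck_cont.
have El x : (`|lap phi x| ^+ 2)%:E = (lap phi x ^+ 2)%:E.
  by rewrite -normrX ger0_norm// sqr_ge0.
under eq_integral do rewrite El.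
rewrite (I_EFin cp) (I_EFin (cbs_exp 1 cl)) -EFinM -EFinB lee_fin subr_ge0.
apply.
- split; first exact: (L2p [::]).
  move=> s s2; exists (partials (rev s) phi); last exact: weak_partials_cbs.
  by apply: L2p; rewrite size_rev.
- exists (fun i => partial i (partial i phi)); last exact: lap_fE.
  move=> i; split.
    exact: (L2p [:: i; i]).
  exact: (weak_partials_cbs (s := [:: i; i])).
Qed.

End stability.

(** * Chain rules for powers of functions *)

Section powers.
Context {R : realType} {n : nat}.
Implicit Types (f g h : 'rV[R]_n -> R) (x : 'rV[R]_n).

Lemma is_derive_exp m (y : R) :
  is_derive y 1 (fun y : R => y ^+ m.+1) (m.+1%:R * y ^+ m).
Proof.
apply: DeriveDef; first exact: exprn_derivable.
by rewrite exp_derive [LHS]mulr1.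
Qed.

Lemma is_derive_scale (c d y : R) (F : R -> R) :
  is_derive y 1 F d -> is_derive y 1 (fun y => c * F y) (c * d).
Proof. by move=> h; exact: (@is_deriveZ _ _ _ F c y 1 d h). Qed.

Lemma is_derive_powR (a y : R) : 0 < y ->
  is_derive y 1 (fun y => y `^ a) (a * y `^ (a - 1)).
Proof. exact: is_derive1_powR. Qed.

Lemma Ck_powR k f a : Ck k f -> (forall x, 0 < f x) -> Ck k (fun x => f x `^ a).
Proof.
move=> Cf f0; have := Ck_comp (Cd_powR k 1 a) Cf f0.
by under eq_fun do rewrite mul1r.
Qed.

Lemma Ck_ppow k f m : (k < m)%N -> Ck k f -> Ck k (fun x => ppow m (f x)).
Proof.
move=> km Cf; have := Ck_comp (Cd_ppow 1 km) Cf (fun=> Logic.I).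
by under eq_fun do rewrite mul1r.
Qed.

Lemma grad2_expl m f h x : Ck 1 f ->
  grad2 (fun x => f x ^+ m.+1) h x = m.+1%:R * f x ^+ m * grad2 f h x.
Proof.
exact: (@grad2_compl R n (fun y => y ^+ m.+1) f h x _ (is_derive_exp m (f x))).
Qed.

Lemma grad2_expr m f h x : Ck 1 f ->
  grad2 h (fun x => f x ^+ m.+1) x = m.+1%:R * f x ^+ m * grad2 h f x.
Proof. by move=> Cf; rewrite grad2C grad2_expl// grad2C. Qed.

Lemma lap_exp m f x : Ck 2 f ->
  lap (fun x => f x ^+ m.+2) x =
  m.+2%:R * f x ^+ m.+1 * lap f x +
  m.+2%:R * m.+1%:R * f x ^+ m * grad2 f f x.
Proof.
move=> Cf.
apply: (@lap_comp R n (fun y => y ^+ m.+2) (fun y => m.+2%:R * y ^+ m.+1)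
  (m.+2%:R * m.+1%:R * f x ^+ m)) => // [y|]; first exact: is_derive_exp.
by rewrite -mulrA; exact: is_derive_scale (is_derive_exp m (f x)).
Qed.

Lemma grad2_powRl a f h x : Ck 1 f -> (forall x, 0 < f x) ->
  grad2 (fun x => f x `^ a) h x = a * f x `^ (a - 1) * grad2 f h x.
Proof.
move=> Cf f0.
exact: (@grad2_compl R n (fun y => y `^ a) f h x _ (is_derive_powR a (f0 x))).
Qed.

Lemma lap_powR a f x : Ck 2 f -> (forall x, 0 < f x) ->
  lap (fun x => f x `^ a) x =
  a * f x `^ (a - 1) * lap f x +
  a * (a - 1) * f x `^ (a - 1 - 1) * grad2 f f x.
Proof.
move=> Cf f0.
apply: (@lap_comp R n (fun y => y `^ a) (fun y => a * y `^ (a - 1))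
  (a * (a - 1) * f x `^ (a - 1 - 1))) => // [y|]; first exact: is_derive_powR.
exact: is_derive_powR_scale.
Qed.

Lemma grad2_ppowl m f h x : Ck 1 f ->
  grad2 (fun x => ppow m.+2 (f x)) h x = m.+2%:R * ppow m.+1 (f x) * grad2 f h x.
Proof.
exact: (@grad2_compl R n (ppow m.+2) f h x _ (is_derive_ppow m (f x))).
Qed.

Lemma grad2_ppowr m f h x : Ck 1 f ->
  grad2 h (fun x => ppow m.+2 (f x)) x = m.+2%:R * ppow m.+1 (f x) * grad2 h f x.
Proof. by move=> Cf; rewrite grad2C grad2_ppowl// grad2C. Qed.

Lemma lap_ppow m f x : Ck 2 f ->
  lap (fun x => ppow m.+3 (f x)) x =
  m.+3%:R * ppow m.+2 (f x) * lap f x +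
  m.+3%:R * m.+2%:R * ppow m.+1 (f x) * grad2 f f x.
Proof.
move=> Cf.
apply: (@lap_comp R n (ppow m.+3) (fun y => m.+3%:R * ppow m.+2 y)
  (m.+3%:R * m.+2%:R * ppow m.+1 (f x))) => // [y|]; first exact: is_derive_ppow.
by rewrite -mulrA; exact: is_derive_scale (is_derive_ppow m (f x)).
Qed.

End powers.

(** * Radial weights and cutoffs *)

Definition r2 (R : realType) (n : nat) (x : 'rV[R]_n) : R :=
  \sum_(i < n) x 0 i ^+ 2.

(** A smooth stand-in for |x|^(-a), normalized so that exponents add up under multiplication. *)
HB.lock Definition wt (R : realType) (n : nat) (a : R) (x : 'rV[R]_n) : R :=
  (1 + @r2 R n x) `^ (- a / 2).

(* e stands for R^(-2): the value is 1 on the ball of radius R and 0 outside that of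
   radius sqrt 2 R; cubes of positive parts make it C^2. *)
HB.lock Definition cutoff (R : realType) (n : nat) (e : R) (x : 'rV[R]_n) : R :=
  ppow 3 (1 - ppow 3 (e * @r2 R n x - 1)).

Arguments r2 {R n} x.
Arguments wt {R n} a x.
Arguments cutoff {R n} e x.

Section radial.
Context {R : realType} {n : nat}.
Implicit Types (h : 'rV[R]_n -> R) (x : 'rV[R]_n) (a b e : R).

Lemma r2_ge0 x : 0 <= r2 x.
Proof. by apply: sumr_ge0 => i _; exact: sqr_ge0. Qed.

Lemma coord_le_r2 x i : x 0 i ^+ 2 <= r2 x.
Proof.
by rewrite /r2 (bigD1 i)//= lerDl; apply: sumr_ge0 => j _; exact: sqr_ge0.
Qed.

Lemma Ck_r2 k : Ck k (@r2 R n).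
Proof. by apply: Ck_sum => i; apply: Ck_exp; exact: Ck_coord. Qed.

Lemma partial_coord (i j : 'I_n) x :
  partial i (fun x : 'rV[R]_n => x 0 j) x = (i == j)%:R.
Proof. exact: (@derive_val _ _ _ _ _ _ _ (is_derive_coord j i x)). Qed.

Lemma partial_r2 i x : partial i r2 x = 2 * x 0 i.
Proof.
have Cc j : Ck 1 (fun x : 'rV[R]_n => x 0 j) by exact: Ck_coord.
rewrite (_ : r2 = fun x => \sum_(j < n) (fun j x => x 0 j ^+ 2) j x)//.
rewrite /partial.
rewrite (_ : (fun x => \sum_(j < n) _) = \sum_(j < n) (fun x : 'rV[R]_n => x 0 j ^+ 2)).
  rewrite derive_sum; last first.
    by move=> j; apply: (@Ck_derivable _ _ 0); apply: Ck_exp.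
  rewrite (bigD1 i)//= big1 ?addr0 => [|j ji].
    have := partial_comp (is_derive_exp 1 (x 0 i)) (@Ck_derivable _ _ 0 _ i x (Cc i)).
    by rewrite partial_coord eqxx mulr1 expr1.
  have := partial_comp (is_derive_exp 1 (x 0 j)) (@Ck_derivable _ _ 0 _ i x (Cc j)).
  by rewrite partial_coord eq_sym (negbTE ji) mulr0.
by apply/funext => y; rewrite fct_sumE.
Qed.

Lemma grad2_r2 x : grad2 r2 r2 x = 4 * r2 x.
Proof.
rewrite grad2E /r2 mulr_sumr; apply: eq_bigr => i _.
by rewrite partial_r2; ring.
Qed.

Lemma lap_r2 x : lap r2 x = 2 * n%:R.
Proof.
rewrite lapE (eq_bigr (fun=> 2)).
  by rewrite sumr_const card_ord mulr_natr.
move=> i _; rewrite (_ : partial i r2 = fun x => 2 * x 0 i).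
  have Cc : Ck 1 (fun x : 'rV[R]_n => x 0 i) by exact: Ck_coord.
  rewrite partial_mul; last exact: Ck_derivable Cc.
    by rewrite partial_cst partial_coord eqxx mulr0 addr0 mulr1.
  by apply: (@Ck_derivable _ _ 0); exact: Ck_cst.
by apply/funext => y; rewrite partial_r2.
Qed.

Lemma wtE a x : wt a x = (1 + r2 x) `^ (- a / 2).
Proof. by rewrite wt.unlock. Qed.

Lemma wt_fE a : wt a = fun x : 'rV[R]_n => (1 + r2 x) `^ (- a / 2).
Proof. by apply/funext => x; exact: wtE. Qed.

Lemma wt_base x : 0 < 1 + r2 x.
Proof. by have := r2_ge0 x; lra. Qed.

Lemma wt_gt0 a x : 0 < wt a x.
Proof. by rewrite wtE powR_gt0// wt_base. Qed.

Lemma Ck_wt k a : Ck k (@wt R n a).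
Proof.
rewrite wt_fE; apply: Ck_powR; last exact: wt_base.
by apply: Ck_add; [exact: Ck_cst|exact: Ck_r2].
Qed.

Lemma wtD a b x : wt (a + b) x = wt a x * wt b x.
Proof.
rewrite !wtE -powRD; first by congr (_ `^ _); field.
by apply/implyP => _; rewrite gt_eqF// wt_base.
Qed.

Lemma wt0 x : wt 0 x = 1.
Proof. by rewrite wtE oppr0 mul0r powRr0. Qed.

Lemma wt2 x : wt 2 x = (1 + r2 x)^-1.
Proof.
rewrite wtE (_ : - 2 / 2 = -1 :> R); last by field.
by rewrite powR_inv1// ltW// wt_base.
Qed.

Lemma wt2_le1 x : wt 2 x <= 1.
Proof. by rewrite wt2 invf_le1 ?wt_base//; have := r2_ge0 x; lra. Qed.

(** Eliminates |x|^2: gradients and Laplacians of weights become polynomials in one weight and in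
    [wt 2], within reach of [ring]. *)
Lemma wt2_r2 x : wt 2 x * r2 x = 1 - wt 2 x.
Proof. by rewrite wt2; have := wt_base x => ?; field; lra. Qed.

Lemma grad2_wtl a h x : grad2 (wt a) h x = - (a / 2) * wt (a + 2) x * grad2 r2 h x.
Proof.
have C1 : Ck 1 (fun x => 1 + r2 x).
  by apply: Ck_add; [exact: Ck_cst|exact: Ck_r2].
rewrite [in LHS]wt_fE grad2_powRl//; last exact: wt_base.
rewrite grad2_addl ?grad2_cstl ?add0r; last 2 first.
- exact: Ck_cst.
- exact: Ck_r2.
by rewrite wtE (_ : - a / 2 - 1 = - (a + 2) / 2) ?mulNr//; field.
Qed.

Lemma grad2_wt a b x :
  grad2 (wt a) (wt b) x = a * b * (wt (a + b + 2) x - wt (a + b + 4) x).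
Proof.
rewrite grad2_wtl grad2C grad2_wtl grad2_r2.
have -> : a + b + 4 = a + b + 2 + 2 by ring.
rewrite (wtD (a + b + 2) 2) (wtD (a + b) 2) (wtD a b) (wtD a 2) (wtD b 2).
have := wt2_r2 x; move: (wt a x) (wt b x) (wt 2 x) (r2 x) => A B t r h.
transitivity (a * b * A * B * t * (t * r)); first by field.
by rewrite h; ring.
Qed.

Lemma lap_wt a x : lap (wt a) x =
  - (a * (n%:R - 2 - a)) * wt (a + 2) x - a * (a + 2) * wt (a + 4) x.
Proof.
have C1 : Ck 2 (fun x => 1 + r2 x).
  by apply: Ck_add; [exact: Ck_cst|exact: Ck_r2].
rewrite [in LHS]wt_fE lap_powR//; last exact: wt_base.
rewrite lap_add ?lap_cst ?lap_r2 ?add0r; last 2 first.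
- exact: Ck_cst.
- exact: Ck_r2.
rewrite grad2_addl ?grad2_cstl ?add0r; last 2 first.
- exact: Ck_cst.
- exact: Ck_r2.
rewrite grad2_addr ?grad2_cstr ?add0r ?grad2_r2; last 2 first.
- exact: Ck_cst.
- exact: Ck_r2.
have -> : (1 + r2 x) `^ (- a / 2 - 1) = wt (a + 2) x.
  by rewrite wtE; congr (_ `^ _); field.
have -> : (1 + r2 x) `^ (- a / 2 - 1 - 1) = wt (a + 2 + 2) x.
  by rewrite wtE; congr (_ `^ _); field.
have -> : a + 4 = a + 2 + 2 by ring.
rewrite (wtD (a + 2) 2); have := wt2_r2 x.
move: (wt (a + 2) x) (wt 2 x) (r2 x) => A t r h.
transitivity (- a * n%:R * A + a * (a + 2) * A * (t * r)); first by field.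
by rewrite h; ring.
Qed.

Let g e x := e * r2 x - 1.
Let f e x := 1 - ppow 3 (g e x).

Let cE e x : cutoff e x = ppow 3 (f e x).
Proof. by rewrite cutoff.unlock. Qed.

Let c_fE e : cutoff e = fun x : 'rV[R]_n => ppow 3 (f e x).
Proof. by apply/funext => x; exact: cE. Qed.

Let Cg k e : Ck k (g e).
Proof. by apply: Ck_sub; [apply: Ck_scale; exact: Ck_r2|exact: Ck_cst]. Qed.

Let Cf e : Ck 2 (f e).
Proof. by apply: Ck_sub; [exact: Ck_cst|exact: Ck_ppow]. Qed.

Lemma Ck_cutoff e : Ck 2 (@cutoff R n e).
Proof. by rewrite c_fE; exact: (@Ck_ppow R n 2 (f e) 3 isT (Cf e)). Qed.

Lemma cutoff_ge0 e x : 0 <= cutoff e x.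
Proof. by rewrite cE ppow_ge0. Qed.

Lemma cutoff_le1 e x : cutoff e x <= 1.
Proof.
rewrite cE; apply: exprn_ile1; first by rewrite le_max lexx.
by rewrite ge_max ler01/= gerBl ppow_ge0.
Qed.

Lemma cutoff_in e x : e * r2 x <= 1 -> cutoff e x = 1.
Proof.
move=> h; rewrite cE /f /g (ppow_neg (y := e * r2 x - 1) 2); last by lra.
by rewrite subr0 ppow_pos// expr1n.
Qed.

Let f_out e x : 2 <= e * r2 x -> f e x <= 0.
Proof.
move=> h; rewrite /f subr_le0 ppow_pos; last by rewrite /g; lra.
by rewrite exprn_ege1// /g; lra.
Qed.

Lemma cutoff_out e x : 2 <= e * r2 x -> cutoff e x = 0.
Proof. by move=> /f_out h; rewrite cE (ppow_neg 2). Qed.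

Lemma r2_coord_out e M x i : 0 <= M -> 2 <= e * M ^+ 2 -> 0 < e ->
  M < `|x 0 i| -> 2 <= e * r2 x.
Proof.
move=> M0 eM e0 xi; apply: (le_trans eM); rewrite ler_pM2l//.
apply: (le_trans _ (coord_le_r2 x i)).
by rewrite -[x 0 i ^+ 2]real_normK ?num_real// ler_sqr ?nnegrE// ltW.
Qed.

Lemma sqrtV_sqr e : 0 < e -> e * Num.sqrt e^-1 ^+ 2 = 1.
Proof. by move=> e0; rewrite sqr_sqrtr ?invr_ge0 ?ltW// divff// gt_eqF. Qed.

Lemma cutoff_out_cube e x i : 0 < e -> 2 * Num.sqrt e^-1 < `|x 0 i| ->
  2 <= e * r2 x.
Proof.
move=> e0; apply: (@r2_coord_out e (2 * Num.sqrt e^-1)) => //.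
by rewrite exprMn mulrCA sqrtV_sqr// mulr1; lra.
Qed.

Lemma bsupp_cutoff e : 0 < e -> bsupp (@cutoff R n e).
Proof.
move=> e0; exists (2 * Num.sqrt e^-1) => x i h; apply: cutoff_out.
exact: cutoff_out_cube h.
Qed.

Let Cf1 e : Ck 1 (f e) := @Ck_le _ _ 1 2 _ isT (Cf e).
Let Cpg e : Ck 2 (fun x => ppow 3 (g e x)) := @Ck_ppow R n 2 (g e) 3 isT (Cg 2 e).
Let Cpg1 e : Ck 1 (fun x => ppow 3 (g e x)) := @Ck_le _ _ 1 2 _ isT (Cpg e).

Let Gg e h x : grad2 (g e) h x = e * grad2 r2 h x.
Proof.
have C1 : Ck 1 (fun x => e * r2 x) by apply: Ck_scale; exact: Ck_r2.
rewrite (@grad2_addl R n (fun x => e * r2 x) (fun=> - 1) h x C1 (Ck_cst _ _)).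
by rewrite grad2_cstl addr0 (grad2_scalel _ _ _ (Ck_r2 1)).
Qed.

Let Gf e h x : grad2 (f e) h x = - (3 * ppow 2 (g e x) * (e * grad2 r2 h x)).
Proof.
rewrite (@grad2_addl R n (fun=> 1) (fun x => - ppow 3 (g e x)) h x (Ck_cst _ _)
  (Ck_opp (Cpg1 e))).
by rewrite grad2_cstl add0r grad2_oppl// (grad2_ppowl 1)// Gg.
Qed.

Let Lg e x : lap (g e) x = e * (2 * n%:R).
Proof.
have C2 : Ck 2 (fun x => e * r2 x) by apply: Ck_scale; exact: Ck_r2.
rewrite (@lap_add R n (fun x => e * r2 x) (fun=> - 1) x C2 (Ck_cst _ _)).
by rewrite lap_cst addr0 (lap_scale _ _ (Ck_r2 2)) lap_r2.
Qed.

Let Lf e x : lap (f e) x = - (3 * ppow 2 (g e x) * (e * (2 * n%:R)) +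
      6 * ppow 1 (g e x) * (e ^+ 2 * (4 * r2 x))).
Proof.
rewrite (@lap_add R n (fun=> 1) (fun x => - ppow 3 (g e x)) x (Ck_cst _ _)
  (Ck_opp (Cpg e))).
rewrite lap_cst add0r lap_opp// (lap_ppow 0)// Lg Gg grad2C Gg.
by rewrite grad2_r2; ring.
Qed.

Lemma grad2_cutoff e h x : grad2 (cutoff e) h x =
  - (9 * ppow 2 (f e x) * ppow 2 (g e x) * e) * grad2 r2 h x.
Proof. by rewrite c_fE (@grad2_ppowl R n 1 (f e))// Gf; ring. Qed.

Lemma lap_cutoff e x : lap (cutoff e) x =
  - (3 * ppow 2 (f e x) * (3 * ppow 2 (g e x) * (e * (2 * n%:R)) +
      6 * ppow 1 (g e x) * (e ^+ 2 * (4 * r2 x)))) +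
  6 * ppow 1 (f e x) * (9 * ppow 2 (g e x) ^+ 2 * (e ^+ 2 * (4 * r2 x))).
Proof.
rewrite c_fE (@lap_ppow R n 0 (f e))// Lf Gf grad2C Gf grad2_r2.
by ring.
Qed.

Lemma grad2_cutoff_in e h x : e * r2 x <= 1 -> grad2 (cutoff e) h x = 0.
Proof.
by move=> h1; rewrite grad2_cutoff (ppow_neg (y := g e x) 1) ?mulr0 ?mul0r ?oppr0 ?mul0r// /g;
  lra.
Qed.

Lemma lap_cutoff_in e x : e * r2 x <= 1 -> lap (cutoff e) x = 0.
Proof.
move=> h1; have g0 : g e x <= 0 by rewrite /g; lra.
by rewrite lap_cutoff (ppow_neg 1 g0) (ppow_neg 0 g0); ring.
Qed.

Lemma grad2_cutoff_out e h x : 2 <= e * r2 x -> grad2 (cutoff e) h x = 0.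
Proof.
by move=> /f_out h1; rewrite grad2_cutoff (ppow_neg 1 h1); ring.
Qed.

Lemma lap_cutoff_out e x : 2 <= e * r2 x -> lap (cutoff e) x = 0.
Proof.
move=> /f_out h1.
by rewrite lap_cutoff (ppow_neg 1 h1) (ppow_neg 0 h1); ring.
Qed.

Let fg_bounds e x m k : 0 < e -> e * r2 x < 2 ->
  [/\ 0 <= ppow m (f e x), ppow m (f e x) <= 1,
      0 <= ppow k (g e x) & ppow k (g e x) <= 1].
Proof.
move=> e0 h; rewrite !ppow_ge0; split => //.
  apply: exprn_ile1; first by rewrite le_max lexx.
  by rewrite ge_max ler01/= /f gerBl ppow_ge0.
apply: exprn_ile1; first by rewrite le_max lexx.
by rewrite ge_max ler01/= /g; lra.
Qed.

(** A common bound for both derivatives of the cutoff: the gradient estimate produces 648, the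
    Laplacian at most 18 n + 576. *)
Definition cutC : R := 18 * n%:R + 720.

Lemma cutC_gt0 : 0 < cutC.
Proof. by rewrite /cutC; have := @ler0n R n; lra. Qed.

Lemma grad2_cutoff_le e x : 0 < e -> grad2 (cutoff e) (cutoff e) x <= cutC * e.
Proof.
move=> e0; have n0 := @ler0n R n.
have [h|h] := leP 2 (e * r2 x).
  by rewrite grad2_cutoff_out// mulr_ge0 ?ltW// cutC_gt0.
have [a0 a1 b0 b1] := @fg_bounds e x 2 2 e0 h.
rewrite grad2_cutoff grad2C grad2_cutoff grad2_r2.
move: a0 a1 b0 b1; set a := ppow 2 (f e x); set b := ppow 2 (g e x) => a0 a1 b0 b1.
have ab : (a * b) ^+ 2 <= 1.
  by apply: exprn_ile1; [exact: mulr_ge0|exact: mulr_ile1].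
have r0 := r2_ge0 x.
apply: (@le_trans _ _ (648 * e)); last first.
  by rewrite ler_pM2r// /cutC; lra.
have -> : - (9 * a * b * e) * (- (9 * a * b * e) * (4 * r2 x)) =
   324 * e * ((a * b) ^+ 2 * (e * r2 x)) by ring.
have er0 : 0 <= e * r2 x by rewrite mulr_ge0// ltW.
have : (a * b) ^+ 2 * (e * r2 x) <= 2.
  by apply: le_trans (ltW h); rewrite ler_piMl.
by rewrite -(ler_pM2l (_ : 0 < 324 * e)); lra.
Qed.

Lemma lap_cutoff_le e x : 0 < e -> `|lap (cutoff e) x| <= cutC * e.
Proof.
move=> e0; have n0 := @ler0n R n.
have [h|h] := leP 2 (e * r2 x).
  by rewrite lap_cutoff_out// normr0 mulr_ge0 ?ltW// cutC_gt0.
have [a0 a1 b0 b1] := @fg_bounds e x 2 2 e0 h.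
have [c0 c1 d0 d1] := @fg_bounds e x 1 1 e0 h.
rewrite lap_cutoff.
move: a0 a1 b0 b1; set a := ppow 2 (f e x); set b := ppow 2 (g e x) => a0 a1 b0 b1.
move: c0 c1 d0 d1; set c := ppow 1 (f e x); set d := ppow 1 (g e x) => c0 c1 d0 d1.
have r0 := r2_ge0 x; have er0 : 0 <= e * r2 x by rewrite mulr_ge0// ltW.
have ab : 0 <= a * b <= 1 by rewrite mulr_ge0//= mulr_ile1.
have ad : 0 <= a * d <= 1 by rewrite mulr_ge0//= mulr_ile1.
have cb : 0 <= c * b ^+ 2 <= 1.
  by rewrite mulr_ge0 ?sqr_ge0//= mulr_ile1 ?sqr_ge0// exprn_ile1.
set E := (X in `|X|).
have -> : E = e * (- (18 * n%:R * (a * b) + 72 * (a * d) * (e * r2 x)) +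
   216 * (c * b ^+ 2) * (e * r2 x)) by rewrite /E; ring.
rewrite normrM gtr0_norm// mulrC ler_pM2r// ler_norml /cutC.
move: ab ad cb => /andP[ab0 ab1] /andP[ad0 ad1] /andP[cb0 cb1].
have h1 : 0 <= (a * d) * (e * r2 x) <= 2 by apply/andP; split; nra.
have h2 : 0 <= (c * b ^+ 2) * (e * r2 x) <= 2 by apply/andP; split; nra.
have h3 : 0 <= n%:R * (a * b) <= n%:R by apply/andP; split; nra.
move: h1 h2 h3 => /andP[? ?] /andP[? ?] /andP[? ?].
by apply/andP; split; lra.
Qed.

End radial.

(** * Automation for signs, regularity and supports *)

Ltac pos := first [
  match goal with
  | H : is_true (0 <= ?a) |- is_true (0 <= ?b) => constr_eq a b; exact: H
  | H : is_true (0 < ?a) |- is_true (0 <= ?b) => constr_eq a b; exact: (ltW H)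
  end | lazymatch goal with
  | |- is_true (0 <= _ + _) => apply: addr_ge0; pos
  | |- is_true (0 <= _ * _) => apply: mulr_ge0; pos
  | |- is_true (0 <= _ ^+ 2) => exact: sqr_ge0
  | |- is_true (0 <= _ ^+ _) =>
     first [by apply: exprn_even_ge0 | apply: exprn_ge0; pos]
  | |- is_true (0 <= _^-1) => rewrite invr_ge0; pos
  | |- is_true (0 <= `|_|) => exact: normr_ge0
  | |- is_true (0 <= _ `^ _) => exact: powR_ge0
  | |- is_true (0 <= _%:R) => exact: ler0n
  | |- is_true (0 <= wt _ _) => exact: ltW (wt_gt0 _ _)
  | |- _ => first [assumption | apply: ltW; assumption | done]
  end].

Ltac spos := first [
  match goal with
  | H : is_true (0 < ?a) |- is_true (0 < ?b) => constr_eq a b; exact: H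
  end | lazymatch goal with
  | |- is_true (0 < _ + _) =>
     first [by apply: addr_gt0; spos | by apply: ltr_pwDl; [spos|pos]
           | by apply: ltr_wpDl; [pos|spos]]
  | |- is_true (0 < _ * _) => apply: mulr_gt0; spos
  | |- is_true (0 < _ ^+ _) => apply: exprn_gt0; spos
  | |- is_true (0 < _^-1) => rewrite invr_gt0; spos
  | |- is_true (0 < _ `^ _) => apply: powR_gt0; spos
  | |- is_true (0 < wt _ _) => exact: wt_gt0
  | |- is_true (0 < _%:R) => by rewrite ltr0n
  | |- _ => first [assumption | done]
  end].

Ltac ck_atom k F := match goal with
  | H : Ck ?m ?F' |- _ => constr_eq F F'; exact: (@Ck_le _ _ k m F isT H)
  | H : forall k, Ck k ?F' |- _ => constr_eq F F'; exact: H
  end.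

Ltac ck := first [
  match goal with
  | H : Ck ?m ?F |- Ck ?k ?F' =>
      constr_eq F F'; exact: (@Ck_le _ _ k m F isT H)
  end | lazymatch goal with
  | |- Ck _ (fun x => @?F x + @?G x) => apply: (@Ck_add _ _ _ F G); ck
  | |- Ck _ (fun x => - @?F x) => apply: (@Ck_opp _ _ _ F); ck
  | |- Ck _ (fun x => @?F x * @?G x) => apply: (@Ck_mul _ _ _ F G); ck
  | |- Ck _ (fun x => @?F x ^+ ?m) => apply: (@Ck_exp _ _ _ F m); ck
  | |- Ck _ (fun x => @?F x `^ ?a) => apply: (@Ck_powR _ _ _ F a); [ck|assumption]
  | |- Ck _ (fun x => lap ?F x) => apply: (@Ck_lap _ _ _ F); ck
  | |- Ck _ (lap ?F) => apply: (@Ck_lap _ _ _ F); ck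
  | |- Ck _ (fun x => grad2 ?F ?G x) => apply: (@Ck_grad2 _ _ _ F G); ck
  | |- Ck _ (grad2 ?F ?G) => apply: (@Ck_grad2 _ _ _ F G); ck
  | |- Ck _ (fun x => wt ?a x) => exact: Ck_wt
  | |- Ck _ (wt ?a) => exact: Ck_wt
  | |- Ck _ (fun _ => ?c) => exact: Ck_cst
  | |- Ck ?k (fun x => cutoff ?e x) => exact: (@Ck_le _ _ k 2 (cutoff e) isT (Ck_cutoff e))
  | |- Ck ?k (cutoff ?e) => exact: (@Ck_le _ _ k 2 (cutoff e) isT (Ck_cutoff e))
  | |- Ck ?k (fun x => ?F x) => ck_atom k F
  | |- Ck ?k ?F => ck_atom k F
  end].

Ltac bs := first [
  match goal with
  | H : bsupp ?F |- bsupp ?F' => constr_eq F F'; exact: H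
  end | lazymatch goal with
  | |- bsupp (fun x => @?F x + @?G x) => apply: (@bsupp_add _ _ F G); bs
  | |- bsupp (fun x => - @?F x) => apply: (@bsupp_opp _ _ F); bs
  | |- bsupp (fun x => @?F x * @?G x) =>
     first [apply: (@bsupp_mull _ _ F G); solve [bs]
           |apply: (@bsupp_mulr _ _ F G); solve [bs]]
  | |- bsupp (fun x => @?F x ^+ _.+1) => apply: (@bsupp_exp _ _ F); bs
  | |- bsupp (fun x => @?F x ^+ 2) => apply: (@bsupp_exp _ _ F 1); bs
  | |- bsupp (fun x => lap ?F x) => apply: (@bsupp_lap _ _ F); bs
  | |- bsupp (lap ?F) => apply: (@bsupp_lap _ _ F); bs
  | |- bsupp (fun x => grad2 ?F ?G x) =>
     first [apply: (@bsupp_grad2r _ _ F G); solve [bs]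
           |apply: (@bsupp_grad2l _ _ F G); solve [bs]]
  | |- bsupp (fun x => cutoff _ x) => exact: bsupp_cutoff
  | |- bsupp (cutoff _) => exact: bsupp_cutoff
  | |- bsupp (fun x => ?F' x) => match goal with
      | H : bsupp ?F |- _ => constr_eq F F'; exact: H
      end
  end].

Ltac cb := split; [apply: (@Ck_cont _ _ 0); ck|bs].

(** * Integral inequalities deduced from pointwise ones *)

Section linear.
Context {R : realType} {n : nat}.
Implicit Types s : seq (R * ('rV[R]_n -> R)).

Fixpoint allcbs s : Prop :=
  if s is p :: s' then cbs p.2 /\ allcbs s' else True.

Definition lin_at s x : R := foldr (fun p a => p.1 * p.2 x + a) 0 s.

Definition lin_I s : R := foldr (fun p a => p.1 * integ p.2 + a) 0 s.

Lemma cbs0 : cbs (fun _ : 'rV[R]_n => 0 : R).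
Proof. by split; [exact: cont_cst|exact: bsupp0]. Qed.

Lemma I_lin s : allcbs s -> cbs (lin_at s) /\ integ (lin_at s) = lin_I s.
Proof.
elim: s => [_|[c f] s IH /= [cf /IH[cs Is]]]; split; first exact: cbs0.
- by rewrite integE /lin_at /= /Rintegral integral0.
- by apply: cbs_add => //; exact: cbs_scale.
- rewrite (_ : lin_at _ = fun x => c * f x + lin_at s x)// I_add//.
    by rewrite I_scale// Is.
  exact: cbs_scale.
Qed.

(** The engine of all integral estimates: an inequality between integrals follows from one between
    integrands, and the list may contain divergences [green f g] with arbitrary coefficients, since
    they contribute nothing to [lin_I]. *)
Lemma I_lin_ge0 s : allcbs s -> (forall x, 0 <= lin_at s x) -> 0 <= lin_I s.
Proof. by move=> /I_lin[_ <-]; exact: I_ge0. Qed.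

Lemma quad_ge0 (a b c x y : R) : 0 <= a -> 0 <= c -> b ^+ 2 <= a * c ->
  0 <= a * x ^+ 2 + 2 * b * x * y + c * y ^+ 2.
Proof.
move=> a0 c0 bac; have [a_eq0|an0] := eqVneq a 0.
  have /eqP : b ^+ 2 = 0.
    by apply/eqP; rewrite eq_le sqr_ge0 andbT (le_trans bac)// a_eq0 mul0r.
  rewrite sqrf_eq0 => /eqP ->; rewrite a_eq0 mulr0 !mul0r !add0r.
  by rewrite mulr_ge0// sqr_ge0.
have {}a0 : 0 < a by rewrite lt_neqAle eq_sym an0.
rewrite -(pmulr_rge0 _ a0).
have -> : a * (a * x ^+ 2 + 2 * b * x * y + c * y ^+ 2) =
  (a * x + b * y) ^+ 2 + (a * c - b ^+ 2) * y ^+ 2 by ring.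
by rewrite addr_ge0 ?sqr_ge0// mulr_ge0 ?sqr_ge0// subr_ge0.
Qed.

End linear.

(** * The Caccioppoli inequality *)

Section caccioppoli.
Context {R : realType} {n : nat}.
Implicit Types (f : 'rV[R]_n -> R).

(** Green's formula for f psi^2 against f, with psi = cutoff^(m+2). Doubling it leaves one spare
    copy of |grad f|^2 psi^2 to absorb the cross term 4 f psi grad f . grad psi; differentiating psi
    costs one power of the cutoff. *)
Lemma caccioppoli f e m : Ck 2 f -> 0 < e ->
  integ (fun x => grad2 f f x * (cutoff e x ^+ m.+2) ^+ 2) <=
  - 2 * integ (fun x => f x * lap f x * (cutoff e x ^+ m.+2) ^+ 2) +
  4 * m.+2%:R ^+ 2 * (@cutC R n * e) * integ (fun x => f x ^+ 2 * (cutoff e x ^+ m.+1) ^+ 2).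
Proof.
move=> Cf e0.
have C1 : Ck 1 (fun x => f x * (cutoff e x ^+ m.+2) ^+ 2) by ck.
have Cz : Ck 1 (fun x : 'rV[R]_n => (cutoff e x ^+ m.+2) ^+ 2) by ck.
have Cz1 : Ck 1 (fun x : 'rV[R]_n => cutoff e x ^+ m.+2) by ck.
have Cc : Ck 1 (@cutoff R n e) by ck.
have Cf1 : Ck 1 f by ck.
have b1 : bsupp (fun x => f x * (cutoff e x ^+ m.+2) ^+ 2) by bs.
have G0 := I_green C1 Cf (or_introl b1).
have := @I_lin_ge0 _ _ [::
  (- 2, fun x => f x * lap f x * (cutoff e x ^+ m.+2) ^+ 2);
  (4 * m.+2%:R ^+ 2 * (@cutC R n * e), fun x => f x ^+ 2 * (cutoff e x ^+ m.+1) ^+ 2);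
  (-1, fun x => grad2 f f x * (cutoff e x ^+ m.+2) ^+ 2);
  (2, green (fun x => f x * (cutoff e x ^+ m.+2) ^+ 2) f)].
rewrite /lin_I /lin_at /= G0 => H.
suff : 0 <= - 2 * integ (fun x => f x * lap f x * (cutoff e x ^+ m.+2) ^+ 2) +
  (4 * m.+2%:R ^+ 2 * (@cutC R n * e) * integ (fun x => f x ^+ 2 * (cutoff e x ^+ m.+1) ^+ 2) +
  (-1 * integ (fun x => grad2 f f x * (cutoff e x ^+ m.+2) ^+ 2) + (2 * 0 + 0))) by lra.
apply: H.
  do 3 (split; first by cb); split => //.
  by apply: cbs_green => //; left.
move=> x; rewrite /green grad2_mull// (grad2_expl 1)// (grad2_expl m.+1)//.
have := grad2_cutoff_le x e0; have := grad2_CS (cutoff e) f x.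
have := grad2_ge0 f x; have := grad2_ge0 (cutoff e) x.
have := @cutC_gt0 R n.
rewrite [cutoff e x ^+ m.+2]exprS.
move: (grad2 f f x) (grad2 (cutoff e) f x) (grad2 (cutoff e) (cutoff e) x) (f x)
  (lap f x) (cutoff e x) (cutoff e x ^+ m.+1) (m.+2%:R) (@cutC R n) =>
  g G q F L psi t M c c0 q0 g0 CS qc.
have CS' : (2 * M * G) ^+ 2 <= g * (4 * M ^+ 2 * (c * e)).
  apply: (@le_trans _ _ (4 * M ^+ 2 * (q * g))).
    have -> : (2 * M * G) ^+ 2 = 4 * M ^+ 2 * G ^+ 2 by ring.
    by rewrite ler_wpM2l// mulr_ge0// sqr_ge0.
  have -> : g * (4 * M ^+ 2 * (c * e)) = 4 * M ^+ 2 * ((c * e) * g) by ring.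
  apply: ler_wpM2l; first by rewrite mulr_ge0// sqr_ge0.
  exact: ler_wpM2r.
have := quad_ge0 (psi * t) (F * t) g0 _ CS'.
move=> /(_ _)/le_trans; apply.
  by pos.
by rewrite le_eqVlt; apply/orP; left; apply/eqP; ring.
Qed.

End caccioppoli.

(** * Stability tested with a product *)

Section test_identities.
Context {R : realType} {n : nat}.
Implicit Types (f g xi eta : 'rV[R]_n -> R).

(** What is left of (Lap (xi eta))^2 once Lap xi Lap (xi eta^2) is taken out; the latter integrates
    to the integral of xi eta^2 Lap (Lap xi). Every term left carries a derivative of eta. *)
Definition remainder xi eta x : R :=
  (2 * grad2 xi eta x + xi x * lap eta x) ^+ 2 -
  2 * xi x * lap xi x * grad2 eta eta x.

Lemma lap_mul_sqr xi eta x : Ck 2 xi -> Ck 2 eta ->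
  lap (fun x => xi x * eta x) x ^+ 2 =
  lap xi x * lap (fun x => xi x * eta x ^+ 2) x +
  remainder xi eta x.
Proof.
move=> Cx Ce; have Ce2 : Ck 2 (fun x => eta x ^+ 2) by ck.
have Ce1 : Ck 1 eta by ck.
rewrite /remainder (lap_mul _ Cx Ce) (lap_mul _ Cx Ce2).
rewrite (lap_exp 0)// (grad2_expr 1)//.
move: (xi x) (eta x) (lap xi x) (lap eta x) (grad2 xi eta x)
  (grad2 eta eta x) => a b c d g h.
by rewrite !expr1 expr0; ring.
Qed.

Lemma I_lap_mul_sqr xi eta : Ck 2 xi -> Ck 2 (lap xi) ->
  Ck 2 eta -> bsupp eta ->
  integ (fun x => lap (fun x => xi x * eta x) x ^+ 2) =
  integ (fun x => xi x * eta x ^+ 2 * lap (lap xi) x) +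
  integ (remainder xi eta).
Proof.
move=> Cx Clx Ce be.
have Cf : Ck 2 (fun x => xi x * eta x ^+ 2) by ck.
have Cf1 : Ck 1 (fun x => xi x * eta x ^+ 2) by ck.
have Cl1 : Ck 1 (lap xi) by exact: (@Ck_le _ _ 1 2 _ isT Clx).
have bf : bsupp (fun x => xi x * eta x ^+ 2) by bs.
have G1 := I_green Cf1 Clx (or_introl bf).
have G2 := I_green Cl1 Cf (or_intror bf).
have cr : cbs (remainder xi eta).
  by split; [apply: (@Ck_cont _ _ 0); rewrite /remainder; ck|rewrite /remainder; bs].
have c1 : cbs (fun x => xi x * eta x ^+ 2 * lap (lap xi) x).
  by split; [apply: (@Ck_cont _ _ 0); ck|bs].
have c2 : cbs (fun x => lap (fun x => xi x * eta x) x ^+ 2).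
  have C : Ck 2 (fun x => xi x * eta x) by ck.
  have b : bsupp (fun x => xi x * eta x) by bs.
  by split; [apply: (@Ck_cont _ _ 0); ck|bs].
(* Equality from two inequalities: the same combination is nonnegative for s = 1 and for s = -1. *)
have E (s : R) : s ^+ 2 = 1 -> 0 <= s * (integ (fun x => lap (fun x => xi x * eta x) x ^+ 2) -
  integ (fun x => xi x * eta x ^+ 2 * lap (lap xi) x) -
  integ (remainder xi eta)).
  move=> s1; have := @I_lin_ge0 _ _ [::
    (s, fun x => lap (fun x => xi x * eta x) x ^+ 2);
    (- s, fun x => xi x * eta x ^+ 2 * lap (lap xi) x);
    (- s, remainder xi eta);
    (s, green (fun x => xi x * eta x ^+ 2) (lap xi));
    (- s, green (lap xi) (fun x => xi x * eta x ^+ 2))].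
  rewrite /lin_I /lin_at /= G1 G2 => H.
  set A := integ _ in H *; set B := integ _ in H *; set C := integ _ in H *.
  suff : 0 <= s * A + (- s * B + (- s * C + (s * 0 + (- s * 0 + 0)))) by lra.
  apply: H.
    split=> //; split=> //; split=> //; split; last split=> //.
      by apply: cbs_green => //; left.
    by apply: cbs_green => //; right.
  move=> x; rewrite lap_mul_sqr// /green [grad2 (lap xi) _ x]grad2C.
  move: (remainder _ _ x) (lap xi x) (lap (lap xi) x) (lap _ x)
    (xi x * eta x ^+ 2) (grad2 _ _ x) => a b c d g h.
  by rewrite le_eqVlt; apply/orP; left; apply/eqP; ring.
have := E 1; have := E (-1); rewrite sqrrN !expr1n => /(_ erefl) h1 /(_ erefl) h2.
by lra.
Qed.

Lemma stable_remainder p u xi eta : stable p u -> Ck 0 u -> (forall x, 0 < u x) ->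
  Ck 2 xi -> Ck 2 (lap xi) -> Ck 2 eta -> bsupp eta ->
  p * integ (fun x => u x `^ (p - 1) * (xi x * eta x) ^+ 2) <=
  integ (fun x => xi x * eta x ^+ 2 * lap (lap xi) x) +
  integ (remainder xi eta).
Proof.
move=> st Cu u0 Cx Clx Ce be; rewrite -I_lap_mul_sqr//.
apply: stable_ibp => //; [exact: Ck_cont Cu|ck|bs].
Qed.

End test_identities.

(** * The energy estimate on balls *)

Lemma energy_arith (R : realType) (p IP IL ID IQ Z : R) :
  let q := 2 / (p - 1) + 4 in let d0 := (4 * q)^-1 in 1 < p ->
  ID <= 2 * d0 * IL + Z -> IQ <= 2 * d0 * IL + Z ->
  (p - 1) * IP <= ID -> IL <= 2 * IP + 2 * ID + 2 * IQ ->
  IP + IL <= (2 * q + (p - 1)^-1 * (1 + 4 * d0 * q)) * Z.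
Proof.
move=> q d0 p1 hD hQ hP hL.
have p10 : 0 < p - 1 by rewrite subr_gt0.
have q0 : 0 < q by rewrite /q addr_gt0// divr_gt0.
have dd : 0 < d0 by rewrite invr_gt0 mulr_gt0.
set Y := 2 * d0 * IL + Z in hD hQ.
have hP' : IP <= (p - 1)^-1 * Y.
  by rewrite ler_pdivlMl//; exact: le_trans hD.
have hLq : IL <= q * Y.
  have -> : q * Y = 2 * ((p - 1)^-1 * Y) + 4 * Y by rewrite /q; ring.
  by clearbody Y; lra.
(* Here q collects the coefficients with which the hypotheses bound IL, and d0 is chosen so that
   exactly half of IL is absorbed. *)
have dq : q * (2 * d0) = 2^-1 by rewrite /d0; field; rewrite gt_eqF.
have hL2 : IL <= 2 * q * Z.
  have qY : q * Y = 2^-1 * IL + q * Z by rewrite /Y mulrDr mulrA dq.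
  move: hLq; rewrite qY -mulrA; move: (q * Z) => t; lra.
have hY : Y <= (1 + 4 * d0 * q) * Z.
  have : 2 * d0 * IL <= 2 * d0 * (2 * q * Z) by rewrite ler_pM2l// mulr_gt0.
  have -> : (1 + 4 * d0 * q) * Z = 2 * d0 * (2 * q * Z) + Z by ring.
  by rewrite /Y lerD2r.
have hP2 : IP <= (p - 1)^-1 * ((1 + 4 * d0 * q) * Z).
  by apply: (le_trans hP'); rewrite ler_pM2l// invr_gt0.
have -> : (2 * q + (p - 1)^-1 * (1 + 4 * d0 * q)) * Z =
  (p - 1)^-1 * ((1 + 4 * d0 * q) * Z) + 2 * q * Z by ring.
exact: lerD.
Qed.

Section energy.
Context {R : realType} {n : nat}.
Variables (p : R) (u : 'rV[R]_n -> R).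
Hypotheses (p1 : 1 < p) (sol : solution p u) (st : stable p u).

Let Cu : Ck 4 u. Proof. by case: sol => h _ _; split. Qed.
Let u0 x : 0 < u x. Proof. by case: sol. Qed.
Let ueq x : lap (lap u) x = u x `^ p.
Proof. by case: sol => _ _ /(_ x); rewrite !laplacianE. Qed.

Lemma sqr_sum_le (a b : R) : (a + b) ^+ 2 <= 2 * a ^+ 2 + 2 * b ^+ 2.
Proof. by rewrite -subr_ge0 (_ : _ - _ = (a - b) ^+ 2) ?sqr_ge0//; ring. Qed.

Lemma young (d a b : R) : 0 < d -> 2 * a * b <= d * a ^+ 2 + d^-1 * b ^+ 2.
Proof.
move=> d0; rewrite -subr_ge0.
have -> : d * a ^+ 2 + d^-1 * b ^+ 2 - 2 * a * b = d^-1 * (d * a - b) ^+ 2.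
  by field; lra.
by rewrite mulr_ge0 ?sqr_ge0// invr_ge0 ltW.
Qed.

Section fixed.
Variables (e : R) (m : nat).
Hypothesis e0 : 0 < e.
Let psi := @cutoff R n e.
Let c := @cutC R n * e.
Let M : R := m.+2%:R.
Let M1 : R := m.+3%:R.
Let IP := integ (fun x => u x `^ (p + 1) * (psi x ^+ m.+3) ^+ 2).
Let IL := integ (fun x => lap u x ^+ 2 * (psi x ^+ m.+3) ^+ 2).
Let IU := integ (fun x => u x ^+ 2 * (psi x ^+ m.+1) ^+ 2).
Let ID := integ (remainder u (fun x => psi x ^+ m.+3)).
(** The square inside [remainder]. It also measures the distance from Lap (u eta) to eta Lap u, so
    it is estimated on its own. *)
Let Q x := (2 * grad2 u (fun x => psi x ^+ m.+3) x +
  u x * lap (fun x => psi x ^+ m.+3) x) ^+ 2.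

Let c0 : 0 <= c. Proof. by rewrite mulr_ge0 ?ltW// cutC_gt0. Qed.
Let Cpsi : Ck 2 psi. Proof. exact: Ck_cutoff. Qed.
Let Ceta : Ck 2 (fun x => psi x ^+ m.+3). Proof. by rewrite /psi; ck. Qed.
Let beta : bsupp (fun x => psi x ^+ m.+3). Proof. by rewrite /psi; bs. Qed.

Let Q_le x : Q x <= 8 * M1 ^+ 2 * c * (grad2 u u x * (psi x ^+ m.+2) ^+ 2) +
  2 * M1 ^+ 4 * c ^+ 2 * (u x ^+ 2 * (psi x ^+ m.+1) ^+ 2).
Proof.
rewrite /Q.
have Cp : Ck 1 psi by rewrite /psi; ck.
have Cp2 : Ck 2 psi by rewrite /psi; ck.
rewrite (grad2_expr m.+2)// (lap_exp m.+1)//.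
have := grad2_cutoff_le x e0; have := lap_cutoff_le x e0.
have := grad2_CS u psi x.
have := grad2_ge0 u x; have := grad2_ge0 psi x.
have := cutoff_ge0 e x; have := cutoff_le1 e x; have := c0.
rewrite -/psi -/c.
have M1E : M1 = m.+2%:R + 1 by rewrite /M1 -natr1.
have M0 : 0 <= m.+2%:R :> R by [].
rewrite [psi x ^+ m.+2]exprS -/M1.
have t0 : psi x <= 1 -> 0 <= psi x -> 0 <= psi x ^+ m.+1.
  by move=> ? ?; exact: exprn_ge0.
move: t0 M0 M1E.
move: (grad2 u u x) (grad2 u psi x) (grad2 psi psi x) (u x)
  (lap psi x) (psi x) (psi x ^+ m.+1) (m.+2%:R) (M1) c =>
  g G q U L z t N N1 k t0 N0 N1E k0 z1 z0 q0 g0 CS Lk qk.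
have {}t0 := t0 z1 z0.
have N10 : 0 <= N1 by rewrite N1E addr_ge0.
apply: (le_trans (sqr_sum_le _ _)); apply: lerD.
  have -> : 2 * (2 * (N1 * (z * t) * G)) ^+ 2 =
    8 * N1 ^+ 2 * (z * t) ^+ 2 * G ^+ 2 by ring.
  have -> : 8 * N1 ^+ 2 * k * (g * (z * t) ^+ 2) =
    8 * N1 ^+ 2 * (z * t) ^+ 2 * (g * k) by ring.
  apply: ler_wpM2l; first by pos.
  by apply: (le_trans CS); apply: ler_wpM2l.
have -> : 2 * (U * (N1 * (z * t) * L + N1 * N * t * q)) ^+ 2 =
  2 * N1 ^+ 2 * (U ^+ 2 * t ^+ 2) * (z * L + N * q) ^+ 2 by ring.
have -> : 2 * N1 ^+ 4 * k ^+ 2 * (U ^+ 2 * t ^+ 2) =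
  2 * N1 ^+ 2 * (U ^+ 2 * t ^+ 2) * (N1 * k) ^+ 2 by ring.
apply: ler_wpM2l; first by pos.
rewrite -[leLHS]real_normK ?num_real// ler_sqr ?nnegrE ?normr_ge0//; last first.
  by rewrite mulr_ge0.
apply: (le_trans (ler_normD _ _)).
rewrite !normrM (ger0_norm z0) (ger0_norm N0) (ger0_norm q0) N1E.
have : z * `|L| <= k by apply: le_trans Lk; rewrite ler_piMl.
have : N * q <= N * k by rewrite ler_wpM2l.
by lra.
Qed.

Let remainder_le d x : 0 < d -> remainder u (fun x => psi x ^+ m.+3) x <=
  Q x + d * (lap u x ^+ 2 * (psi x ^+ m.+3) ^+ 2) +
  d^-1 * M1 ^+ 4 * c ^+ 2 * (u x ^+ 2 * (psi x ^+ m.+1) ^+ 2).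
Proof.
move=> d0; rewrite /remainder -/(Q x) -addrA lerD2l.
have Cp : Ck 1 psi by rewrite /psi; ck.
rewrite (grad2_expr m.+2)// (grad2_expl m.+2)//.
have := grad2_cutoff_le x e0; have := grad2_ge0 psi x.
rewrite -/psi -/c [psi x ^+ m.+3]exprS [psi x ^+ m.+2]exprS -/M1.
move: (grad2 psi psi x) (u x) (lap u x) (psi x) (psi x ^+ m.+1) M1 c =>
  q U L z t N1 k q0 qk.
have := young (- (L * (z * (z * t)))) (U * t * N1 ^+ 2 * q) d0.
have -> : 2 * - (L * (z * (z * t))) * (U * t * N1 ^+ 2 * q) =
  - (2 * U * L * (N1 * (z * t) * (N1 * (z * t) * q))) by ring.
move/le_trans; apply; rewrite sqrrN exprMn lerD2l.
have -> : d^-1 * (U * t * N1 ^+ 2 * q) ^+ 2 =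
  d^-1 * N1 ^+ 4 * (U ^+ 2 * t ^+ 2) * q ^+ 2 by ring.
have -> : d^-1 * N1 ^+ 4 * k ^+ 2 * (U ^+ 2 * t ^+ 2) =
  d^-1 * N1 ^+ 4 * (U ^+ 2 * t ^+ 2) * k ^+ 2 by ring.
apply: ler_wpM2l.
  by pos.
by rewrite ler_sqr ?nnegrE//; exact: le_trans qk.
Qed.

Let cP : cbs (fun x => u x `^ (p + 1) * (psi x ^+ m.+3) ^+ 2).
Proof. by rewrite /psi; cb. Qed.
Let cL : cbs (fun x => lap u x ^+ 2 * (psi x ^+ m.+3) ^+ 2).
Proof. by rewrite /psi; cb. Qed.
Let cU : cbs (fun x => u x ^+ 2 * (psi x ^+ m.+1) ^+ 2).
Proof. by rewrite /psi; cb. Qed.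
Let cG : cbs (fun x => grad2 u u x * (psi x ^+ m.+2) ^+ 2).
Proof. by rewrite /psi; cb. Qed.
Let cM : cbs (fun x => u x * lap u x * (psi x ^+ m.+2) ^+ 2).
Proof. by rewrite /psi; cb. Qed.
Let cQ : cbs Q. Proof. by rewrite /Q; cb. Qed.
Let cD : cbs (remainder u (fun x => psi x ^+ m.+3)).
Proof. by rewrite /remainder; cb. Qed.
Let cS : cbs (fun x => lap (fun x => u x * psi x ^+ m.+3) x ^+ 2).
Proof.
have C : Ck 2 (fun x => u x * psi x ^+ m.+3) by ck.
have b : bsupp (fun x => u x * psi x ^+ m.+3) by bs.
by cb.
Qed.

Let K2 d := (2 + d^-1) * M1 ^+ 4 + 64 * M1 ^+ 4 * d^-1 + 32 * M1 ^+ 2 * M ^+ 2.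

Let cross_le d x : 0 < d -> - (16 * M1 ^+ 2 * c) *
    (u x * lap u x * (psi x ^+ m.+2) ^+ 2) <=
  d * (lap u x ^+ 2 * (psi x ^+ m.+3) ^+ 2) +
  64 * M1 ^+ 4 * d^-1 * c ^+ 2 * (u x ^+ 2 * (psi x ^+ m.+1) ^+ 2).
Proof.
move=> d0; rewrite [psi x ^+ m.+3]exprS [psi x ^+ m.+2]exprS.
have := young (- (lap u x * (psi x * (psi x * psi x ^+ m.+1))))
  (8 * M1 ^+ 2 * c * (u x * psi x ^+ m.+1)) d0.
move: (u x) (lap u x) (psi x) (psi x ^+ m.+1) M1 c => U L z t N1 k.
by move=> h; apply: (le_trans (le_trans _ h)); rewrite le_eqVlt;
  apply/orP; left; apply/eqP; ring.
Qed.

Let cacc : integ (fun x => grad2 u u x * (psi x ^+ m.+2) ^+ 2) +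
  2 * integ (fun x => u x * lap u x * (psi x ^+ m.+2) ^+ 2) -
  4 * M ^+ 2 * c * IU <= 0.
Proof.
have C2 : Ck 2 u by ck.
have := caccioppoli m C2 e0; rewrite -/psi -/c -/M -/IU.
rewrite -subr_le0; congr (_ <= 0); move: (integ _) (integ _) => ? ?; ring.
Qed.

(** Cauchy-Schwarz reduces the error to |grad u|^2 with one power of the cutoff fewer, Caccioppoli
    to u Lap u, and Young to a small multiple of [IL] plus u^2 at order e^2. The constant [K2] adds
    up these losses. *)
Let ID_le d : 0 < d -> ID <= 2 * d * IL + K2 d * c ^+ 2 * IU.
Proof.
move=> d0; have := @I_lin_ge0 _ _ [::
  (2 * d, fun x => lap u x ^+ 2 * (psi x ^+ m.+3) ^+ 2);
  (K2 d * c ^+ 2, fun x => u x ^+ 2 * (psi x ^+ m.+1) ^+ 2);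
  (-1, remainder u (fun x => psi x ^+ m.+3));
  (8 * M1 ^+ 2 * c, fun x => grad2 u u x * (psi x ^+ m.+2) ^+ 2);
  (16 * M1 ^+ 2 * c, fun x => u x * lap u x * (psi x ^+ m.+2) ^+ 2);
  (- (32 * M1 ^+ 2 * c * M ^+ 2 * c), fun x => u x ^+ 2 * (psi x ^+ m.+1) ^+ 2)].
rewrite /lin_I /lin_at /= -/IL -/IU -/ID => H.
have {}H := H (conj cL (conj cU (conj cD (conj cG (conj cM (conj cU Logic.I)))))).
have h := cacc.
set IG := integ _ in h H; set IM := integ _ in h H.
have h2 : 8 * M1 ^+ 2 * c * (IG + 2 * IM - 4 * M ^+ 2 * c * IU) <= 0.
  by rewrite mulr_ge0_le0//; pos.
have : 0 <= 2 * d * IL + (K2 d * c ^+ 2 * IU +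
  (-1 * ID + (8 * M1 ^+ 2 * c * IG + (16 * M1 ^+ 2 * c * IM +
  (- (32 * M1 ^+ 2 * c * M ^+ 2 * c) * IU + 0))))).
  apply: H => x.
  have := remainder_le x d0; have := Q_le x; have := cross_le x d0.
  rewrite /K2; move: (Q x) (remainder _ _ x) (grad2 u u x * _) (u x * _ * _)
   (lap u x ^+ 2 * _) (u x ^+ 2 * _) (M1 ^+ 4) (M1 ^+ 2) (M ^+ 2)
   (d^-1) => ? ? ? ? ? ? ? ? ? ?; lra.
by lra.
Qed.

Let IQ_le d : 0 < d -> integ Q <= 2 * d * IL + K2 d * c ^+ 2 * IU.
Proof.
move=> d0; have := @I_lin_ge0 _ _ [::
  (2 * d, fun x => lap u x ^+ 2 * (psi x ^+ m.+3) ^+ 2);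
  (K2 d * c ^+ 2, fun x => u x ^+ 2 * (psi x ^+ m.+1) ^+ 2);
  (-1, Q);
  (8 * M1 ^+ 2 * c, fun x => grad2 u u x * (psi x ^+ m.+2) ^+ 2);
  (16 * M1 ^+ 2 * c, fun x => u x * lap u x * (psi x ^+ m.+2) ^+ 2);
  (- (32 * M1 ^+ 2 * c * M ^+ 2 * c), fun x => u x ^+ 2 * (psi x ^+ m.+1) ^+ 2)].
rewrite /lin_I /lin_at /= -/IL -/IU => H.
have {}H := H (conj cL (conj cU (conj cQ (conj cG (conj cM (conj cU Logic.I)))))).
have h := cacc.
set IG := integ _ in h H; set IM := integ _ in h H.
have h2 : 8 * M1 ^+ 2 * c * (IG + 2 * IM - 4 * M ^+ 2 * c * IU) <= 0.
  by rewrite mulr_ge0_le0//; pos.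
have : 0 <= 2 * d * IL + (K2 d * c ^+ 2 * IU +
  (-1 * integ Q + (8 * M1 ^+ 2 * c * IG + (16 * M1 ^+ 2 * c * IM +
  (- (32 * M1 ^+ 2 * c * M ^+ 2 * c) * IU + 0))))).
  apply: H => x.
  have := Q_le x; have := cross_le x d0.
  have t1 : 0 <= d * (lap u x ^+ 2 * (psi x ^+ m.+3) ^+ 2).
    by pos.
  have t2 : 0 <= d^-1 * M1 ^+ 4 * c ^+ 2 * (u x ^+ 2 * (psi x ^+ m.+1) ^+ 2).
    by pos.
  move: t1 t2; rewrite /K2; move: (Q x) (grad2 u u x * _) (u x * _ * _)
   (lap u x ^+ 2 * _) (u x ^+ 2 * _) (M1 ^+ 4) (M1 ^+ 2) (M ^+ 2)
   (d^-1) => ? ? ? ? ? ? ? ? ?; lra.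
by lra.
Qed.

(** Stability tested with u eta. As Lap (Lap u) = u^p, the term without derivatives of eta is again
    [IP], and p - 1 copies of it survive. *)
Let IP_le : (p - 1) * IP <= ID.
Proof.
have := stable_remainder st (Ck_le (leq0n 4) Cu) u0 (@Ck_le _ _ 2 4 _ isT Cu)
  (Ck_lap Cu) Ceta beta.
rewrite -/ID (_ : integ (fun x => u x `^ (p - 1) * _) = IP); last first.
  congr integ; apply/funext => x.
  rewrite exprMn mulrA; congr (_ * _).
  rewrite -powR_mulrn ?ltW// -powRD; last by apply/implyP => _; rewrite gt_eqF.
  by congr (_ `^ _); ring.
rewrite (_ : integ (fun x => _ * lap (lap u) x) = IP); last first.
  congr integ; apply/funext => x; rewrite ueq mulrC mulrA; congr (_ * _).
  rewrite -[X in _ * X](powRr1 (ltW (u0 x))) -powRD//.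
  by apply/implyP => _; rewrite gt_eqF.
by lra.
Qed.

(** The integral of (Lap (u eta))^2 is [IP] + [ID], and eta Lap u differs from Lap (u eta) by a
    quantity whose square is [Q]. *)
Let IL_le : IL <= 2 * IP + 2 * ID + 2 * integ Q.
Proof.
have E := I_lap_mul_sqr (@Ck_le _ _ 2 4 _ isT Cu) (Ck_lap Cu) Ceta beta.
have EP : integ (fun x => u x * (psi x ^+ m.+3) ^+ 2 * lap (lap u) x) = IP.
  congr integ; apply/funext => x; rewrite ueq mulrC mulrA; congr (_ * _).
  rewrite -[X in _ * X](powRr1 (ltW (u0 x))) -powRD//.
  by apply/implyP => _; rewrite gt_eqF.
have {}E : integ (fun x => lap (fun x => u x * psi x ^+ m.+3) x ^+ 2) = IP + ID :=
  etrans E (congr1 (fun t => t + ID) EP).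
have := @I_lin_ge0 _ _ [::
  (-1, fun x => lap u x ^+ 2 * (psi x ^+ m.+3) ^+ 2);
  (2, Q);
  (2, fun x => lap (fun x => u x * psi x ^+ m.+3) x ^+ 2)].
rewrite /lin_I /lin_at /= => H.
have {}H := H (conj cL (conj cQ (conj cS Logic.I))).
suff : 0 <= -1 * IL + (2 * integ Q +
  (2 * integ (fun x => lap (fun x => u x * psi x ^+ m.+3) x ^+ 2) + 0)).
  rewrite E; move: IL IP ID (integ Q) => a b d q.
  by move=> {}H; rewrite -subr_ge0; move: H; congr (_ <= _); ring.
apply: H => x.
rewrite (lap_mul _ (@Ck_le _ _ 2 4 _ isT Cu) Ceta) /Q.
have := sqr_sum_le (u x * lap (fun x => psi x ^+ m.+3) x +
  psi x ^+ m.+3 * lap u x + 2 * grad2 u (fun x => psi x ^+ m.+3) x)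
  (- (2 * grad2 u (fun x => psi x ^+ m.+3) x +
  u x * lap (fun x => psi x ^+ m.+3) x)).
move: (u x) (lap u x) (lap _ x) (psi x ^+ m.+3) (grad2 _ _ x) =>
  U L Lp z G.
have -> : (U * Lp + z * L + 2 * G + - (2 * G + U * Lp)) ^+ 2 = L ^+ 2 * z ^+ 2.
  by ring.
by rewrite sqrrN; lra.
Qed.

Let q := 2 / (p - 1) + 4.
Let d0 := (4 * q)^-1.

Lemma energy_cutoff : IP + IL <= (2 * q + (p - 1)^-1 * (1 + 4 * d0 * q)) * K2 d0 *
  (@cutC R n) ^+ 2 * (e ^+ 2 * IU).
Proof.
have q0 : 0 < q by rewrite /q addr_gt0// divr_gt0// subr_gt0.
have dd : 0 < d0 by rewrite invr_gt0 mulr_gt0.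
apply: (le_trans (energy_arith p1 (ID_le dd) (IQ_le dd) IP_le IL_le)).
by rewrite le_eqVlt; apply/orP; left; apply/eqP; rewrite /c -/q -/d0; ring.
Qed.

End fixed.

End energy.

Section energy_bound.
Context {R : realType} {n : nat}.
Implicit Types (p e d t U : R) (u : 'rV[R]_n -> R).

Lemma powR_sqr (x a : R) : 0 < x -> (x ^+ 2) `^ a = x `^ (2 * a).
Proof. by move=> x0; rewrite -powR_mulrn ?ltW// -powRrM. Qed.

Lemma sqrtV_exp e : 0 < e -> Num.sqrt e^-1 ^+ n = e `^ (- (n%:R / 2)).
Proof.
move=> e0; rewrite -powR12_sqrt ?invr_ge0 ?ltW// -powR_inv1 ?ltW//.
rewrite -!powRrM -powR_mulrn ?powR_ge0// -powRrM; congr (_ `^ _).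
by rewrite mulN1r mulNr mulrC.
Qed.

(** Young's inequality between U^2 and U^(p+1), by cases: either the first term on the right already
    suffices, or d U^(p-1) t^4 <= e^2, which raised to the power 2 / (p - 1) bounds U^2. The size of
    m lets the cutoff pay for the factor t^(8/(p-1)) and still keep one t, so that the last term has
    bounded support. *)
Lemma young_cutoff p d e t U m : 1 < p -> 0 < d -> 0 < e -> 0 <= t -> t <= 1 ->
  0 < U -> 8 / (p - 1) <= m%:R ->
  e ^+ 2 * (U ^+ 2 * (t ^+ m.+1) ^+ 2) <=
  d * (U `^ (p + 1) * (t ^+ m.+3) ^+ 2) +
  (d `^ (2 / (p - 1)))^-1 * e `^ (2 * (p + 1) / (p - 1)) * t.
Proof.
move=> p1 d0 e0 t0 t1 U0 hm; set a := 2 / (p - 1).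
have p10 : 0 < p - 1 by rewrite subr_gt0.
have a0 : 0 < a by rewrite divr_gt0.
have [->|tn0] := eqVneq t 0.
  by rewrite [0 ^+ m.+1]exprS [0 ^+ m.+3]exprS !mul0r expr0n /= !mulr0 addr0.
have {}t0 : 0 < t by rewrite lt_neqAle eq_sym tn0.
have K0 : 0 <= (d `^ a)^-1 * e `^ (2 * (p + 1) / (p - 1)) * t.
  by rewrite !mulr_ge0 ?invr_ge0 ?powR_ge0// ltW.
have [h|h] := leP (e ^+ 2 * (U ^+ 2 * (t ^+ m.+1) ^+ 2))
    (d * (U `^ (p + 1) * (t ^+ m.+3) ^+ 2)); first by rewrite (le_trans h)// lerDl.
have Up : U `^ (p + 1) = U `^ (p - 1) * U ^+ 2.
  rewrite -powR_mulrn ?ltW// -powRD; last by apply/implyP => _; rewrite gt_eqF.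
  by congr (_ `^ _); ring.
have h1 : d * U `^ (p - 1) * t ^+ 4 <= e ^+ 2.
  rewrite -(ler_pM2r (_ : 0 < U ^+ 2 * (t ^+ m.+1) ^+ 2)); last first.
    by rewrite mulr_gt0// !exprn_gt0.
  apply: le_trans (ltW h); rewrite Up le_eqVlt; apply/orP; left; apply/eqP.
  by rewrite !exprS; ring.
have Ua : (U `^ (p - 1)) `^ a = U ^+ 2.
  rewrite -powRrM -powR_mulrn ?ltW//; congr (_ `^ _).
  by rewrite /a mulrC divfK// gt_eqF.
have h2 : d `^ a * U ^+ 2 * (t ^+ 4) `^ a <= (e ^+ 2) `^ a.
  have -> : d `^ a * U ^+ 2 * (t ^+ 4) `^ a = (d * U `^ (p - 1) * t ^+ 4) `^ a.
    rewrite powRM; [|by pos|by pos]; rewrite powRM; [|by pos|by pos].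
    by rewrite Ua.
  by apply: ge0_ler_powR => //; [exact: ltW|rewrite nnegrE; pos|rewrite nnegrE; pos].
have h3 : (t ^+ m.+1) ^+ 2 <= t * (t ^+ 4) `^ a.
  have -> : (t ^+ m.+1) ^+ 2 = t * t ^+ (m + m).+1.
    by rewrite -exprM -exprS; congr (_ ^+ _); clear; lia.
  rewrite ler_pM2l// -[t ^+ 4](powR_mulrn 4 (ltW t0)) -powRrM.
  rewrite -(powR_mulrn _ (ltW t0)); apply: ger_powR; first by rewrite t0.
  have -> : 4 * a = 8 / (p - 1) by rewrite /a mulrA -natrM.
  apply: (le_trans hm); rewrite ler_nat; clear; lia.
have ea : e `^ (2 * (p + 1) / (p - 1)) = e ^+ 2 * (e ^+ 2) `^ a.
  rewrite powR_sqr// -powR_mulrn ?ltW// -powRD; last first.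
    by apply/implyP => _; rewrite gt_eqF.
  by congr (_ `^ _); rewrite /a; field; rewrite gt_eqF.
have da : 0 < d `^ a by rewrite powR_gt0.
apply: ler_wpDl; first by pos.
rewrite ea -(ler_pM2l da).
have -> : d `^ a * ((d `^ a)^-1 * (e ^+ 2 * (e ^+ 2) `^ a) * t) =
  e ^+ 2 * t * (e ^+ 2) `^ a by field; rewrite gt_eqF.
apply: (@le_trans _ _ (e ^+ 2 * t * (d `^ a * U ^+ 2 * (t ^+ 4) `^ a))); last first.
  by rewrite ler_pM2l// mulr_gt0// exprn_gt0.
have -> : d `^ a * (e ^+ 2 * (U ^+ 2 * (t ^+ m.+1) ^+ 2)) =
  e ^+ 2 * d `^ a * U ^+ 2 * (t ^+ m.+1) ^+ 2 by ring.
have -> : e ^+ 2 * t * (d `^ a * U ^+ 2 * (t ^+ 4) `^ a) =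
  e ^+ 2 * d `^ a * U ^+ 2 * (t * (t ^+ 4) `^ a) by ring.
by rewrite ler_pM2l// !mulr_gt0// exprn_gt0.
Qed.

Lemma integ_cutoff e m : 0 < e ->
  integ (fun x => @cutoff R n e x ^+ m.+1) <= 4 ^+ n * e `^ (- (n%:R / 2)).
Proof.
move=> e0; have s0 : 0 <= 2 * Num.sqrt e^-1 by rewrite mulr_ge0// sqrtr_ge0.
have cc : cbs (fun x => @cutoff R n e x ^+ m.+1) by cb.
have : integ (fun x => @cutoff R n e x ^+ m.+1) <=
    1 * ((2 * Num.sqrt e^-1) *+ 2) ^+ n.
  apply: I_le_meas => //.
    by move=> x; rewrite exprn_ge0// cutoff_ge0.
  move=> x; rewrite mul1r indicE.
  have [h|h] := pselect (cube (2 * Num.sqrt e^-1) x).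
    by rewrite mem_set// exprn_ile1 ?cutoff_ge0 ?cutoff_le1.
  rewrite memNset//; move/existsNP: h => [i /negP]; rewrite -ltNge => h.
  by rewrite cutoff_out ?expr0n//; exact: cutoff_out_cube h.
rewrite mul1r -sqrtV_exp// -exprMn.
by congr (_ <= _ ^+ _); rewrite -mulr_natr; ring.
Qed.

Lemma absorb e (K IP IL IU B Y Z : R) : 0 < K -> IP + IL <= K * (e ^+ 2 * IU) ->
  e ^+ 2 * IU <= (2 * K)^-1 * IP + B * Y -> B * Y <= Z -> 0 <= IP -> 0 <= IL ->
  IP + IL <= 2 * (K * Z).
Proof.
move=> K0 h1 h2 h3 P0 L0.
have : K * (e ^+ 2 * IU) <= K * ((2 * K)^-1 * IP + Z).
  by rewrite ler_pM2l// (le_trans h2)// lerD2l.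
have -> : K * ((2 * K)^-1 * IP + Z) = IP / 2 + K * Z by field; rewrite gt_eqF.
move: h1 P0 L0; move: (K * _) (K * Z) => a b; clear; lra.
Qed.

Lemma energy_bound p u : 1 < p -> solution p u -> stable p u ->
  exists m C, [/\ 0 <= C & forall e, 0 < e ->
    integ (fun x => u x `^ (p + 1) * (cutoff e x ^+ m.+1) ^+ 2) +
    integ (fun x => lap u x ^+ 2 * (cutoff e x ^+ m.+1) ^+ 2) <=
    C * e `^ (2 * (p + 1) / (p - 1) - n%:R / 2)].
Proof.
move=> p1 sol st; have p10 : 0 < p - 1 by rewrite subr_gt0.
have Cu : Ck 4 u by case: sol.
have u0 x : 0 < u x by case: sol.
(* Powers of the cutoff high enough for [young_cutoff]. *)
pose m := Num.bound (8 / (p - 1)).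
have hm : 8 / (p - 1) <= m%:R by apply: ltW; apply: archi_boundP; rewrite divr_ge0// ltW.
have [K [K0 hK]] : exists K, 0 < K /\ forall e, 0 < e ->
  integ (fun x => u x `^ (p + 1) * (cutoff e x ^+ m.+3) ^+ 2) +
  integ (fun x => lap u x ^+ 2 * (cutoff e x ^+ m.+3) ^+ 2) <=
  K * (e ^+ 2 * integ (fun x => u x ^+ 2 * (cutoff e x ^+ m.+1) ^+ 2)).
  set q := 2 / (p - 1) + 4; set d0 := (4 * q)^-1.
  have q0 : 0 < q by rewrite /q addr_gt0// divr_gt0.
  have dd : 0 < d0 by rewrite invr_gt0 mulr_gt0.
  exists ((2 * q + (p - 1)^-1 * (1 + 4 * d0 * q)) * ((2 + d0^-1) * m.+3%:R ^+ 4 +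
    64 * m.+3%:R ^+ 4 * d0^-1 + 32 * m.+3%:R ^+ 2 * m.+2%:R ^+ 2) *
    (@cutC R n) ^+ 2); split; last first.
    by move=> e e0; exact: energy_cutoff.
  have c0 := @cutC_gt0 R n.
  by clearbody q d0 m; spos.
(* With this d the term K d [IP] is half of [IP] and is absorbed. *)
pose d := (2 * K)^-1.
have d0 : 0 < d by rewrite invr_gt0 mulr_gt0.
exists m.+2, (2 * (K * ((d `^ (2 / (p - 1)))^-1 * 4 ^+ n))); split.
  by rewrite !mulr_ge0 ?invr_ge0 ?powR_ge0 ?exprn_ge0 ?ltW.
move=> e e0; have := hK e e0.
set IP := integ _; set IL := integ _; set IU := integ _ => h.
have cP : cbs (fun x => u x `^ (p + 1) * (cutoff e x ^+ m.+3) ^+ 2) by cb.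
have cU : cbs (fun x => u x ^+ 2 * (cutoff e x ^+ m.+1) ^+ 2) by cb.
have cC : cbs (fun x => @cutoff R n e x ^+ 1) by cb.
set B := (d `^ (2 / (p - 1)))^-1 * e `^ (2 * (p + 1) / (p - 1)).
have B0 : 0 <= B by rewrite mulr_ge0 ?invr_ge0 ?powR_ge0.
have hU : e ^+ 2 * IU <= d * IP + B * integ (fun x => @cutoff R n e x ^+ 1).
  have := @I_lin_ge0 _ _ [:: (d, fun x => u x `^ (p + 1) * (cutoff e x ^+ m.+3) ^+ 2);
    (B, fun x => @cutoff R n e x ^+ 1);
    (- e ^+ 2, fun x => u x ^+ 2 * (cutoff e x ^+ m.+1) ^+ 2)].
  rewrite /lin_I /lin_at /= -/IP -/IU => H.
  have : 0 <= d * IP + (B * integ (fun x => @cutoff R n e x ^+ 1) +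
    (- e ^+ 2 * IU + 0)).
    apply: H => [|x]; first by [].
    have := young_cutoff p1 d0 e0 (cutoff_ge0 e x) (cutoff_le1 e x) (u0 x) hm.
    rewrite -/B expr1; set a := u x `^ _ * _; set b := u x ^+ 2 * _.
    by clearbody a b; move: (cutoff e x) => c; clear; lra.
  by move=> hh; rewrite -subr_ge0; move: hh; congr (_ <= _); ring.
have L0 : 0 <= IL.
  by apply: I_ge0 => x; rewrite mulr_ge0// sqr_ge0.
have hC := integ_cutoff 0 e0.
have hB : B * integ (fun x => @cutoff R n e x ^+ 1) <=
  (d `^ (2 / (p - 1)))^-1 * 4 ^+ n * e `^ (2 * (p + 1) / (p - 1) - n%:R / 2).
  apply: (le_trans (ler_wpM2l B0 hC)); rewrite le_eqVlt; apply/orP; left.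
  rewrite powRD; last by apply/implyP => _; rewrite gt_eqF.
  by apply/eqP; rewrite /B; ring.
have P0 : 0 <= IP by apply: I_ge0 => x; rewrite mulr_ge0 ?powR_ge0 ?sqr_ge0.
have := absorb K0 h hU hB P0 L0.
by congr (_ <= _); ring.
Qed.

End energy_bound.

(** * Subharmonic functions of moderate growth *)

Section subharmonic.
Context {R : realType} {n : nat}.
Implicit Types (w f g : 'rV[R]_n -> R) (e a : R) (x : 'rV[R]_n).

Lemma powR_third (t : R) : 0 <= t -> (t `^ 3^-1) ^+ 3 = t.
Proof.
by move=> t0; rewrite -powR_mulrn ?powR_ge0// -powRrM mulVf// powRr1.
Qed.

(* A C^2 substitute for the positive part of w: it is dominated by it, hence inherits
   its L^2 bounds, and is subharmonic if w is so where positive. *)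
Definition ramp w x : R := (1 + ppow 3 (w x)) `^ 3^-1 - 1.

Let T1 w x : 1 <= 1 + ppow 3 (w x).
Proof. by rewrite lerDl ppow_ge0. Qed.

Let T0 w x : 0 < 1 + ppow 3 (w x).
Proof. exact: lt_le_trans (T1 w x). Qed.

Lemma Ck_ramp w : Ck 2 w -> Ck 2 (ramp w).
Proof.
move=> Cw; apply: Ck_sub; last exact: Ck_cst.
apply: Ck_powR => [|x]; last exact: T0.
by apply: Ck_add; [exact: Ck_cst|exact: Ck_ppow].
Qed.

Lemma ramp_ge0 w x : 0 <= ramp w x.
Proof.
rewrite subr_ge0 -[X in X <= _](powRr0 (1 + ppow 3 (w x))).
by apply: ler_powR => //; exact: T1.
Qed.

Lemma ramp_le0 w x : ramp w x <= 0 -> w x <= 0.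
Proof.
rewrite subr_le0 => h; rewrite leNgt; apply/negP => w0.
have := powR_third (ltW (T0 w x)); rewrite (ppow_pos _ (ltW w0)) => h3.
have : ((1 + w x ^+ 3) `^ 3^-1) ^+ 3 <= 1.
  by apply: exprn_ile1; [exact: powR_ge0|move: h; rewrite (ppow_pos _ (ltW w0))].
by rewrite h3 gerDl leNgt exprn_gt0.
Qed.

Lemma ramp_sqr w x : ramp w x ^+ 2 <= w x ^+ 2.
Proof.
have [w0|w0] := leP (w x) 0.
  by rewrite /ramp ppow_neg// addr0 powR1 subrr expr0n/= sqr_ge0.
rewrite ler_sqr ?nnegrE ?ramp_ge0 ?(ltW w0)// /ramp lerBlDl.
rewrite -(@ler_pXn2r _ 3) ?nnegrE ?powR_ge0//; last by rewrite addr_ge0// ltW.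
rewrite (powR_third (ltW (T0 w x))) (ppow_pos _ (ltW w0)); move: (w x) w0 => t t0.
by rewrite -subr_ge0 (_ : _ - _ = 3 * t ^+ 2 + 3 * t); [pos|ring].
Qed.

(** The map from y to (1 + max(0, y)^3)^(1/3) is convex and nondecreasing, and constant for y <= 0;
    so only the sign of Lap w where w > 0 matters. *)
Lemma lap_ramp_ge0 w x : Ck 2 w -> (0 < w x -> 0 <= lap w x) ->
  0 <= lap (ramp w) x.
Proof.
move=> Cw hw; have Cw1 : Ck 1 w by ck.
have Cp : Ck 2 (fun x => ppow 3 (w x)) by exact: Ck_ppow.
have CT : Ck 2 (fun x => 1 + ppow 3 (w x)) by apply: Ck_add => //; exact: Ck_cst.
have CT1 : Ck 1 (fun x => 1 + ppow 3 (w x)) by ck.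
have Cp1 : Ck 1 (fun x => ppow 3 (w x)) by ck.
have Cc k := @Ck_cst R n k 1.
have CP : Ck 2 (fun x => (1 + ppow 3 (w x)) `^ 3^-1) by apply: Ck_powR => //; exact: T0.
have C1 := @Ck_cst R n 2 (- 1).
rewrite /ramp (lap_add _ CP C1) lap_cst addr0.
rewrite (lap_powR _ _ CT); last exact: T0.
rewrite (lap_add _ (Cc 2) Cp) lap_cst add0r (lap_ppow 0)//.
rewrite (grad2_addl _ _ (Cc 1) Cp1) grad2_cstl add0r (grad2_addr _ _ (Cc 1) Cp1) grad2_cstr add0r.
rewrite (grad2_ppowl 1)// (grad2_ppowr 1)//.
have [w0|w0] := leP (w x) 0.
  by rewrite !ppow_neg// !mulr0 !mul0r !mulr0 !addr0.
have {hw} := hw w0; have := grad2_ge0 w x; have := T0 w x.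
rewrite !(ppow_pos _ (ltW w0)).
have -> : (1 + w x ^+ 3) `^ (3^-1 - 1) = (1 + w x ^+ 3) * (1 + w x ^+ 3) `^ (3^-1 - 1 - 1).
  rewrite -{2}[1 + w x ^+ 3]powRr1; last by pos.
  rewrite -powRD; last by apply/implyP => _; rewrite gt_eqF; spos.
  by congr (_ `^ _); ring.
have := powR_ge0 (1 + w x ^+ 3) (3^-1 - 1 - 1).
move: (w x) w0 (lap w x) (grad2 w w x) (_ `^ _) => t t0 L G B B0 h1 G0 L0.
have -> : 3^-1 * ((1 + t ^+ 3) * B) * (3 * t ^+ 2 * L + 3 * 2 * t ^+ 1 * G) +
  3^-1 * (3^-1 - 1) * B * (3 * t ^+ 2 * (3 * t ^+ 2 * G)) =
  B * ((1 + t ^+ 3) * t ^+ 2 * L + 2 * t * G) by field.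
by pos.
Qed.

Lemma le_cutoff e0 e x : 0 < e0 -> e <= e0 / 2 -> cutoff e0 x <= cutoff e x.
Proof.
move=> e00 e2; have [h|h] := leP 2 (e0 * r2 x); first by rewrite cutoff_out// cutoff_ge0.
rewrite [leRHS]cutoff_in ?cutoff_le1//.
apply: (@le_trans _ _ (e0 / 2 * r2 x)); first by rewrite ler_wpM2r// r2_ge0.
by move: h; clear; lra.
Qed.

Lemma wt_annulus e a x : 0 < e -> 1 <= e * r2 x -> 0 <= a ->
  wt a x <= e `^ (a / 2).
Proof.
move=> e0 h a0; have b0 := wt_base x.
have -> : wt a x = (1 + r2 x)^-1 `^ (a / 2).
  rewrite wtE -[in RHS]powR_inv1 ?(ltW b0)// -powRrM; congr (_ `^ _); ring.
apply: ge0_ler_powR.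
- by rewrite divr_ge0.
- by rewrite nnegrE invr_ge0 ltW.
- by rewrite nnegrE ltW.
- rewrite -ler_pV2 ?inE ?unitf_gt0 ?invr_gt0 ?e0//= ?b0//.
  rewrite invrK -(ler_pM2l e0) divff ?gt_eqF//; lra.
Qed.

(** Derivatives of the cutoff live where 1 < e |x|^2 < 2. There the weight is at most e^(a/2), and
    the wider cutoff with parameter e / 4 equals 1, so any power of it may be inserted. *)
Lemma commutator_le a : 0 <= a -> exists D, 0 <= D /\ forall m e x, 0 < e ->
  `|2 * grad2 (cutoff e) (@wt R n a) x + wt a x * lap (cutoff e) x| <=
  D * (e `^ (a / 2) * e) * (cutoff (e / 4) x ^+ m) ^+ 2.
Proof.
move=> a0; have c0 := @cutC_gt0 R n.
exists (2 * ((1 + @cutC R n) * a) + @cutC R n); split; first by pos.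
move=> m e x e0; set D := 2 * (_ * a) + _.
have D0 : 0 <= D by rewrite /D; pos.
have hr : 0 <= D * (e `^ (a / 2) * e) * (cutoff (e / 4) x ^+ m) ^+ 2 by pos.
have [h1|h1] := leP (e * r2 x) 1.
  by rewrite grad2_cutoff_in// lap_cutoff_in// !mulr0 addr0 normr0.
have [h2|h2] := leP 2 (e * r2 x).
  by rewrite grad2_cutoff_out// lap_cutoff_out// !mulr0 addr0 normr0.
rewrite [cutoff (e / 4) x]cutoff_in; last by move: h2; clear; lra.
rewrite !expr1n mulr1.
have hw := wt_annulus e0 (ltW h1) a0.
have hG : `|grad2 (cutoff e) (@wt R n a) x| <= (1 + @cutC R n) * a * (e `^ (a / 2) * e).
  rewrite -[leRHS]ger0_norm; last by pos.
  rewrite -ler_sqr ?nnegrE ?normr_ge0// !real_normK ?num_real//.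
  apply: (le_trans (grad2_CS _ _ _)); rewrite grad2_wt.
  have q := grad2_cutoff_le x e0; have q0 := grad2_ge0 (@cutoff R n e) x.
  have hw2 : wt (a + a + 2) x <= (e `^ (a / 2)) ^+ 2 * e.
    have : wt (a + a + 2) x <= e `^ ((a + a + 2) / 2).
      by apply: wt_annulus => //; [exact: ltW|pos].
    have -> // : e `^ ((a + a + 2) / 2) = (e `^ (a / 2)) ^+ 2 * e.
    rewrite -powR_mulrn ?powR_ge0// -powRrM -{3}[e]powRr1 ?ltW//.
    rewrite -powRD; last by apply/implyP => _; rewrite gt_eqF.
    by congr (_ `^ _); field.
  have w4 := wt_gt0 (a + a + 4) x.
  move: q q0 hw2 w4; move: (grad2 _ _ x) (wt (_ + 2) x) (wt (_ + 4) x) (e `^ _) (@cutC R n) c0.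
  move=> G w1 w2 Y c c0 q q0 h3 w20.
  apply: (@le_trans _ _ (c * e * (a * a * (Y ^+ 2 * e)))).
    apply: (@le_trans _ _ (G * (a * a * (Y ^+ 2 * e)))).
      apply: ler_wpM2l => //; apply: ler_wpM2l; first by pos.
      by lra.
    by apply: ler_wpM2r => //; pos.
  rewrite -subr_ge0 (_ : _ - _ = (1 + c + c ^+ 2) * (a ^+ 2 * (Y ^+ 2 * e ^+ 2))); last by ring.
  by pos.
have hL : `|wt a x * lap (cutoff e) x| <= @cutC R n * (e `^ (a / 2) * e).
  rewrite normrM ger0_norm; last by pos.
  have -> : @cutC R n * (e `^ (a / 2) * e) = e `^ (a / 2) * (@cutC R n * e) by ring.
  by apply: ler_pM (ltW (wt_gt0 _ _)) (normr_ge0 _) hw (lap_cutoff_le x e0).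
apply: (le_trans (ler_normD _ _)); rewrite normrM ger0_norm//.
rewrite /D; move: hG hL; set g1 := `|_|; set g2 := `|_|; set Y := _ `^ _ * _.
by clearbody g1 g2 Y; move: (@cutC R n) => c; clear; lra.
Qed.

(* The test function is a cutoff of (1+|x|^2)^(-(n-2)/2), which is strictly
   superharmonic: its Laplacian is - n (n-2) (1+|x|^2)^(-(n+2)/2). *)
Lemma subharmonic_eq0 f m C b : (3 <= n)%N -> Ck 2 f -> (forall x, 0 <= f x) ->
  (forall x, 0 <= lap f x) -> 0 <= C -> 0 <= b ->
  (forall e, 0 < e -> integ (fun x => f x ^+ 2 * (cutoff e x ^+ m.+1) ^+ 2) <=
    C * e `^ (2 + b - n%:R / 2)) ->
  forall x, f x <= 0.
Proof.
move=> n3 Cf f0 lf C0 b0 hC x0; rewrite leNgt; apply/negP => fx0.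
pose a : R := n%:R - 2.
have a0 : 0 < a by rewrite /a subr_gt0 ltr_nat.
have [D [D0 hD]] := commutator_le (ltW a0).
(* The two Green formulas for f and the truncated weight leave, against f times the strictly
   negative Laplacian of the weight, only the commutator with the cutoff. *)
have key e : 0 < e -> e <= 1 ->
  integ (fun x => f x * (wt (a + 4) x * cutoff e x)) <=
  (a * n%:R)^-1 * (D * (C * 4 `^ (- (2 + b - n%:R / 2)) + 4 ^+ n * 4 `^ (n%:R / 2))) * e.
  move=> e0 e1.
  have Cf1 : Ck 1 f by ck.
  have Cc : Ck 2 (@cutoff R n e) by ck.
  have CH : Ck 2 (fun x => cutoff e x * @wt R n a x) by ck.
  have CH1 : Ck 1 (fun x => cutoff e x * @wt R n a x) by ck.
  have Cw : Ck 2 (@wt R n a) by ck.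
  have bH : bsupp (fun x => cutoff e x * @wt R n a x) by bs.
  have e40 : 0 < e / 4 by rewrite divr_gt0.
  have G1 := I_green Cf1 CH (or_intror bH).
  have G2 := I_green CH1 Cf (or_introl bH).
  have := @I_lin_ge0 _ _ [::
    (- (a * n%:R), fun x => f x * (wt (a + 4) x * cutoff e x));
    (D * (e `^ (a / 2) * e) * e^-1, fun x => f x ^+ 2 * (cutoff (e / 4) x ^+ m.+1) ^+ 2);
    (D * (e `^ (a / 2) * e) * e, fun x => @cutoff R n (e / 4) x ^+ (m + m).+2);
    (1, green (fun x => cutoff e x * @wt R n a x) f);
    (-1, green f (fun x => cutoff e x * @wt R n a x))].
  rewrite /lin_I /lin_at /= G1 G2 => H.
  have {}H : 0 <= - (a * n%:R) * integ (fun x => f x * (wt (a + 4) x * cutoff e x)) +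
      (D * (e `^ (a / 2) * e) * e^-1 *
         integ (fun x => f x ^+ 2 * (cutoff (e / 4) x ^+ m.+1) ^+ 2) +
      (D * (e `^ (a / 2) * e) * e * integ (fun x => @cutoff R n (e / 4) x ^+ (m + m).+2) +
      (1 * 0 + (-1 * 0 + 0)))).
    apply: H.
      do 3 (split; first by cb); split; last split => //.
        by apply: cbs_green => //; left.
      by apply: cbs_green => //; right.
    move=> x; rewrite /green (lap_mul _ Cc Cw) lap_wt [grad2 f _ x]grad2C.
    have := hD m.+1 e x e0; have := f0 x; have := lf x.
    have := wt_gt0 a x; have := cutoff_ge0 e x; have := cutoff_ge0 (e / 4) x.
    have -> : cutoff (e / 4) x ^+ (m + m).+2 = (cutoff (e / 4) x ^+ m.+1) ^+ 2.
      by rewrite -exprM; congr (_ ^+ _); clear; lia.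
    have al0 := mulr_ge0 (powR_ge0 e (a / 2)) (ltW e0).
    move: al0 e0 D0; have -> : n%:R = a + 2 :> R by rewrite /a subrK.
    clear; move: (grad2 (cutoff e) _ x) (lap (cutoff e) x) (wt a x) (lap f x) (f x)
      (grad2 _ f x) (wt (a + 4) x) (wt (a + 2) x) (cutoff e x) (_ ^+ m.+1) (_ `^ _ * e).
    move=> G L w F g H w4 w2 z t al al0 e0 D0 _ z0 w0 F0 g0 hE.
    have {}hE : - (g * (2 * G + w * L)) + D * al * (g * t ^+ 2) >= 0.
      have -> : - (g * (2 * G + w * L)) + D * al * (g * t ^+ 2) =
        g * (D * al * t ^+ 2 - (2 * G + w * L)) by ring.
      by apply: mulr_ge0 => //; rewrite subr_ge0; exact: le_trans (ler_norm _) hE.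
    have zF : 0 <= z * w * F by pos.
    (* Young in the form f <= f^2 / e + e. Since a / 2 = n / 2 - 1, the assumed growth makes the
       first part O(e^(1+b)), and the volume of the ball makes the second O(e). *)
    have hy : 0 <= D * al * (e^-1 * (g ^+ 2 * t ^+ 2) + e * t ^+ 2 - g * t ^+ 2).
      apply: mulr_ge0; first by pos.
      have -> : e^-1 * (g ^+ 2 * t ^+ 2) + e * t ^+ 2 - g * t ^+ 2 =
        e^-1 * t ^+ 2 * ((g - e / 2) ^+ 2 + 3 / 4 * e ^+ 2) by field; rewrite gt_eqF.
      by pos.
    move: (addr_ge0 (addr_ge0 hE zF) hy); congr (_ <= _); ring.
  have e4 r : (e / 4) `^ r = e `^ r * 4 `^ (- r).
    by rewrite powRM ?ltW ?invr_gt0// -powR_inv1// -powRrM mulN1r.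
  have IF := hC _ e40; have IC := @integ_cutoff R n _ (m + m).+1 e40.
  rewrite !e4 opprK in IF IC.
  have al0 : 0 <= e `^ (a / 2) * e by pos.
  have I1 : e `^ (a / 2) * e * e^-1 * integ (fun x => f x ^+ 2 * (cutoff (e / 4) x ^+ m.+1) ^+ 2) <=
      C * 4 `^ (- (2 + b - n%:R / 2)) * e.
    apply: le_trans (ler_wpM2l _ IF) _; first by pos.
    have -> : e `^ (a / 2) * e * e^-1 * (C * (e `^ (2 + b - n%:R / 2) * 4 `^ (- (2 + b - n%:R / 2)))) =
       C * 4 `^ (- (2 + b - n%:R / 2)) * (e `^ (a / 2) * e `^ (2 + b - n%:R / 2)).
      by field; rewrite gt_eqF.
    apply: ler_wpM2l; first by pos.
    rewrite -powRD; last by apply/implyP => _; rewrite gt_eqF.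
    have -> : a / 2 + (2 + b - n%:R / 2) = 1 + b by rewrite /a; field.
    by rewrite -[leRHS](powRr1 (ltW e0)); apply: ger_powR; rewrite ?e0// lerDl.
  have I2 : e `^ (a / 2) * e * e * integ (fun x => @cutoff R n (e / 4) x ^+ (m + m).+2) <=
      4 ^+ n * 4 `^ (n%:R / 2) * e.
    apply: le_trans (ler_wpM2l _ IC) _; first by pos.
    have -> : e `^ (a / 2) * e * e * (4 ^+ n * (e `^ (- (n%:R / 2)) * 4 `^ (n%:R / 2))) =
       4 ^+ n * 4 `^ (n%:R / 2) * e * (e `^ (a / 2) * e * e `^ (- (n%:R / 2))) by ring.
    rewrite -[leRHS]mulr1; apply: ler_wpM2l; first by pos.
    rewrite -{2}[e](powRr1 (ltW e0)) -!powRD; try by apply/implyP => _; rewrite gt_eqF.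
    have -> : a / 2 + 1 + - (n%:R / 2) = 0 by rewrite /a; field.
    by rewrite powRr0.
  have an0 : 0 < a * n%:R by rewrite mulr_gt0// ltr0n; case: (n) n3.
  rewrite -mulrA ler_pdivlMl//.
  have := ler_wpM2l D0 (lerD I1 I2).
  move: H; rewrite !mulr0 !addr0 mulrDr.
  set A := integ _; set B := integ _; set E := integ _; set Y := _ `^ _ * _.
  set c1 := 4 `^ _; set c2 := 4 `^ _; set c3 := 4 ^+ _.
  clearbody A B E Y c1 c2 c3; clearbody a; clear.
  by move: (e^-1) (n%:R) => i N; rewrite -!mulrA => h1 h2; lra.
(* A scale at which the cutoff equals 1 at x0. *)
pose e0 := (1 + r2 x0)^-1.
have b0' := wt_base x0.
have e00 : 0 < e0 by rewrite invr_gt0.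
pose I0 := integ (fun x => f x * (wt (a + 4) x * cutoff e0 x)).
have fw (e y : R) x : 0 < e -> 0 <= f x * (wt (a + 4) x * cutoff e x).
  by move=> h; have := f0 x; have := cutoff_ge0 e x => *; pos.
have I0gt : 0 < I0.
  apply: I_gt0; first by cb.
    by move=> x; apply: fw.
  exists x0; rewrite cutoff_in; first by rewrite mulr1; spos.
  by rewrite /e0 mulrC ler_pdivrMr// mul1r lerDr.
set K : R := (a * n%:R)^-1 * _ in key.
have K0 : 0 <= K.
  rewrite /K; apply: mulr_ge0; first by rewrite invr_ge0; apply: mulr_ge0; [exact: ltW|].
  by pos.
clearbody K.
(* Three requirements: e <= 1 for [key]; e <= e0 / 2, so that the cutoff at scale e dominates the
   one at e0; and K e < I0, which contradicts [key]. *)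
pose e := Num.min (Num.min 1 (e0 / 2)) (I0 / (2 * (K + 1))).
have e_gt0 : 0 < e by rewrite !lt_min ltr01 !divr_gt0// mulr_gt0// ltr_wpDl.
have e1 : e <= 1 by rewrite !ge_min lexx.
have e2 : e <= e0 / 2 by rewrite !ge_min lexx orbT.
have e3 : e <= I0 / (2 * (K + 1)) by rewrite !ge_min lexx !orbT.
have le_cutoff x := le_cutoff x e00 e2.
have : I0 <= K * e.
  apply: le_trans (key e e_gt0 e1); apply: I_le; [by cb|by cb|move=> x].
  apply: ler_wpM2l => //; apply: ler_wpM2l => //.
  exact: ltW (wt_gt0 _ _).
apply/negP; rewrite -ltNge; apply: (le_lt_trans (ler_wpM2l K0 e3)).
rewrite mulrA ltr_pdivrMr; last by rewrite mulr_gt0// ltr_wpDl.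
by rewrite mulrC ltr_pM2l//; lra.
Qed.

End subharmonic.

(** * Comparison of v with a power of u *)

Section lower_bound.
Context {R : realType} {n : nat}.
Variables (p : R) (u : 'rV[R]_n -> R).
Hypotheses (n3 : (3 <= n)%N) (p1 : 1 < p) (sol : solution p u) (st : stable p u).

(** With s = (p + 1) / 2 the constant satisfies l^2 s = 1. This is what gives, for w = l u^s + Lap
    u, the inequality Lap w >= l s u^(s-1) w, the gradient term having a good sign because s >=
    1. *)
Lemma lap_le_power x :
  Num.sqrt (2 / (p + 1)) * u x `^ ((p + 1) / 2) <= - lap u x.
Proof.
set l := Num.sqrt _; set s := (p + 1) / 2.
have Cu : Ck 4 u by case: sol => h _ _; split.
have u0 y : 0 < u y by case: sol.
have ueq y : lap (lap u) y = u y `^ p by case: sol => _ _ /(_ y); rewrite !laplacianE.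
have p10 : 0 < p + 1 by have := p1; lra.
have s0 : 0 < s by rewrite /s divr_gt0.
have l0 : 0 < l by rewrite sqrtr_gt0 divr_gt0.
have l2 : l ^+ 2 = 2 / (p + 1) by rewrite sqr_sqrtr// divr_ge0// ltW.
have Cu2 : Ck 2 u by ck.
have Cl : Ck 2 (lap u) by ck.
have Cs : Ck 2 (fun x => u x `^ s) by ck.
have Cls : Ck 2 (fun x => l * u x `^ s) by ck.
pose w y := l * u y `^ s + lap u y.
have Cw : Ck 2 w by apply: Ck_add.
have hw y : 0 < w y -> 0 <= lap w y.
  rewrite /w => wy; rewrite (lap_add _ Cls Cl) ueq (lap_scale _ _ Cs) (lap_powR _ _ Cu2)//.
  have -> : u y `^ p = u y `^ (s - 1) * u y `^ s.
    rewrite -powRD; last by apply/implyP => _; rewrite gt_eqF.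
    by congr (_ `^ _); rewrite /s; field.
  have ls : l ^+ 2 * s = 1.
    by rewrite l2 /s; field; rewrite gt_eqF.
  have s1 : 0 <= s - 1 by have := p1; rewrite /s; lra.
  have := powR_ge0 (u y) (s - 1 - 1); have := powR_ge0 (u y) (s - 1).
  move: wy (grad2_ge0 u y); move: (lap u y) (grad2 u u y) (u y `^ s) (u y `^ (s - 1)) (u y `^ (s - 1 - 1)).
  move=> L G S S1 S2 wy G0 S10 S20.
  have -> : l * (s * S1 * L + s * (s - 1) * S2 * G) + S1 * S =
    l * s * S1 * (l * S + L) + (l * s) * (s - 1) * S2 * G + (1 - l ^+ 2 * s) * (S1 * S) by ring.
  by rewrite ls subrr mul0r addr0; pos.
have [m [C [C0 hE]]] := energy_bound p1 sol st.
have p10' : 0 < p - 1 by rewrite subr_gt0.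
have lp : 0 <= 2 / (p + 1) by rewrite divr_ge0// ltW.
(* The energy exponent 2 (p + 1) / (p - 1) equals 2 + b with b = 4 / (p - 1), within the growth
   allowed there. *)
have := @subharmonic_eq0 R n (ramp w) m ((2 * (l ^+ 2 + 1)) * C) (4 / (p - 1)) n3
  (Ck_ramp Cw) (ramp_ge0 w) (fun x => lap_ramp_ge0 Cw (hw x)) _ _ _ x.
move=> H; have /ramp_le0 : ramp w x <= 0.
  apply: H; [by pos|by rewrite divr_ge0// ltW|move=> e e0].
  have -> : 2 + 4 / (p - 1) = 2 * (p + 1) / (p - 1).
    by field; rewrite gt_eqF.
  have K0 : 0 <= 2 * (l ^+ 2 + 1) by pos.
  rewrite -[leRHS]mulrA; apply: le_trans (ler_wpM2l K0 (hE e e0)).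
  have cP : cbs (fun x => u x `^ (p + 1) * (cutoff e x ^+ m.+1) ^+ 2) by cb.
  have cL : cbs (fun x => lap u x ^+ 2 * (cutoff e x ^+ m.+1) ^+ 2) by cb.
  have cW : cbs (fun x => ramp w x ^+ 2 * (cutoff e x ^+ m.+1) ^+ 2).
    have Cr := Ck_ramp Cw; cb.
  have := @I_lin_ge0 _ _ [::
    (2 * (l ^+ 2 + 1), fun x => u x `^ (p + 1) * (cutoff e x ^+ m.+1) ^+ 2);
    (2 * (l ^+ 2 + 1), fun x => lap u x ^+ 2 * (cutoff e x ^+ m.+1) ^+ 2);
    (-1, fun x => ramp w x ^+ 2 * (cutoff e x ^+ m.+1) ^+ 2)] (conj cP (conj cL (conj cW Logic.I))).
  rewrite /lin_I /lin_at /= => H2; rewrite -subr_ge0.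
  set A := integ _; set B := integ _; set E := integ _.
  suff : 0 <= 2 * (l ^+ 2 + 1) * A + (2 * (l ^+ 2 + 1) * B + (-1 * E + 0)).
    by congr (_ <= _); ring.
  apply: H2 => y; have := ramp_sqr w y; rewrite /w.
  have -> : u y `^ (p + 1) = (u y `^ s) ^+ 2.
    by rewrite -powR_mulrn ?powR_ge0// -powRrM; congr (_ `^ _); rewrite /s; field.
  move: (lap u y) (u y `^ s) (cutoff e y ^+ m.+1) (ramp _ y) => L S t r h.
  have : 0 <= (2 * (l ^+ 2 + 1) * (S ^+ 2 + L ^+ 2) - r ^+ 2) * t ^+ 2.
    apply: mulr_ge0; last by pos.
    rewrite subr_ge0; apply: (le_trans h); rewrite -subr_ge0.
    rewrite (_ : _ - _ = (l * S - L) ^+ 2 + 2 * S ^+ 2 + 2 * (l * L) ^+ 2); last by ring.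
    by pos.
  by congr (_ <= _); ring.
by rewrite /w -lerBrDr sub0r.
Qed.

End lower_bound.

(** * The weight on the annulus of the cutoff *)

Section weighted_cutoff.
Context {R : realType} {n : nat}.
Implicit Types (e tau : R) (x : 'rV[R]_n).
Let c := @cutC R n.

Let c8 : 8 <= c.
Proof. by rewrite /c /cutC; have := @ler0n R n; lra. Qed.

Lemma grad2_cutoff_r2_le e x : 0 < e -> `|grad2 (cutoff e) r2 x| <= c.
Proof.
move=> e0; have c0 : 0 <= c by apply: le_trans c8.
have [h|h] := leP 2 (e * r2 x); first by rewrite grad2_cutoff_out// normr0.
rewrite -[leRHS]ger0_norm// -ler_sqr ?nnegrE ?normr_ge0// !real_normK ?num_real//.
apply: (le_trans (grad2_CS _ _ _)); rewrite grad2_r2.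
have := grad2_cutoff_le x e0; rewrite -/c => q.
apply: (@le_trans _ _ (c * e * (4 * r2 x))).
  by rewrite ler_wpM2r// mulr_ge0// r2_ge0.
have -> : c * e * (4 * r2 x) = c * (4 * (e * r2 x)) by ring.
by rewrite expr2 ler_wpM2l//; move: c8 h; move: (e * _) c; clear=> a b; lra.
Qed.

(** Inside the ball all derivatives of the cutoff vanish; outside it w^2 <= e^tau and t <= e. Hence
    each error term is e^tau times e or e^2, according to the number of derivatives it carries. *)
Lemma annulus_bounds tau e x : 0 < e -> e <= 1 -> 0 <= tau ->
  let w := wt tau x in let t := wt 2 x in let g := grad2 (cutoff e) r2 x in
  let q := grad2 (cutoff e) (cutoff e) x in let L := lap (cutoff e) x in
  let k := e `^ tau in
  [/\ w ^+ 2 * q <= c * (k * e), w ^+ 2 * t * `|g| <= c * (k * e),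
     w ^+ 2 * q ^+ 2 <= c ^+ 2 * (k * e ^+ 2) &
     w ^+ 2 * L ^+ 2 <= c ^+ 2 * (k * e ^+ 2)] /\
  [/\ w ^+ 2 * t ^+ 2 * g ^+ 2 <= c ^+ 2 * (k * e ^+ 2),
     w ^+ 2 * t * q <= c * (k * e ^+ 2),
     w ^+ 2 * t * `|L| <= c * (k * e ^+ 2) &
     w ^+ 2 * t ^+ 2 * `|g| <= c * (k * e ^+ 2)].
Proof.
move=> e0 e1 tau0 w t g q L k; have c0 : 0 <= c by apply: le_trans c8.
have k0 : 0 <= k by exact: powR_ge0.
suff [[g0 q0 L0]|[hw ht]] : [/\ g = 0, q = 0 & L = 0] \/ (w ^+ 2 <= k /\ t <= e).
- rewrite g0 q0 L0 !expr0n !normr0 !mulr0.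
  by split; split; pos.
- have hq := grad2_cutoff_le x e0; have hL := lap_cutoff_le x e0.
  have hg := grad2_cutoff_r2_le x e0; have q0 := grad2_ge0 (@cutoff R n e) x.
  have t0 : 0 <= t by exact: ltW (wt_gt0 _ _).
  have w0 : 0 <= w ^+ 2 by exact: sqr_ge0.
  rewrite -/c -/q -/L -/g in hq hL hg q0.
  clearbody w t g q L k.
  have hq2 : q ^+ 2 <= (c * e) ^+ 2 by rewrite ler_sqr ?nnegrE//; pos.
  have hL2 : L ^+ 2 <= (c * e) ^+ 2.
    by rewrite -[L ^+ 2]real_normK ?num_real// ler_sqr ?nnegrE//; pos.
  have hg2 : g ^+ 2 <= c ^+ 2.
    by rewrite -[g ^+ 2]real_normK ?num_real// ler_sqr ?nnegrE//; pos.
  have ht2 : t ^+ 2 <= e ^+ 2 by rewrite ler_sqr ?nnegrE//; pos.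
  have M (a b a' b' : R) : 0 <= a -> 0 <= b -> a <= a' -> b <= b' -> a * b <= a' * b'.
    by exact: ler_pM.
  have wt_ : w ^+ 2 * t <= k * e by apply: M.
  have wt2_ : w ^+ 2 * t ^+ 2 <= k * e ^+ 2 by apply: M => //; pos.
  split; split.
  + have -> : c * (k * e) = k * (c * e) by ring.
    by apply: M.
  + by rewrite mulrC; apply: M => //; pos.
  + have -> : c ^+ 2 * (k * e ^+ 2) = k * (c * e) ^+ 2 by ring.
    by apply: M => //; pos.
  + have -> : c ^+ 2 * (k * e ^+ 2) = k * (c * e) ^+ 2 by ring.
    by apply: M => //; pos.
  + by rewrite mulrC; apply: M => //; pos.
  + have -> : c * (k * e ^+ 2) = k * e * (c * e) by ring.
    by apply: M => //; pos.
  + have -> : c * (k * e ^+ 2) = k * e * (c * e) by ring.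
    by apply: M => //; pos.
  + by rewrite mulrC; apply: M => //; pos.
have [h|h] := leP (e * r2 x) 1.
  by left; rewrite /g /q /L !grad2_cutoff_in// lap_cutoff_in.
right; split; last first.
  have := @wt_annulus R n e 2 x e0 (ltW h) (ler0n R 2).
  by rewrite divff// powRr1// ltW.
rewrite expr2 -wtD /k; have := @wt_annulus R n e (tau + tau) x e0 (ltW h) (addr_ge0 tau0 tau0).
by rewrite (_ : (tau + tau) / 2 = tau)//; field.
Qed.

(** The converse comparison: on the support of the cutoff e (1 + |x|^2) <= 3, because e <= 1. It
    allows an error with constant factor e^tau to be absorbed in a weighted integral. *)
Lemma cutoff_weight_le tau e x : 0 < e -> e <= 1 -> 0 <= tau ->
  e `^ tau * cutoff e x <= 3 `^ tau * (wt tau x ^+ 2 * cutoff e x).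
Proof.
move=> e0 e1 tau0; have [h|h] := leP 2 (e * r2 x).
  by rewrite cutoff_out// !mulr0.
rewrite mulrA; apply: ler_wpM2r; first exact: cutoff_ge0.
have b0 := wt_base x.
have -> : wt tau x ^+ 2 = (1 + r2 x)^-1 `^ tau.
  rewrite expr2 -wtD wtE -[in RHS]powR_inv1 ?(ltW b0)// -powRrM.
  by congr (_ `^ _); field.
rewrite -powRM ?invr_ge0 ?(ltW b0)//; apply: ge0_ler_powR => //.
- by rewrite nnegrE ltW.
- by rewrite nnegrE divr_ge0// ltW.
- rewrite ler_pdivlMr//; move: e1 h; clear; move: (r2 x) => r.
  by move=> e1 h; rewrite mulrDr mulr1; lra.
Qed.

End weighted_cutoff.

(** * Pointwise inequalities for the weighted test function *)

Section pointwise.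
Context {R : realType}.
Implicit Types (x y a b : R).

Lemma amgm x a b : 0 <= a -> 0 <= b -> x ^+ 2 <= a * b -> 2 * x <= a + b.
Proof.
move=> a0 b0 h; have ab : 0 <= a + b by pos.
have [x0|x0] := leP x 0; first by apply: le_trans ab; rewrite pmulr_rle0.
rewrite -ler_sqr ?nnegrE//; last by pos.
rewrite -subr_ge0 (_ : _ - _ = (a - b) ^+ 2 + 4 * (a * b - x ^+ 2)); last by ring.
apply: addr_ge0; first by pos.
by apply: mulr_ge0 => //; rewrite subr_ge0.
Qed.

(* Here a = u^(k-1), U = u, V = - Lap u, w^2 = (1+|x|^2)^(-tau), t = (1+|x|^2)^(-1)
   and z^2 th is the cutoff.  The two subtracted brackets are u^k w^2 (z^2 th)^2 against
   u and u^(k+1) (z^2 th)^2 against w^2 in Green's formula, and integrate to 0. *)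
Lemma hardy_point (a U V w t g d q G h K e z th M k tau nu c del : R) :
  0 <= a -> 0 < U -> 0 <= t -> 0 <= G -> 0 <= q -> 0 <= z -> z <= 1 ->
  0 < M -> 0 < k -> 0 < tau -> 0 < nu -> 0 < del -> 0 <= c -> 0 <= K -> 0 <= e ->
  d ^+ 2 <= q * G -> h ^+ 2 <= G * (4 * tau ^+ 2 * ((w ^+ 2) ^+ 2 * t)) ->
  w ^+ 2 * q <= c * (K * e) -> w ^+ 2 * t * `|g| <= c * (K * e) ->
  V * (a * U) * (w * (z ^+ 2 * th)) ^+ 2 <=
  (k + 2 * (tau * (k + 1) / nu) + del) * (a * G * (w * (z ^+ 2 * th)) ^+ 2) +
  (M ^+ 2 / del + 2 * M * tau) * c * (K * e) * (a * U ^+ 2 * (z * th) ^+ 2) -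
  (a * U * w ^+ 2 * (z ^+ 2 * th) ^+ 2 * - V +
    (k * a * G * (w ^+ 2 * (z ^+ 2 * th) ^+ 2) + a * U * ((z ^+ 2 * th) ^+ 2 * h +
      w ^+ 2 * (2 * M * (z ^+ 3 * th ^+ 2) * d)))) -
  (k + 1)^-1 * (a * U ^+ 2 * (z ^+ 2 * th) ^+ 2 *
      (- (2 * tau * nu) * (w ^+ 2 * t) - 2 * tau * (2 * tau + 2) * (w ^+ 2 * t ^+ 2)) +
    ((k + 1) * (a * U) * ((z ^+ 2 * th) ^+ 2 * h) +
     a * U ^+ 2 * (2 * M * (z ^+ 3 * th ^+ 2) * (- tau * (w ^+ 2 * t) * g)))).
Proof.
move=> a0 U0 t0 G0 q0 z0 z1 M0 k0 tau0 nu0 d0 c0 K0 e0 hd hh hq hg.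
(* With this weight in Young's inequality, the term in U^2 w^2 t needed in T1 is exactly the one
   that the Laplacian of w^2 supplies in the second bracket. This is the Hardy inequality. The
   factor 2 in front of U h stands for one cross term from each bracket. *)
pose lam := tau * (k + 1) / nu.
have k1 : 0 < k + 1 by apply: addr_gt0.
have lam0 : 0 < lam by rewrite /lam; spos.
have T1 : 0 <= a * (z ^+ 2 * th) ^+ 2 * (2 * lam * (w ^+ 2 * G) +
    2 * tau ^+ 2 / lam * (U ^+ 2 * (w ^+ 2 * t)) - 2 * (U * h)).
  apply: mulr_ge0; first by pos.
  rewrite subr_ge0; apply: amgm; [by pos|by pos|].
  have -> : 2 * lam * (w ^+ 2 * G) * (2 * tau ^+ 2 / lam * (U ^+ 2 * (w ^+ 2 * t))) =
    U ^+ 2 * (G * (4 * tau ^+ 2 * ((w ^+ 2) ^+ 2 * t))) by field; rewrite gt_eqF.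
  by rewrite exprMn; apply: ler_wpM2l => //; pos.
have T2 : 0 <= a * (z * th) ^+ 2 * w ^+ 2 * (del * (z ^+ 2 * G) +
    M ^+ 2 / del * (U ^+ 2 * q) - 2 * (M * U * z * d)).
  apply: mulr_ge0; first by pos.
  rewrite subr_ge0; apply: amgm; [by pos|by pos|].
  have -> : del * (z ^+ 2 * G) * (M ^+ 2 / del * (U ^+ 2 * q)) =
    (M * U * z) ^+ 2 * (q * G) by field; rewrite gt_eqF.
  by rewrite exprMn; apply: ler_wpM2l => //; pos.
have T3 : 0 <= a * U ^+ 2 * (z * th) ^+ 2 * (M ^+ 2 / del) * (c * (K * e) - w ^+ 2 * q).
  by apply: mulr_ge0; [pos|rewrite subr_ge0].
have T4 : 0 <= a * U ^+ 2 * (z * th) ^+ 2 * (2 * M * tau) *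
    (c * (K * e) - (k + 1)^-1 * (z * (w ^+ 2 * t * - g))).
  apply: mulr_ge0; first by pos.
  rewrite subr_ge0; apply: le_trans hg.
  have wt0 : 0 <= w ^+ 2 * t by pos.
  have k1' : (k + 1)^-1 <= 1 by rewrite invf_le1// lerDr ltW.
  have [g0|g0] := leP 0 g.
    apply: (@le_trans _ _ 0); last by pos.
    by rewrite mulrN !mulrN oppr_le0; pos.
  rewrite ltr0_norm//; have ng : 0 <= - g by rewrite oppr_ge0 ltW.
  have h0 : 0 <= w ^+ 2 * t * - g by exact: mulr_ge0.
  rewrite [leLHS]mulrA; apply: ler_piMl => //; apply: mulr_ile1 => //.
  by rewrite invr_ge0 ltW.
have T5 : 0 <= a * U ^+ 2 * (z ^+ 2 * th) ^+ 2 *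
    (2 * tau * (2 * tau + 2) * (w ^+ 2 * t ^+ 2)) / (k + 1) by pos.
rewrite -subr_ge0.
(* The two sides differ exactly by T1 + ... + T5: T2, T3 and T4 handle the derivatives of the
   cutoff, and T5 is the lower order part of the Laplacian of w^2. *)
have := addr_ge0 (addr_ge0 (addr_ge0 T1 T2) (addr_ge0 T3 T4)) T5.
congr (_ <= _); rewrite /lam; field.
by rewrite !gt_eqF.
Qed.

Lemma sqr_sum_young del a b : 0 < del ->
  (a + b) ^+ 2 <= (1 + del) * a ^+ 2 + (1 + del^-1) * b ^+ 2.
Proof.
move=> d0; have := young a b d0; rewrite sqrrD -mulrA mulr_natl => h.
by rewrite !mulrDl !mul1r -subr_ge0; move: h; rewrite -subr_ge0; congr (_ <= _); ring.
Qed.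

(** Separates, in the remainder for v and w z^2 th, the part where only the weight is
    differentiated, at the price of a factor 1 + del. Here b = grad v . grad w, Lw = Lap w, P = u^p,
    G = |grad v|^2, while gv and gw are the products of the gradient of the cutoff with those of v
    and w. The three contributions Q1, Q2, Q3 of the cutoff are of lower order in e. *)
Lemma remainder_point (V P w t g gv G b Lw q L K e z th M tau c del W gw : R) :
  0 <= V -> 0 <= P -> 0 <= z -> z <= 1 -> 1 <= M -> 0 <= tau -> 0 < del -> 0 <= c ->
  0 <= q -> 0 <= G -> 0 <= t -> t <= 1 -> 0 <= K -> 0 <= e ->
  gv ^+ 2 <= q * G ->
  w ^+ 2 * q <= c * (K * e) -> w ^+ 2 * t * `|g| <= c * (K * e) ->
  w ^+ 2 * q ^+ 2 <= c ^+ 2 * (K * e ^+ 2) ->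
  w ^+ 2 * L ^+ 2 <= c ^+ 2 * (K * e ^+ 2) ->
  w ^+ 2 * t ^+ 2 * g ^+ 2 <= c ^+ 2 * (K * e ^+ 2) ->
  W = tau ^+ 2 * (w ^+ 2 * t - w ^+ 2 * t ^+ 2) ->
  gw = - (tau / 2) * (w * t) * g ->
  (2 * ((z ^+ 2 * th) * b + w * (M * (z * th) * gv)) +
     V * (w * (M * (z * th) * L + M * (M - 1) * th * q) + (z ^+ 2 * th) * Lw +
       2 * (M * (z * th) * gw))) ^+ 2 +
  2 * V * P * ((z ^+ 2 * th) ^+ 2 * W +
    2 * (w * (z ^+ 2 * th) * (M * (z * th) * gw)) + w ^+ 2 * (M ^+ 2 * (z * th) ^+ 2 * q)) <=
  (1 + del) * ((z ^+ 2 * th) ^+ 2 * ((2 * b + V * Lw) ^+ 2 + 2 * V * P * W)) +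
  (1 + del^-1) * (12 * M ^+ 2 * c) * (e * K * (G * (z * th) ^+ 2)) +
  (1 + del^-1) * (3 * M ^+ 2 * tau ^+ 2 * c ^+ 2 + 6 * M ^+ 4 * c ^+ 2) *
    (K * e ^+ 2 * (V ^+ 2 * th ^+ 2)) +
  2 * (M * tau + M ^+ 2) * c * (K * e * (V * P * (z * th) ^+ 2)).
Proof.
move=> V0 P0 z0 z1 M1 tau0 d0 c0 q0 G0 t0 t1 K0 e0 hgv hq hg hq2 hL2 hg2 WE gwE.
have M0 : 0 <= M by apply: le_trans M1.
have z2 : z ^+ 2 <= 1 by apply: exprn_ile1.
have di : 0 <= 1 + del^-1 by pos.
have W0 : 0 <= W.
  have : 0 <= tau ^+ 2 * (w ^+ 2 * t * (1 - t)).
    by apply: mulr_ge0; [pos|apply: mulr_ge0; [pos|rewrite subr_ge0]].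
  by rewrite WE; congr (_ <= _); ring.
set Q1 := 2 * (w * (M * (z * th) * gv)).
set Q2 := V * (w * (M * th * (z * L + (M - 1) * q))).
set Q3 := V * (2 * (M * (z * th) * gw)).
have h1 : 3 * Q1 ^+ 2 <= 12 * M ^+ 2 * c * (e * K * (G * (z * th) ^+ 2)).
  have -> : 3 * Q1 ^+ 2 = 12 * M ^+ 2 * (z * th) ^+ 2 * (w ^+ 2 * gv ^+ 2) by rewrite /Q1; ring.
  have -> : 12 * M ^+ 2 * c * (e * K * (G * (z * th) ^+ 2)) =
    12 * M ^+ 2 * (z * th) ^+ 2 * (c * (K * e) * G) by ring.
  apply: ler_wpM2l; first by pos.
  apply: (@le_trans _ _ (w ^+ 2 * (q * G))); first by apply: ler_wpM2l => //; pos.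
  by rewrite mulrA; apply: ler_wpM2r.
have h2 : 3 * Q2 ^+ 2 <= 6 * M ^+ 4 * c ^+ 2 * (K * e ^+ 2 * (V ^+ 2 * th ^+ 2)).
  have -> : 3 * Q2 ^+ 2 = 3 * M ^+ 2 * V ^+ 2 * th ^+ 2 *
    (w ^+ 2 * (z * L + (M - 1) * q) ^+ 2) by rewrite /Q2; ring.
  have -> : 6 * M ^+ 4 * c ^+ 2 * (K * e ^+ 2 * (V ^+ 2 * th ^+ 2)) =
    3 * M ^+ 2 * V ^+ 2 * th ^+ 2 * (2 * M ^+ 2 * (c ^+ 2 * (K * e ^+ 2))) by ring.
  apply: ler_wpM2l; first by pos.
  set Y := c ^+ 2 * (K * e ^+ 2) in hL2 hq2 *.
  have Y0 : 0 <= Y by rewrite /Y; pos.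
  apply: (@le_trans _ _ (2 * (z ^+ 2 * (w ^+ 2 * L ^+ 2)) +
      2 * (M - 1) ^+ 2 * (w ^+ 2 * q ^+ 2))).
    have -> : 2 * (z ^+ 2 * (w ^+ 2 * L ^+ 2)) + 2 * (M - 1) ^+ 2 * (w ^+ 2 * q ^+ 2) =
      w ^+ 2 * (2 * (z * L) ^+ 2 + 2 * ((M - 1) * q) ^+ 2) by ring.
    apply: ler_wpM2l; first by pos.
    exact: sqr_sum_le.
  apply: (@le_trans _ _ (2 * Y + 2 * (M - 1) ^+ 2 * Y)).
    apply: lerD; last by apply: ler_wpM2l => //; pos.
    apply: ler_wpM2l => //; apply: le_trans hL2.
    by apply: ler_piMl => //; pos.
  rewrite -subr_ge0 (_ : _ - _ = 4 * Y * (M - 1)); last by ring.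
  by apply: mulr_ge0; [pos|rewrite subr_ge0].
have h3 : 3 * Q3 ^+ 2 <= 3 * M ^+ 2 * tau ^+ 2 * c ^+ 2 * (K * e ^+ 2 * (V ^+ 2 * th ^+ 2)).
  have -> : 3 * Q3 ^+ 2 = 3 * M ^+ 2 * tau ^+ 2 * V ^+ 2 * th ^+ 2 *
    (z ^+ 2 * (w ^+ 2 * t ^+ 2 * g ^+ 2)) by rewrite /Q3 gwE; field.
  have -> : 3 * M ^+ 2 * tau ^+ 2 * c ^+ 2 * (K * e ^+ 2 * (V ^+ 2 * th ^+ 2)) =
    3 * M ^+ 2 * tau ^+ 2 * V ^+ 2 * th ^+ 2 * (c ^+ 2 * (K * e ^+ 2)) by ring.
  apply: ler_wpM2l; first by pos.
  by apply: le_trans hg2; apply: ler_piMl => //; pos.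
have hQ : (Q1 + Q2 + Q3) ^+ 2 <= 3 * Q1 ^+ 2 + 3 * Q2 ^+ 2 + 3 * Q3 ^+ 2.
  rewrite -subr_ge0 (_ : _ - _ = (Q1 - Q2) ^+ 2 + (Q2 - Q3) ^+ 2 + (Q1 - Q3) ^+ 2); last by ring.
  by pos.
have h4 : 2 * V * P * (2 * (w * (z ^+ 2 * th) * (M * (z * th) * gw)) +
    w ^+ 2 * (M ^+ 2 * (z * th) ^+ 2 * q)) <=
  2 * (M * tau + M ^+ 2) * c * (K * e * (V * P * (z * th) ^+ 2)).
  have -> : 2 * V * P * (2 * (w * (z ^+ 2 * th) * (M * (z * th) * gw)) +
      w ^+ 2 * (M ^+ 2 * (z * th) ^+ 2 * q)) =
    2 * V * P * (z * th) ^+ 2 * (M * tau * (z * (w ^+ 2 * t * - g)) + M ^+ 2 * (w ^+ 2 * q)).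
    by rewrite gwE; field.
  have -> : 2 * (M * tau + M ^+ 2) * c * (K * e * (V * P * (z * th) ^+ 2)) =
    2 * V * P * (z * th) ^+ 2 * (M * tau * (c * (K * e)) + M ^+ 2 * (c * (K * e))) by ring.
  apply: ler_wpM2l; first by pos.
  apply: lerD; last by apply: ler_wpM2l => //; pos.
  apply: ler_wpM2l; first by pos.
  apply: le_trans hg; apply: (@le_trans _ _ (z * (w ^+ 2 * t * `|g|))).
    apply: ler_wpM2l => //; apply: ler_wpM2l; first by pos.
    by rewrite -normrN ler_norm.
  by apply: ler_piMl => //; pos.
have h5 := sqr_sum_young ((z ^+ 2 * th) * (2 * b + V * Lw)) (Q1 + Q2 + Q3) d0.
have h6 := ler_wpM2l di (le_trans hQ (lerD (lerD h1 h2) h3)).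
have h7 : 0 <= del * ((z ^+ 2 * th) ^+ 2 * (2 * V * P * W)) by pos.
have E : 2 * ((z ^+ 2 * th) * b + w * (M * (z * th) * gv)) +
     V * (w * (M * (z * th) * L + M * (M - 1) * th * q) + (z ^+ 2 * th) * Lw +
       2 * (M * (z * th) * gw)) = (z ^+ 2 * th) * (2 * b + V * Lw) + (Q1 + Q2 + Q3).
  by rewrite /Q1 /Q2 /Q3; ring.
rewrite E -(addrA ((z ^+ 2 * th) ^+ 2 * W)) [2 * V * P * (_ + (_ + _))]mulrDr.
move: h4 h5 h6 h7.
set X1 := 2 * V * P * (_ + _); set Y4 := 2 * _ * c * _.
set A0 := z ^+ 2 * th * _; set Q := Q1 + Q2 + Q3.
have -> : (1 + del) * ((z ^+ 2 * th) ^+ 2 * ((2 * b + V * Lw) ^+ 2 + 2 * V * P * W)) =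
    (1 + del) * A0 ^+ 2 + (1 + del) * ((z ^+ 2 * th) ^+ 2 * (2 * V * P * W)).
  by rewrite /A0; ring.
have -> : 2 * V * P * ((z ^+ 2 * th) ^+ 2 * W) = (z ^+ 2 * th) ^+ 2 * (2 * V * P * W) by ring.
set X0 := (z ^+ 2 * th) ^+ 2 * (2 * V * P * W).
set Y1 := e * K * _; set Y2 := K * e ^+ 2 * _.
rewrite -(mulrA (1 + del^-1) (12 * M ^+ 2 * c) Y1) -(mulrA (1 + del^-1) (_ + _) Y2).
have -> : (3 * M ^+ 2 * tau ^+ 2 * c ^+ 2 + 6 * M ^+ 4 * c ^+ 2) * Y2 =
  6 * M ^+ 4 * c ^+ 2 * Y2 + 3 * M ^+ 2 * tau ^+ 2 * c ^+ 2 * Y2 by ring.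
move: (12 * _ * _ * Y1) (6 * _ * _ * Y2) (3 * _ * _ * _ * Y2) (1 + del^-1).
clearbody X1 Y4 A0 Q X0; clear => y1 y2 y3 D h4 h5 h6 h7.
move: h5 h6; move: ((A0 + Q) ^+ 2) (A0 ^+ 2) (Q ^+ 2) => a2 a0 q2.
rewrite !mulrDl !mulrDr !mul1r; move: h7 h4.
move: (D * q2) (D * y1) (D * y2) (D * y3) (del * X0) (del * a0) => d1 d2 d3 d4 d5 d6.
clear; lra.
Qed.

(* With W = |grad w|^2 and Lw = Lap w, the last three brackets come from Green's formula
   for v X W against v, v^2 against X W, and v^2 X Lw against w.  They trade
   (2 grad v . grad w + v Lap w)^2 for 4 v W Lap v + v^2 (2 Lap W - Lw^2 - 2 grad Lw . grad w),
   and the last factor is at most - tau^2 Kt w^2 t^2. *)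
Lemma weight_point (V P w t g gv gG b h1 q L K e z th M tau c N Kt
    X dX W dW gw Lw gL gpw : R) :
  0 <= V -> 0 <= P -> 0 <= z -> z <= 1 -> 1 <= M -> 0 <= tau -> 0 <= c ->
  0 <= q -> 0 <= t -> t <= 1 -> 0 <= K -> 0 <= e -> 0 < Kt -> 0 <= N - 2 - tau ->
  Kt = 4 * (tau + 1) * (N - 4 - 2 * tau) + (N - 2 - tau) * (N - 6 - 3 * tau) ->
  w ^+ 2 * t * q <= c * (K * e ^+ 2) ->
  w ^+ 2 * t * `|L| <= c * (K * e ^+ 2) ->
  w ^+ 2 * t ^+ 2 * `|g| <= c * (K * e ^+ 2) ->
  X = (z ^+ 2 * th) ^+ 2 ->
  dX = 2 * (z ^+ 2 * th) * (M * (z * th) * L + M * (M - 1) * th * q) +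
    2 * (M ^+ 2 * (z * th) ^+ 2 * q) ->
  W = tau ^+ 2 * (w ^+ 2 * t - w ^+ 2 * t ^+ 2) ->
  b ^+ 2 <= gG * W ->
  dW = tau ^+ 2 * ((- ((2 * tau + 2) * (N - 4 - 2 * tau)) * (w ^+ 2 * t ^+ 2) -
      (2 * tau + 2) * (2 * tau + 4) * (w ^+ 2 * t ^+ 3)) -
    (- ((2 * tau + 4) * (N - 6 - 2 * tau)) * (w ^+ 2 * t ^+ 3) -
      (2 * tau + 4) * (2 * tau + 6) * (w ^+ 2 * t ^+ 4))) ->
  gw = tau ^+ 2 * (- (tau + 1) * (w ^+ 2 * t ^+ 2) * g + (tau + 2) * (w ^+ 2 * t ^+ 3) * g) ->
  Lw = - (tau * (N - 2 - tau)) * (w * t) - tau * (tau + 2) * (w * t ^+ 2) ->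
  gL = - (tau * (N - 2 - tau)) * ((tau + 2) * tau * (w ^+ 2 * t ^+ 2 - w ^+ 2 * t ^+ 3)) -
    tau * (tau + 2) * ((tau + 4) * tau * (w ^+ 2 * t ^+ 3 - w ^+ 2 * t ^+ 4)) ->
  gpw = - (tau / 2) * (w * t) * g ->
  X * ((2 * b + V * Lw) ^+ 2 + 2 * V * P * W) <=
  9 * tau ^+ 2 / Kt * (P ^+ 2 * (w * (z ^+ 2 * th)) ^+ 2) +
  c * (8 * tau ^+ 2 * M ^+ 2 + 8 * M * tau ^+ 2 * (2 * tau + 3) +
    2 * M * tau * (tau * (N - 2 - tau) + tau * (tau + 2))) * (K * e ^+ 2 * (V ^+ 2 * th ^+ 2)) +
  4 * (V * (X * W) * - P + (V * (X * h1 + W * (2 * M * (z ^+ 3 * th ^+ 2) * gv)) + X * W * gG)) -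
  2 * (V ^+ 2 * (X * dW + W * dX + 2 * (2 * M * (z ^+ 3 * th ^+ 2) * gw)) +
    2 * V * (X * h1 + W * (2 * M * (z ^+ 3 * th ^+ 2) * gv))) +
  2 * (V ^+ 2 * (X * Lw) * Lw + (V ^+ 2 * (X * gL + Lw * (2 * M * (z ^+ 3 * th ^+ 2) * gpw)) +
    X * Lw * (2 * V * b))).
Proof.
move=> V0 P0 z0 z1 M1 tau0 c0 q0 t0 t1 K0 e0 Kt0 N0 KtE hq hL hg XE dXE WE hb dWE gwE LwE gLE gpwE.
have M0 : 0 <= M by apply: le_trans M1.
have M10 : 0 <= M - 1 by rewrite subr_ge0.
have z2 : z ^+ 2 <= 1 by apply: exprn_ile1.
have z3 : z ^+ 3 <= 1 by apply: exprn_ile1.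
have X0 : 0 <= X by rewrite XE; pos.
set Y := c * (K * e ^+ 2) in hq hL hg *.
have T1 : 0 <= X * (4 * (gG * W - b ^+ 2)).
  by apply: mulr_ge0 => //; apply: mulr_ge0 => //; rewrite subr_ge0.
(* Origin of 9 tau^2 / Kt: V P W occurs six times, twice on the left and four times through - Lap v
   = - (- P), and 6 P V t - Kt V^2 t^2 <= 9 P^2 / Kt by completing the square. *)
have T2 : 0 <= X * w ^+ 2 * (tau ^+ 2 / Kt * (3 * P - Kt * V * t) ^+ 2 +
    6 * V * P * tau ^+ 2 * t ^+ 2) by pos.
(* The weight terms in V^2 of order t^3 and t^4, which have a good sign because t <= 1. *)
have T3 : 0 <= X * w ^+ 2 * V ^+ 2 * tau ^+ 2 * (tau + 2) * t ^+ 3 *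
    ((16 + 10 * tau) - (5 * tau + 14) * t).
  apply: mulr_ge0; first by pos.
  rewrite subr_ge0; apply: (@le_trans _ _ (5 * tau + 14)).
    by apply: ler_piMr => //; pos.
  by move: tau0; clear; lra.
have T4 : 0 <= V ^+ 2 * th ^+ 2 * (2 * tau ^+ 2) *
    (4 * M ^+ 2 * Y - z ^+ 2 * (1 - t) * (2 * M * (z * (w ^+ 2 * t * L)) +
      (4 * M ^+ 2 - 2 * M) * (w ^+ 2 * t * q))).
  apply: mulr_ge0; first by pos.
  have Y0 : 0 <= Y by rewrite /Y; pos.
  have h2 : 2 * M * (z * (w ^+ 2 * t * L)) + (4 * M ^+ 2 - 2 * M) * (w ^+ 2 * t * q) <= 4 * M ^+ 2 * Y.
    have -> : 4 * M ^+ 2 * Y = 2 * M * Y + (4 * M ^+ 2 - 2 * M) * Y by ring.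
    apply: lerD; apply: ler_wpM2l => //; try by pos.
      apply: le_trans hL; apply: (@le_trans _ _ (z * (w ^+ 2 * t * `|L|))).
        by apply: ler_wpM2l => //; apply: ler_wpM2l; [pos|exact: ler_norm].
      by apply: ler_piMl => //; pos.
    have -> : 4 * M ^+ 2 - 2 * M = 2 * M * (M - 1) + 2 * M ^+ 2 by ring.
    by pos.
  have t10 : 0 <= 1 - t by rewrite subr_ge0.
  have zt0 : 0 <= z ^+ 2 * (1 - t) by pos.
  have zt1 : z ^+ 2 * (1 - t) <= 1.
    by apply: mulr_ile1 => //; [pos|rewrite gerBl].
  rewrite subr_ge0; apply: le_trans (ler_wpM2l zt0 h2) _.
  by apply: ler_piMl => //; pos.
have T5 : 0 <= V ^+ 2 * th ^+ 2 * (8 * M * tau ^+ 2) *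
    ((2 * tau + 3) * Y - z ^+ 3 * (- (tau + 1) + (tau + 2) * t) * (w ^+ 2 * t ^+ 2 * g)).
  apply: mulr_ge0; first by pos.
  rewrite subr_ge0; apply: le_trans (ler_norm _) _; rewrite normrM.
  have wt0 : 0 <= w ^+ 2 * t ^+ 2 by pos.
  apply: ler_pM => //; last by rewrite normrM ger0_norm.
  rewrite normrM (ger0_norm (_ : 0 <= z ^+ 3)); last by pos.
  rewrite -[leRHS]mul1r; apply: ler_pM => //; first by pos.
  by rewrite ler_norml; apply/andP; split; move: tau0 t0 t1; clear; nra.
have T6 : 0 <= V ^+ 2 * th ^+ 2 * (2 * M * tau) *
    ((tau * (N - 2 - tau) + tau * (tau + 2)) * Y +
     z ^+ 3 * (tau * (N - 2 - tau) + tau * (tau + 2) * t) * (w ^+ 2 * t ^+ 2 * g)).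
  apply: mulr_ge0; first by pos.
  have c10 : 0 <= tau * (N - 2 - tau) by pos.
  have c20 : 0 <= tau * (tau + 2) by pos.
  have -> (s r v : R) : s + r * v = s - r * - v by ring.
  rewrite subr_ge0; apply: le_trans (ler_norm _) _; rewrite normrM normrN.
  have wt0 : 0 <= w ^+ 2 * t ^+ 2 by pos.
  apply: ler_pM => //; last by rewrite normrM ger0_norm.
  rewrite ger0_norm; last by pos.
  rewrite -[leRHS]mul1r; apply: ler_pM => //; [by pos|by pos|].
  by rewrite lerD2l; apply: ler_piMr.
rewrite -subr_ge0.
have := addr_ge0 (addr_ge0 (addr_ge0 T1 T2) (addr_ge0 T3 T4)) (addr_ge0 T5 T6).
congr (_ <= _).
rewrite /Y dXE WE dWE gwE LwE gLE gpwE XE.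
have Kt0' : Kt != 0 by rewrite gt_eqF.
have -> : tau ^+ 2 / Kt * (3 * P - Kt * V * t) ^+ 2 =
  9 * tau ^+ 2 / Kt * P ^+ 2 - 6 * tau ^+ 2 * P * V * t + Kt * (tau ^+ 2 * V ^+ 2 * t ^+ 2) by field.
move: (9 * tau ^+ 2 / Kt) => Z; rewrite KtE.
by clear; field.
Qed.

End pointwise.

(** * Derivatives of powers of the cutoff *)

Section cutoff_powers.
Context {R : realType} {n : nat}.
Implicit Types (f : 'rV[R]_n -> R) (x : 'rV[R]_n) (tau e s : R) (m : nat).

Lemma wt_single tau s j x : s = tau + 2 * j%:R -> wt s x = wt tau x * wt 2 x ^+ j.
Proof.
move=> ->; elim: j => [|j IH]; first by rewrite mulr0 addr0 mulr1.
by rewrite exprSr mulrA -IH -wtD; congr (wt _ x); rewrite -natr1; ring.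
Qed.

Lemma wt_double tau s j x : s = 2 * tau + 2 * j%:R ->
  wt s x = wt tau x ^+ 2 * wt 2 x ^+ j.
Proof.
move=> sE; rewrite expr2 -wtD; apply: wt_single.
by rewrite sE; ring.
Qed.

Lemma grad2_cutoff_wt e s x : grad2 (cutoff e) (wt s) x =
  - (s / 2) * wt (s + 2) x * grad2 (cutoff e) r2 x.
Proof. by rewrite grad2C grad2_wtl grad2C. Qed.

Lemma cutoffS2 m e x : cutoff e x ^+ m.+3 = cutoff e x ^+ 2 * cutoff e x ^+ m.+1.
Proof. by rewrite -exprD. Qed.

Lemma cutoffS1 m e x : cutoff e x ^+ m.+2 = cutoff e x * cutoff e x ^+ m.+1.
Proof. by rewrite -exprS. Qed.

Lemma grad2_cutoff_exp m e f x : grad2 (fun x => cutoff e x ^+ m.+3) f x =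
  m.+3%:R * (cutoff e x * cutoff e x ^+ m.+1) * grad2 (cutoff e) f x.
Proof.
have Cc : Ck 1 (@cutoff R n e) by ck.
by rewrite (grad2_expl m.+2)// cutoffS1.
Qed.

Lemma grad2_cutoff_sqr m e f x : grad2 (fun x => (cutoff e x ^+ m.+3) ^+ 2) f x =
  2 * m.+3%:R * (cutoff e x ^+ 3 * (cutoff e x ^+ m.+1) ^+ 2) * grad2 (cutoff e) f x.
Proof.
have Cc : Ck 1 (@cutoff R n e) by ck.
have Cx : Ck 1 (fun x => @cutoff R n e x ^+ m.+3) by ck.
rewrite (grad2_expl 1)// grad2_cutoff_exp cutoffS2.
move: (cutoff e x) (grad2 _ _ x) (_ ^+ m.+1) => b d a; ring.
Qed.

Lemma lap_cutoff_exp m e x : lap (fun x : 'rV[R]_n => cutoff e x ^+ m.+3) x =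
  m.+3%:R * (cutoff e x * cutoff e x ^+ m.+1) * lap (cutoff e) x +
  m.+3%:R * (m.+3%:R - 1) * cutoff e x ^+ m.+1 * grad2 (cutoff e) (cutoff e) x.
Proof.
have Cc : Ck 2 (@cutoff R n e) by ck.
by rewrite (lap_exp m.+1)// cutoffS1 -{5}(@natr1 R m.+2) addrK.
Qed.

Lemma lap_cutoff_sqr m e x : lap (fun x : 'rV[R]_n => (cutoff e x ^+ m.+3) ^+ 2) x =
  2 * (cutoff e x ^+ 2 * cutoff e x ^+ m.+1) *
    (m.+3%:R * (cutoff e x * cutoff e x ^+ m.+1) * lap (cutoff e) x +
     m.+3%:R * (m.+3%:R - 1) * cutoff e x ^+ m.+1 * grad2 (cutoff e) (cutoff e) x) +
  2 * (m.+3%:R ^+ 2 * (cutoff e x * cutoff e x ^+ m.+1) ^+ 2 *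
    grad2 (cutoff e) (cutoff e) x).
Proof.
have Cx : Ck 2 (fun x => @cutoff R n e x ^+ m.+3) by ck.
rewrite (lap_exp 0)// lap_cutoff_exp grad2_cutoff_exp grad2C grad2_cutoff_exp cutoffS2 expr1.
rewrite expr0; move: (cutoff e x) (grad2 _ _ x) (lap _ x) (_ ^+ m.+1) => b d f a; ring.
Qed.

End cutoff_powers.

Section scaling.
Context {R : realType}.

(** Turns the pointwise Hardy inequality into one between the final integrands. The comparison l S
    <= V, with S = u^((p+1)/2), is used three times: once to bring out P^2 and twice to replace
    powers of u by v on the larger side. *)
Lemma hardy_scale (l V a U S P b Y Z G B D g1 g2 i : R) : 0 <= l -> 0 <= Y -> 0 <= Z ->
  0 <= G -> 0 <= a -> 0 <= U -> 0 <= P -> 0 <= b -> 0 <= B -> 0 <= D -> l * S <= V ->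
  a * U ^+ 2 = P * S -> a * U * S = P ^+ 2 -> b * S = a ->
  V * (a * U) * Y <= B * (a * G * Y) + D * (a * U ^+ 2 * Z) - g1 - i * g2 ->
  0 <= - l ^+ 2 * (P ^+ 2 * Y) + B * (b * G * V * Y) + D * (V * P * Z) +
    - l * g1 + - (l * i) * g2.
Proof.
move=> l0 Y0 Z0 G0 a0 U0 P0 b0 B0 D0 hV E1 E2 E3 H.
have V0 : 0 <= V - l * S by rewrite subr_ge0.
have t1 : 0 <= Y * (a * U) * l * (V - l * S) by pos.
have t2 : 0 <= B * G * Y * b * (V - l * S) by pos.
have t3 : 0 <= D * Z * P * (V - l * S) by pos.
have := ler_wpM2l l0 H; rewrite -subr_ge0 => t4.
have := addr_ge0 (addr_ge0 t1 t2) (addr_ge0 t3 t4).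
congr (_ <= _); rewrite -E2 E1.
transitivity (- l ^+ 2 * (a * U * S * Y) + B * (b * G * V * Y) + D * (V * P * Z) +
    - l * g1 + - (l * i) * g2 + l * B * G * Y * (a - b * S)); first by ring.
by rewrite E3 subrr mulr0 addr0.
Qed.

End scaling.

Section constants.
Context {R : realType}.
Variables (n m : nat) (tau del : R).
Let M : R := m.+3%:R.
Let c := @cutC R n.

(** [low_const] and [mid_const] are the coefficients of [I_low] and [I_mid] in the bound for the
    remainder once [I_dir] has been eliminated by Caccioppoli; [hardy_const] is that of [I_mid] in
    the Hardy inequality. *)
Definition low_const : R :=
  (1 + del) * (c * (8 * tau ^+ 2 * M ^+ 2 + 8 * M * tau ^+ 2 * (2 * tau + 3) +
    2 * M * tau * (tau * (n%:R - 2 - tau) + tau * (tau + 2)))) +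
  (1 + del^-1) * (3 * M ^+ 2 * tau ^+ 2 * c ^+ 2 + 6 * M ^+ 4 * c ^+ 2) +
  (1 + del^-1) * (12 * M ^+ 2 * c) * (4 * m.+2%:R ^+ 2 * c).

Definition mid_const : R :=
  (1 + del^-1) * (12 * M ^+ 2 * c) * 2 + 2 * (M * tau + M ^+ 2) * c.

Definition hardy_const : R := (M ^+ 2 / del + 2 * M * tau) * c.

Lemma low_const_ge0 : 0 < del -> 0 < tau -> 2 * tau < n%:R - 2 -> 0 <= low_const.
Proof.
move=> d0 t0 tn; have c0 : 0 <= c := ltW cutC_gt0.
have N0 : 0 <= n%:R - 2 - tau by move: (n%:R) tn t0 => N; lra.
by have M0 : 0 <= M by []; rewrite /low_const; clearbody M c; pos.
Qed.

Lemma mid_const_ge0 : 0 < del -> 0 < tau -> 0 <= mid_const.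
Proof.
move=> d0 t0; have c0 : 0 <= c := ltW cutC_gt0.
by have M0 : 0 <= M by []; rewrite /mid_const; clearbody M c; pos.
Qed.

Lemma hardy_const_ge0 : 0 < del -> 0 < tau -> 0 <= hardy_const.
Proof.
move=> d0 t0; have c0 : 0 <= c := ltW cutC_gt0.
by have M0 : 0 <= M by []; rewrite /hardy_const; clearbody M c; pos.
Qed.

End constants.

Lemma imp_trans (A B C : Prop) : (A -> B) -> A -> (B -> C) -> C.
Proof. by auto. Qed.

(** * Upper and lower bounds for the weighted gradient integral *)

Section main_estimate.
Context {R : realType} {n : nat}.
Variables (p tau : R) (u : 'rV[R]_n -> R) (m : nat) (e : R).
Hypotheses (n3 : (3 <= n)%N) (p1 : 1 < p) (sol : solution p u) (st : stable p u).
Hypotheses (tau0 : 0 < tau) (tau_n : 2 * tau < n%:R - 2) (e0 : 0 < e) (e1 : e <= 1).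

Let Cu : Ck 4 u. Proof. by case: sol => h _ _; split. Qed.
Let u0 x : 0 < u x. Proof. by case: sol. Qed.
Let ueq x : lap (lap u) x = u x `^ p.
Proof. by case: sol => _ _ /(_ x); rewrite !laplacianE. Qed.

Let v x := - lap u x.
(** Determined by k + (p + 1) / 2 = 2 p: then u^k v >= l u^(2p), and likewise u^(k-1) = u^(p-2)
    u^((p+1)/2) is controlled by u^(p-2) v. *)
Let k : R := (3 * p - 1) / 2.
Let l : R := Num.sqrt (2 / (p + 1)).
(** 2 tau nu is the leading coefficient of minus the Laplacian of [wt (2 * tau)], hence the Hardy
    constant. *)
Let nu : R := n%:R - 2 - 2 * tau.
Let K := e `^ tau.
Let M : R := m.+3%:R.
Let c := @cutC R n.
Let X x := (@cutoff R n e x ^+ m.+3) ^+ 2.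

(** [I_top] and [I_grad] carry the main terms. The other three are unweighted errors with fewer
    powers of the cutoff; they come with factors K e, K e^2 and K e for [I_mid], [I_low] and
    [I_dir], where K = e^tau is the size of the squared weight at the edge of the ball. *)
Definition I_top := integ (fun x => (u x `^ p) ^+ 2 * (wt tau x * cutoff e x ^+ m.+3) ^+ 2).
Definition I_grad := integ (fun x => u x `^ (p - 2) * grad2 u u x * - lap u x *
  (wt tau x * cutoff e x ^+ m.+3) ^+ 2).
Definition I_mid := integ (fun x => - lap u x * u x `^ p * (cutoff e x ^+ m.+2) ^+ 2).
Definition I_low := integ (fun x => (- lap u x) ^+ 2 * (cutoff e x ^+ m.+1) ^+ 2).
Definition I_dir := integ (fun x => grad2 (fun x => - lap u x) (fun x => - lap u x) x * (cutoff e x ^+ m.+2) ^+ 2).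

Let k0 : 0 < k. Proof. by rewrite /k divr_gt0//; have := p1; lra. Qed.
Let nu0 : 0 < nu. Proof. by rewrite /nu; have := tau_n; lra. Qed.
Let l0 : 0 < l. Proof. by rewrite sqrtr_gt0 divr_gt0//; have := p1; lra. Qed.
Let c0 : 0 <= c. Proof. exact: ltW (cutC_gt0). Qed.
Let K0 : 0 <= K. Proof. exact: powR_ge0. Qed.
Let CX : Ck 2 X. Proof. by rewrite /X; ck. Qed.
Let CX1 : Ck 1 X. Proof. by rewrite /X; ck. Qed.
Let bX : bsupp X. Proof. by rewrite /X; bs. Qed.
Let Cv : Ck 2 v. Proof. by rewrite /v; ck. Qed.
Let v_ge x : l * u x `^ ((p + 1) / 2) <= v x.
Proof. exact: lap_le_power. Qed.
Let v0 x : 0 <= v x.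
Proof. by apply: le_trans (v_ge x); rewrite mulr_ge0 ?powR_ge0// ltW. Qed.

Let f1 x := u x `^ k * (wt (2 * tau) x * X x).
Let f2 x := u x `^ (k + 1) * X x.

Let powk x : u x `^ k = u x `^ (k - 1) * u x.
Proof.
rewrite -[X in _ = _ * X](powRr1 (ltW (u0 x))) -powRD ?subrK//.
by apply/implyP => _; rewrite gt_eqF.
Qed.

Let powk1 x : u x `^ (k + 1) = u x `^ (k - 1) * u x ^+ 2.
Proof.
rewrite expr2 mulrA -powk -[X in _ = _ * X](powRr1 (ltW (u0 x))) -powRD//.
by apply/implyP => _; rewrite gt_eqF.
Qed.

Let green1E x : let z := cutoff e x in let th := z ^+ m.+1 in
  green f1 u x = u x `^ (k - 1) * u x * wt tau x ^+ 2 * (z ^+ 2 * th) ^+ 2 * - v x +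
    (k * u x `^ (k - 1) * grad2 u u x * (wt tau x ^+ 2 * (z ^+ 2 * th) ^+ 2) +
     u x `^ (k - 1) * u x * ((z ^+ 2 * th) ^+ 2 * grad2 (wt (2 * tau)) u x +
      wt tau x ^+ 2 * (2 * M * (z ^+ 3 * th ^+ 2) * grad2 (cutoff e) u x))).
Proof.
move=> z th; have Cu1 : Ck 1 u by ck.
have Cuk : Ck 1 (fun x => u x `^ k) by ck.
have Cw : Ck 1 (@wt R n (2 * tau)) by ck.
have CwX : Ck 1 (fun x => wt (2 * tau) x * X x) by ck.
rewrite /green /f1 (grad2_mull _ _ Cuk CwX) (grad2_mull _ _ Cw CX1).
rewrite (grad2_powRl _ _ _ Cu1)// /X grad2_cutoff_sqr -/M powk cutoffS2 -/z -/th.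
rewrite (@wt_double _ _ tau _ 0) ?mulr0 ?addr0// expr0 mulr1 /v opprK.
move: (lap u x) (u x) (u x `^ _) (wt tau x) z th (grad2 u u x) (grad2 (wt _) u x)
  (grad2 (cutoff e) u x) => L U a w z0 t G h d; clear; ring.
Qed.

Let green2E x : let z := cutoff e x in let th := z ^+ m.+1 in
  let w := wt tau x in let t := wt 2 x in
  green f2 (wt (2 * tau)) x = u x `^ (k - 1) * u x ^+ 2 * (z ^+ 2 * th) ^+ 2 *
      (- (2 * tau * nu) * (w ^+ 2 * t) - 2 * tau * (2 * tau + 2) * (w ^+ 2 * t ^+ 2)) +
    ((k + 1) * (u x `^ (k - 1) * u x) * ((z ^+ 2 * th) ^+ 2 * grad2 (wt (2 * tau)) u x) +
     u x `^ (k - 1) * u x ^+ 2 * (2 * M * (z ^+ 3 * th ^+ 2) *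
       (- tau * (w ^+ 2 * t) * grad2 (cutoff e) r2 x))).
Proof.
move=> z th w t; have Cu1 : Ck 1 u by ck.
have Cuk : Ck 1 (fun x => u x `^ (k + 1)) by ck.
rewrite /green /f2 (grad2_mull _ _ Cuk CX1).
rewrite (grad2_powRl _ _ _ Cu1)// addrK /X grad2_cutoff_sqr -/M powk1 powk cutoffS2 -/z -/th.
rewrite lap_wt grad2_cutoff_wt [grad2 u _ x]grad2C.
rewrite (@wt_double _ _ tau (2 * tau + 2) 1) ?mulr1// expr1.
rewrite (@wt_double _ _ tau (2 * tau + 4) 2); last by rewrite -natrM.
have -> : 2 * tau / 2 = tau by rewrite mulrC mulKf.
rewrite -/w -/t /nu.
move: (u x) (u x `^ _) w t z th (grad2 _ u x)
  (grad2 (cutoff e) r2 x) => U a w0 t0 z0 th0 G h; clear; ring.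
Qed.

Let powE x : let a := u x `^ (k - 1) in let P := u x `^ p in
  let S := u x `^ ((p + 1) / 2) in
  [/\ a * u x ^+ 2 = P * S, a * u x * S = P ^+ 2 & u x `^ (p - 2) * S = a].
Proof.
have pD (r s : R) : u x `^ r * u x `^ s = u x `^ (r + s).
  by rewrite -powRD//; apply/implyP => _; rewrite gt_eqF.
rewrite /= -powk1 -powk -powR_mulrn ?powR_ge0// -powRrM !pD.
by split; congr (_ `^ _); rewrite /k; field.
Qed.

Let hardy_at del x : 0 < del -> 0 <=
  - l ^+ 2 * ((u x `^ p) ^+ 2 * (wt tau x * cutoff e x ^+ m.+3) ^+ 2) +
  (k + 2 * (tau * (k + 1) / nu) + del) *
    (u x `^ (p - 2) * grad2 u u x * - lap u x * (wt tau x * cutoff e x ^+ m.+3) ^+ 2) +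
  (M ^+ 2 / del + 2 * M * tau) * c * (K * e) *
    (- lap u x * u x `^ p * (cutoff e x ^+ m.+2) ^+ 2) +
  - l * green f1 u x + - (l * (k + 1)^-1) * green f2 (wt (2 * tau)) x.
Proof.
move=> d0; have [[hq hg _ _] _] := @annulus_bounds R n tau e x e0 e1 (ltW tau0).
have hd := grad2_CS (cutoff e) u x.
have hh : grad2 (wt (2 * tau)) u x ^+ 2 <=
    grad2 u u x * (4 * tau ^+ 2 * ((wt tau x ^+ 2) ^+ 2 * wt 2 x)).
  rewrite [grad2 (wt _) u x]grad2C; apply: le_trans (grad2_CS _ _ _) _.
  apply: ler_wpM2l; first exact: grad2_ge0.
  rewrite grad2_wt (@wt_double _ _ (2 * tau) (2 * tau + 2 * tau + 2) 1); last by ring.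
  rewrite (@wt_double _ _ (2 * tau) (2 * tau + 2 * tau + 4) 2); last by ring.
  rewrite (@wt_double _ _ tau (2 * tau) 0); last by rewrite mulr0 addr0.
  rewrite expr0 mulr1 expr1.
  have t0 := ltW (wt_gt0 2 x); move: (wt tau x) (wt 2 x) t0 => w t t0.
  rewrite -subr_ge0 (_ : _ - _ = 4 * tau ^+ 2 * (w ^+ 2) ^+ 2 * t ^+ 2); last by ring.
  by pos.
have H := @hardy_point R (u x `^ (k - 1)) (u x) (v x) (wt tau x) (wt 2 x)
  (grad2 (cutoff e) r2 x) (grad2 (cutoff e) u x) (grad2 (cutoff e) (cutoff e) x)
  (grad2 u u x) (grad2 (wt (2 * tau)) u x) K e (cutoff e x) (cutoff e x ^+ m.+1)
  M k tau nu c del (powR_ge0 _ _) (u0 x) (ltW (wt_gt0 _ _)) (grad2_ge0 _ _)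
  (grad2_ge0 _ _) (cutoff_ge0 _ _) (cutoff_le1 _ _) (ltr0Sn _ _) k0 tau0 nu0 d0 c0 K0
  (ltW e0) hd hh hq hg.
rewrite green1E green2E cutoffS2 (cutoffS1 m) -/(v x).
have [h1 h2 h3] := powE x; rewrite /= in h1 h2 h3.
have D0 : 0 <= (M ^+ 2 / del + 2 * M * tau) * c * (K * e).
  have M0 : 0 <= M by []; have := tau0; have := c0; have := K0; have := e0 => *; pos.
have G0 := grad2_ge0 u x; have V1 := v_ge x; have V0 := v0 x; have U0 := ltW (u0 x).
have a0 := powR_ge0 (u x) (k - 1); have P0 := powR_ge0 (u x) p.
have b0 := powR_ge0 (u x) (p - 2); have L0 := ltW l0.
have B0 : 0 <= k + 2 * (tau * (k + 1) / nu) + del.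
  by have := k0; have := tau0; have := nu0; move=> *; pos.
apply: (hardy_scale _ _ _ _ _ _ _ _ _ _ V1 h1 h2 h3) => //; try exact: sqr_ge0.
Qed.

Let cF1 : cbs (green f1 u).
Proof.
apply: cbs_green; [by rewrite /f1; ck|by ck|left].
by rewrite /f1; bs.
Qed.

Let cF2 : cbs (green f2 (wt (2 * tau))).
Proof.
apply: cbs_green; [by rewrite /f2; ck|by ck|left].
by rewrite /f2; bs.
Qed.

Let ctop : cbs (fun x => (u x `^ p) ^+ 2 * (wt tau x * cutoff e x ^+ m.+3) ^+ 2).
Proof. by cb. Qed.
Let cgrad : cbs (fun x => u x `^ (p - 2) * grad2 u u x * - lap u x *
  (wt tau x * cutoff e x ^+ m.+3) ^+ 2).
Proof. by cb. Qed.
Let cmid : cbs (fun x => - lap u x * u x `^ p * (cutoff e x ^+ m.+2) ^+ 2).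
Proof. by cb. Qed.
Let clow : cbs (fun x => (- lap u x) ^+ 2 * (cutoff e x ^+ m.+1) ^+ 2).
Proof. by cb. Qed.
Let cdir : cbs (fun x => grad2 (fun x => - lap u x) (fun x => - lap u x) x * (cutoff e x ^+ m.+2) ^+ 2).
Proof. by cb. Qed.

Lemma hardy_integral del : 0 < del ->
  l ^+ 2 * I_top <= (k + 2 * (tau * (k + 1) / nu) + del) * I_grad +
    (M ^+ 2 / del + 2 * M * tau) * c * (K * e) * I_mid.
Proof.
move=> d0; have Cu2 : Ck 2 u by ck.
have Cf1 : Ck 1 f1 by rewrite /f1; ck.
have Cf2 : Ck 1 f2 by rewrite /f2; ck.
have Cw := @Ck_wt R n 2 (2 * tau).
have b1 : bsupp f1 by rewrite /f1; bs.
have b2 : bsupp f2 by rewrite /f2; bs.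
have G1 := I_green Cf1 Cu2 (or_introl b1).
have G2 := I_green Cf2 Cw (or_introl b2).
have := @I_lin_ge0 _ _ [::
  (- l ^+ 2, fun x => (u x `^ p) ^+ 2 * (wt tau x * cutoff e x ^+ m.+3) ^+ 2);
  (k + 2 * (tau * (k + 1) / nu) + del,
    fun x => u x `^ (p - 2) * grad2 u u x * - lap u x *
      (wt tau x * cutoff e x ^+ m.+3) ^+ 2);
  ((M ^+ 2 / del + 2 * M * tau) * c * (K * e),
    fun x => - lap u x * u x `^ p * (cutoff e x ^+ m.+2) ^+ 2);
  (- l, green f1 u); (- (l * (k + 1)^-1), green f2 (wt (2 * tau)))]
  (conj ctop (conj cgrad (conj cmid (conj cF1 (conj cF2 Logic.I))))).
rewrite /lin_I /lin_at /= G1 G2 -/I_top -/I_grad -/I_mid => H.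
rewrite -subr_ge0.
suff : 0 <= - l ^+ 2 * I_top + ((k + 2 * (tau * (k + 1) / nu) + del) * I_grad +
  ((M ^+ 2 / del + 2 * M * tau) * c * (K * e) * I_mid +
  (- l * 0 + (- (l / (k + 1)) * 0 + 0)))).
  by move: (_ * I_grad) (_ * I_mid) => a b; congr (_ <= _); ring.
apply: H => x; have := hardy_at x d0.
move: (_ * (_ * _ * - lap u x * _)) (_ * (- lap u x * _ * _)) => a b.
by congr (_ <= _); ring.
Qed.

Let eta (x : 'rV[R]_n) := wt tau x * cutoff e x ^+ m.+3.
Let Ceta : Ck 2 eta. Proof. by rewrite /eta; ck. Qed.
Let beta : bsupp eta. Proof. by rewrite /eta; bs. Qed.
Let lap_v : lap v = fun x => - u x `^ p.
Proof. by apply/funext => x; rewrite lap_opp ?ueq//; ck. Qed.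
Let Clv : Ck 2 (lap v).
Proof. have Cu2 : Ck 2 u by ck.
by rewrite lap_v; ck. Qed.
Let cR : cbs (remainder v eta).
Proof.
split; last by rewrite /remainder; bs.
by apply: (@Ck_cont _ _ 0); rewrite /remainder; ck.
Qed.

(** Since Lap (Lap v) = p u^(p-1) v - p (p - 1) u^(p-2) |grad u|^2, the first term reproduces the
    left side of the stability inequality and cancels it. *)
Let stability_integral : p * (p - 1) * I_grad <= integ (remainder v eta).
Proof.
have Cu2 : Ck 2 u by ck.
have := stable_remainder st (Ck_le (leq0n 4) Cu) u0 Cv Clv Ceta beta.
have cA : cbs (fun x => u x `^ (p - 1) * (v x * eta x) ^+ 2) by cb.
have -> : (fun x => v x * eta x ^+ 2 * lap (lap v) x) = fun x =>
    p * (u x `^ (p - 1) * (v x * eta x) ^+ 2) - p * (p - 1) *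
    (u x `^ (p - 2) * grad2 u u x * - lap u x * (wt tau x * cutoff e x ^+ m.+3) ^+ 2).
  apply/funext => x; rewrite lap_v lap_opp; last by ck.
  rewrite lap_powR// -/(eta x) -/(v x).
  have -> : p - 1 - 1 = p - 2 by ring.
  rewrite -[lap u x]opprK -/(v x).
  move: (v x) (eta x) (u x `^ _) (u x `^ _) (grad2 _ _ x) => V E a b G; ring.
rewrite I_sub; [|exact: cbs_scale|exact: cbs_scale].
by rewrite !I_scale// -/I_grad -addrA lerDl addrC subr_ge0.
Qed.

Let W (x : 'rV[R]_n) : R := tau ^+ 2 * (wt (2 * tau + 2) x - wt (2 * tau + 4) x).
Let Lw (x : 'rV[R]_n) : R := - (tau * (n%:R - 2 - tau)) * wt (tau + 2) x - tau * (tau + 2) * wt (tau + 4) x.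
Let CW j : Ck j W. Proof. by rewrite /W; ck. Qed.
Let CLw j : Ck j Lw. Proof. by rewrite /Lw; ck. Qed.

Let w2 j s (x : 'rV[R]_n) : s = 2 * tau + 2 * j%:R -> wt s x = wt tau x ^+ 2 * wt 2 x ^+ j.
Proof. exact: wt_double. Qed.
Let w1 j s (x : 'rV[R]_n) : s = tau + 2 * j%:R -> wt s x = wt tau x * wt 2 x ^+ j.
Proof. exact: wt_single. Qed.

Let WE (x : 'rV[R]_n) : W x = tau ^+ 2 * (wt tau x ^+ 2 * wt 2 x - wt tau x ^+ 2 * wt 2 x ^+ 2).
Proof.
by rewrite /W (@w2 1 (2 * tau + 2)) ?mulr1// (@w2 2 (2 * tau + 4)) ?expr1//; ring.
Qed.

Let LwE (x : 'rV[R]_n) : Lw x = - (tau * (n%:R - 2 - tau)) * (wt tau x * wt 2 x) -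
  tau * (tau + 2) * (wt tau x * wt 2 x ^+ 2).
Proof.
by rewrite /Lw (@w1 1 (tau + 2)) ?mulr1// (@w1 2 (tau + 4)) ?expr1//; ring.
Qed.

Let grad_om (x : 'rV[R]_n) : grad2 (wt tau) (wt tau) x = W x.
Proof. by rewrite grad2_wt /W -expr2; congr (_ * (wt _ x - wt _ x)); ring. Qed.

Let lap_om (x : 'rV[R]_n) : lap (wt tau) x = Lw x.
Proof. by rewrite lap_wt. Qed.

Let gpwE (x : 'rV[R]_n) : grad2 (cutoff e) (wt tau) x =
  - (tau / 2) * (wt tau x * wt 2 x) * grad2 (cutoff e) r2 x.
Proof. by rewrite grad2_cutoff_wt wtD. Qed.

Let dWE (x : 'rV[R]_n) : lap W x = tau ^+ 2 *
  ((- ((2 * tau + 2) * (n%:R - 4 - 2 * tau)) * (wt tau x ^+ 2 * wt 2 x ^+ 2) -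
      (2 * tau + 2) * (2 * tau + 4) * (wt tau x ^+ 2 * wt 2 x ^+ 3)) -
    (- ((2 * tau + 4) * (n%:R - 6 - 2 * tau)) * (wt tau x ^+ 2 * wt 2 x ^+ 3) -
      (2 * tau + 4) * (2 * tau + 6) * (wt tau x ^+ 2 * wt 2 x ^+ 4))).
Proof.
have Ca := @Ck_wt R n 2 (2 * tau + 2); have Cb := @Ck_wt R n 2 (2 * tau + 4).
have Cb' : Ck 2 (fun x : 'rV[R]_n => - wt (2 * tau + 4) x) by ck.
have Cd : Ck 2 (fun x : 'rV[R]_n => wt (2 * tau + 2) x - wt (2 * tau + 4) x) by ck.
rewrite /W (lap_scale _ _ Cd) (lap_add _ Ca Cb') (lap_opp _ Cb) !lap_wt.
rewrite (@w2 2 (2 * tau + 2 + 2)); last by ring.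
rewrite (@w2 3 (2 * tau + 2 + 4)); last by ring.
rewrite (@w2 3 (2 * tau + 4 + 2)); last by ring.
rewrite (@w2 4 (2 * tau + 4 + 4)); last by ring.
move: (wt tau x) (wt 2 x) (n%:R) => w t N; clear; ring.
Qed.

Let gwE (x : 'rV[R]_n) : grad2 (cutoff e) W x = tau ^+ 2 *
  (- (tau + 1) * (wt tau x ^+ 2 * wt 2 x ^+ 2) * grad2 (cutoff e) r2 x +
   (tau + 2) * (wt tau x ^+ 2 * wt 2 x ^+ 3) * grad2 (cutoff e) r2 x).
Proof.
have Ca := @Ck_wt R n 1 (2 * tau + 2); have Cb := @Ck_wt R n 1 (2 * tau + 4).
have Cb' : Ck 1 (fun x : 'rV[R]_n => - wt (2 * tau + 4) x) by ck.
have Cd : Ck 1 (fun x : 'rV[R]_n => wt (2 * tau + 2) x - wt (2 * tau + 4) x) by ck.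
rewrite /W (grad2_scaler _ _ _ Cd) (grad2_addr _ _ Ca Cb') (grad2_oppr _ _ Cb) !grad2_cutoff_wt.
rewrite (@w2 2 (2 * tau + 2 + 2)); last by ring.
rewrite (@w2 3 (2 * tau + 4 + 2)); last by ring.
have -> : (2 * tau + 2) / 2 = tau + 1 by field.
have -> : (2 * tau + 4) / 2 = tau + 2 by field.
move: (wt tau x) (wt 2 x) (grad2 _ _ x) => w t N; clear; ring.
Qed.

Let gLE (x : 'rV[R]_n) : grad2 Lw (wt tau) x =
  - (tau * (n%:R - 2 - tau)) * ((tau + 2) * tau *
      (wt tau x ^+ 2 * wt 2 x ^+ 2 - wt tau x ^+ 2 * wt 2 x ^+ 3)) -
    tau * (tau + 2) * ((tau + 4) * tau *
      (wt tau x ^+ 2 * wt 2 x ^+ 3 - wt tau x ^+ 2 * wt 2 x ^+ 4)).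
Proof.
have Ca := @Ck_wt R n 1 (tau + 2); have Cb := @Ck_wt R n 1 (tau + 4).
have Ca' : Ck 1 (fun x : 'rV[R]_n => - (tau * (n%:R - 2 - tau)) * wt (tau + 2) x) by ck.
have Cb' : Ck 1 (fun x : 'rV[R]_n => tau * (tau + 2) * wt (tau + 4) x) by ck.
have Cb2 : Ck 1 (fun x : 'rV[R]_n => - (tau * (tau + 2) * wt (tau + 4) x)) by ck.
rewrite /Lw (grad2_addl _ _ Ca' Cb2) (grad2_oppl _ _ Cb') (grad2_scalel _ _ _ Ca).
rewrite (grad2_scalel _ _ _ Cb) !grad2_wt.
rewrite (@w2 2 (tau + 2 + tau + 2)); last by ring.
rewrite (@w2 3 (tau + 2 + tau + 4)); last by ring.
rewrite (@w2 3 (tau + 4 + tau + 2)); last by ring.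
rewrite (@w2 4 (tau + 4 + tau + 4)); last by ring.
by [].
Qed.

Let remainderE (x : 'rV[R]_n) :
  let z := cutoff e x in let th := z ^+ m.+1 in let w := wt tau x in
  let q := grad2 (cutoff e) (cutoff e) x in
  let gw := - (tau / 2) * (wt tau x * wt 2 x) * grad2 (cutoff e) r2 x in
  remainder v eta x =
  (2 * ((z ^+ 2 * th) * grad2 v (wt tau) x + w * (M * (z * th) * grad2 (cutoff e) v x)) +
     v x * (w * (M * (z * th) * lap (cutoff e) x + M * (M - 1) * th * q) +
       (z ^+ 2 * th) * Lw x + 2 * (M * (z * th) * gw))) ^+ 2 +
  2 * v x * u x `^ p * ((z ^+ 2 * th) ^+ 2 * W x +
    2 * (w * (z ^+ 2 * th) * (M * (z * th) * gw)) + w ^+ 2 * (M ^+ 2 * (z * th) ^+ 2 * q)).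
Proof.
move=> z th w q gw; rewrite /remainder /eta lap_v.
have Cw1 := @Ck_wt R n 1 tau; have Cw := @Ck_wt R n 2 tau.
have Cc1 : Ck 1 (fun x : 'rV[R]_n => cutoff e x ^+ m.+3) by ck.
have Cc : Ck 2 (fun x : 'rV[R]_n => cutoff e x ^+ m.+3) by ck.
have gc f : grad2 (fun x => cutoff e x ^+ m.+3) f x = M * (z * th) * grad2 (cutoff e) f x.
  by rewrite grad2_cutoff_exp.
have gcr f : grad2 f (fun x => cutoff e x ^+ m.+3) x = M * (z * th) * grad2 (cutoff e) f x.
  by rewrite grad2C.
rewrite (grad2_mulr v x Cw1 Cc1) (lap_mul _ Cw Cc) (grad2_mull _ x Cw1 Cc1).
rewrite !(grad2_mulr _ x Cw1 Cc1) !gc !gcr ?gc.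
rewrite lap_cutoff_exp grad_om lap_om gpwE cutoffS2 -/z -/th -/M -/w -/q.
clear gc gcr; rewrite -/gw; move: (v x) (u x `^ p) (W x) (Lw x) (grad2 v (wt tau) x) (grad2 (cutoff e) v x)
  (lap (cutoff e) x) q gw w z th => V P W0 L0 b gv L q0 gw0 w0 z0 th0; clear.
ring.
Qed.

Let gv2 f (x : 'rV[R]_n) : grad2 (fun x => v x ^+ 2) f x = 2 * v x * grad2 v f x.
Proof.
have Cv1 : Ck 1 v by exact: (@Ck_le _ _ 1 2 _ isT Cv).
by rewrite (grad2_expl 1)// expr1.
Qed.

Let gXE f (x : 'rV[R]_n) : grad2 X f x = 2 * M *
  (cutoff e x ^+ 3 * (cutoff e x ^+ m.+1) ^+ 2) * grad2 (cutoff e) f x.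
Proof. by rewrite /X grad2_cutoff_sqr. Qed.

Let green3E (x : 'rV[R]_n) : let z := cutoff e x in let th := z ^+ m.+1 in
  green (fun x => v x * (X x * W x)) v x =
  v x * (X x * W x) * - u x `^ p +
    (v x * (X x * grad2 W v x + W x * (2 * M * (z ^+ 3 * th ^+ 2) * grad2 (cutoff e) v x)) +
     X x * W x * grad2 v v x).
Proof.
move=> z th; have Cv1 : Ck 1 v by exact: (@Ck_le _ _ 1 2 _ isT Cv).
have CW1 := CW 1; have CXW : Ck 1 (fun x => X x * W x) by exact: Ck_mul.
rewrite /green (grad2_mull _ _ Cv1 CXW) (grad2_mull _ _ CX1 CW1) lap_v.
by rewrite gXE.
Qed.

Let green4E (x : 'rV[R]_n) : let z := cutoff e x in let th := z ^+ m.+1 in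
  green (fun x => v x ^+ 2) (fun x => X x * W x) x =
  v x ^+ 2 * (X x * lap W x + W x * lap X x +
     2 * (2 * M * (z ^+ 3 * th ^+ 2) * grad2 (cutoff e) W x)) +
    2 * v x * (X x * grad2 W v x + W x * (2 * M * (z ^+ 3 * th ^+ 2) * grad2 (cutoff e) v x)).
Proof.
move=> z th; have Cv1 : Ck 1 v by exact: (@Ck_le _ _ 1 2 _ isT Cv).
rewrite /green (lap_mul _ CX (CW 2)) gv2 (grad2_mulr _ _ CX1 (CW 1)).
by rewrite [grad2 v X x]grad2C !gXE [grad2 v W x]grad2C.
Qed.

Let green5E (x : 'rV[R]_n) : let z := cutoff e x in let th := z ^+ m.+1 in
  green (fun x => v x ^+ 2 * (X x * Lw x)) (wt tau) x =
  v x ^+ 2 * (X x * Lw x) * Lw x +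
   (v x ^+ 2 * (X x * grad2 Lw (wt tau) x + Lw x * (2 * M * (z ^+ 3 * th ^+ 2) *
      grad2 (cutoff e) (wt tau) x)) +
    X x * Lw x * (2 * v x * grad2 v (wt tau) x)).
Proof.
move=> z th; have Cv1 : Ck 1 v by exact: (@Ck_le _ _ 1 2 _ isT Cv).
have Cv2 : Ck 1 (fun x => v x ^+ 2) by ck.
have CL1 := CLw 1; have CXL : Ck 1 (fun x => X x * Lw x) by exact: Ck_mul.
rewrite /green (grad2_mull _ _ Cv2 CXL) (grad2_mull _ _ CX1 CL1) lap_om gv2.
by rewrite gXE.
Qed.

(** At leading order t^2 the first product comes from 2 Lap W, the second from - Lw^2 - 2 grad Lw .
    grad w, where W = |grad w|^2 and Lw = Lap w. *)
Let Kt : R := 4 * (tau + 1) * (n%:R - 4 - 2 * tau) +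
  (n%:R - 2 - tau) * (n%:R - 6 - 3 * tau).
Hypothesis Kt0 : 0 < Kt.

Let D4 : R := c * (8 * tau ^+ 2 * M ^+ 2 + 8 * M * tau ^+ 2 * (2 * tau + 3) +
    2 * M * tau * (tau * (n%:R - 2 - tau) + tau * (tau + 2))).

Let remainder_at del x : 0 < del -> remainder v eta x <=
  (1 + del) * (9 * tau ^+ 2 / Kt * ((u x `^ p) ^+ 2 * (wt tau x * cutoff e x ^+ m.+3) ^+ 2) +
     D4 * (K * e ^+ 2 * ((- lap u x) ^+ 2 * (cutoff e x ^+ m.+1) ^+ 2)) +
     4 * green (fun x => v x * (X x * W x)) v x -
     2 * green (fun x => v x ^+ 2) (fun x => X x * W x) x +
     2 * green (fun x => v x ^+ 2 * (X x * Lw x)) (wt tau) x) +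
  (1 + del^-1) * (12 * M ^+ 2 * c) * (e * K *
    (grad2 (fun x => - lap u x) (fun x => - lap u x) x * (cutoff e x ^+ m.+2) ^+ 2)) +
  (1 + del^-1) * (3 * M ^+ 2 * tau ^+ 2 * c ^+ 2 + 6 * M ^+ 4 * c ^+ 2) *
    (K * e ^+ 2 * ((- lap u x) ^+ 2 * (cutoff e x ^+ m.+1) ^+ 2)) +
  2 * (M * tau + M ^+ 2) * c *
    (K * e * (- lap u x * u x `^ p * (cutoff e x ^+ m.+2) ^+ 2)).
Proof.
move=> d0.
have [[hq hg hq2 hL2] [hg2 htq htL htg]] := @annulus_bounds R n tau e x e0 e1 (ltW tau0).
have hgv := grad2_CS (cutoff e) v x.
have hb : grad2 v (wt tau) x ^+ 2 <= grad2 v v x * W x.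
  by rewrite -grad_om; exact: grad2_CS.
have M1 : 1 <= M by rewrite /M ler1n.
have H1 := @remainder_point R (v x) (u x `^ p) (wt tau x) (wt 2 x) (grad2 (cutoff e) r2 x)
  (grad2 (cutoff e) v x) (grad2 v v x) (grad2 v (wt tau) x) (Lw x)
  (grad2 (cutoff e) (cutoff e) x) (lap (cutoff e) x) K e (cutoff e x) (cutoff e x ^+ m.+1)
  M tau c del (W x) (- (tau / 2) * (wt tau x * wt 2 x) * grad2 (cutoff e) r2 x)
  (v0 x) (powR_ge0 _ _) (cutoff_ge0 _ _) (cutoff_le1 _ _) M1 (ltW tau0) d0 c0
  (grad2_ge0 _ _) (grad2_ge0 _ _) (ltW (wt_gt0 _ _)) (wt2_le1 _) K0 (ltW e0) hgv
  hq hg hq2 hL2 hg2 (WE x) erefl.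
have N0 : 0 <= n%:R - 2 - tau.
  by have := tau_n; have := tau0; move: (n%:R) => N; lra.
have H2 := @weight_point R (v x) (u x `^ p) (wt tau x) (wt 2 x) (grad2 (cutoff e) r2 x)
  (grad2 (cutoff e) v x) (grad2 v v x) (grad2 v (wt tau) x) (grad2 W v x)
  (grad2 (cutoff e) (cutoff e) x) (lap (cutoff e) x) K e (cutoff e x) (cutoff e x ^+ m.+1)
  M tau c n%:R Kt (X x) (lap X x) (W x) (lap W x) (grad2 (cutoff e) W x) (Lw x)
  (grad2 Lw (wt tau) x) (grad2 (cutoff e) (wt tau) x)
  (v0 x) (powR_ge0 _ _) (cutoff_ge0 _ _) (cutoff_le1 _ _) M1 (ltW tau0) c0
  (grad2_ge0 _ _) (ltW (wt_gt0 _ _)) (wt2_le1 _) K0 (ltW e0) Kt0 N0 erefl htq htL htg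
  (congr1 (fun z => z ^+ 2) (cutoffS2 m e x)) (lap_cutoff_sqr m e x) (WE x) hb (dWE x)
  (gwE x) (LwE x) (gLE x) (gpwE x).
rewrite remainderE green3E green4E green5E.
apply: (le_trans H1).
rewrite -/(v x) (cutoffS1 m) -/D4 in H1 H2 *.
have XE : X x = (cutoff e x ^+ 2 * cutoff e x ^+ m.+1) ^+ 2 by rewrite /X cutoffS2.
rewrite -XE cutoffS2.
do 3 apply: lerD => //.
have d1 : 0 <= 1 + del by rewrite addr_ge0// ltW.
apply: ler_wpM2l => //.
Qed.

Let cg3 : cbs (green (fun x => v x * (X x * W x)) v).
Proof.
have Cv1 : Ck 1 v by exact: (@Ck_le _ _ 1 2 _ isT Cv).
apply: cbs_green; [apply: Ck_mul => //; exact: Ck_mul|exact: Cv|left].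
by apply: bsupp_mull; exact: bsupp_mulr.
Qed.

Let cg4 : cbs (green (fun x => v x ^+ 2) (fun x => X x * W x)).
Proof.
have Cv1 : Ck 1 v by exact: (@Ck_le _ _ 1 2 _ isT Cv).
apply: cbs_green; [exact: Ck_exp|exact: Ck_mul|right].
exact: bsupp_mulr.
Qed.

Let cg5 : cbs (green (fun x => v x ^+ 2 * (X x * Lw x)) (wt tau)).
Proof.
have Cv1 : Ck 1 v by exact: (@Ck_le _ _ 1 2 _ isT Cv).
apply: cbs_green; [apply: Ck_mul; [exact: Ck_exp|exact: Ck_mul]|exact: Ck_wt|left].
by apply: bsupp_mull; exact: bsupp_mulr.
Qed.

Let remainder_integral del : 0 < del -> integ (remainder v eta) <=
  (1 + del) * (9 * tau ^+ 2 / Kt) * I_top +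
  ((1 + del) * D4 + (1 + del^-1) * (3 * M ^+ 2 * tau ^+ 2 * c ^+ 2 + 6 * M ^+ 4 * c ^+ 2)) *
    (K * e ^+ 2 * I_low) +
  (1 + del^-1) * (12 * M ^+ 2 * c) * (e * K * I_dir) +
  2 * (M * tau + M ^+ 2) * c * (K * e * I_mid).
Proof.
move=> d0.
have Cv1 : Ck 1 v by exact: (@Ck_le _ _ 1 2 _ isT Cv).
have G3 : integ (green (fun x => v x * (X x * W x)) v) = 0.
  apply: I_green; [apply: Ck_mul => //; exact: Ck_mul|exact: Cv|left].
  by apply: bsupp_mull; exact: bsupp_mulr.
have G4 : integ (green (fun x => v x ^+ 2) (fun x => X x * W x)) = 0.
  apply: I_green; [exact: Ck_exp|exact: Ck_mul|right].
  exact: bsupp_mulr.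
have G5 : integ (green (fun x => v x ^+ 2 * (X x * Lw x)) (wt tau)) = 0.
  apply: I_green; [apply: Ck_mul; [exact: Ck_exp|exact: Ck_mul]|exact: Ck_wt|left].
  by apply: bsupp_mull; exact: bsupp_mulr.
have := @I_lin_ge0 _ _ [::
  ((1 + del) * (9 * tau ^+ 2 / Kt),
    fun x => (u x `^ p) ^+ 2 * (wt tau x * cutoff e x ^+ m.+3) ^+ 2);
  (((1 + del) * D4 + (1 + del^-1) * (3 * M ^+ 2 * tau ^+ 2 * c ^+ 2 + 6 * M ^+ 4 * c ^+ 2)) *
    (K * e ^+ 2), fun x => (- lap u x) ^+ 2 * (cutoff e x ^+ m.+1) ^+ 2);
  ((1 + del^-1) * (12 * M ^+ 2 * c) * (e * K), fun x =>
    grad2 (fun x => - lap u x) (fun x => - lap u x) x * (cutoff e x ^+ m.+2) ^+ 2);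
  (2 * (M * tau + M ^+ 2) * c * (K * e),
    fun x => - lap u x * u x `^ p * (cutoff e x ^+ m.+2) ^+ 2);
  (- 1, remainder v eta);
  ((1 + del) * 4, green (fun x => v x * (X x * W x)) v);
  ((1 + del) * - 2, green (fun x => v x ^+ 2) (fun x => X x * W x));
  ((1 + del) * 2, green (fun x => v x ^+ 2 * (X x * Lw x)) (wt tau))]
  (conj ctop (conj clow (conj cdir (conj cmid (conj cR (conj cg3 (conj cg4 (conj cg5 Logic.I)))))))).
rewrite /lin_I /lin_at /= G3 G4 G5 -/I_top -/I_low -/I_dir -/I_mid => H.
rewrite -subr_ge0; apply: (imp_trans H) => [x|].
  have := remainder_at x d0; rewrite -subr_ge0.
  move: (remainder _ _ x) (green _ _ x) (green _ _ x) (green _ _ x)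
   (grad2 _ _ x * _) ((- lap u x) ^+ 2 * _) (- lap u x * _ * _) (_ ^+ 2 * _) => r g3 g4 g5 a b f h.
  congr (_ <= _); move: (9 * tau ^+ 2 / Kt) (1 + del^-1) D4; clear => y y1 y2; ring.
move: (integ _) I_dir I_low I_mid I_top => a b f h g.
congr (_ <= _); move: (9 * tau ^+ 2 / Kt) (1 + del^-1) D4; clear => y y1 y2; ring.
Qed.

Let dir_integral : I_dir <= 2 * I_mid + 4 * m.+2%:R ^+ 2 * (c * e) * I_low.
Proof.
have := caccioppoli m Cv e0; rewrite -/I_dir -/I_low -/c.
have -> : integ (fun x => v x * lap v x * (cutoff e x ^+ m.+2) ^+ 2) = - I_mid.
  rewrite -I_opp//; congr integ; apply/funext => x.
  by rewrite lap_v /v mulrN mulNr.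
by rewrite mulrNN.
Qed.

(** Young's inequality between u^p and v. The factor e^tau that goes with u^(2p) is traded for the
    squared weight on the support of the cutoff, so this part is a small multiple of [I_top]. *)
Let mid_integral d : 0 < d -> K * e * I_mid <= d * I_top + 3 `^ tau / (4 * d) * (K * e ^+ 2 * I_low).
Proof.
move=> d0.
have := @I_lin_ge0 _ _ [::
  (d, fun x => (u x `^ p) ^+ 2 * (wt tau x * cutoff e x ^+ m.+3) ^+ 2);
  (3 `^ tau / (4 * d) * (K * e ^+ 2), fun x => (- lap u x) ^+ 2 * (cutoff e x ^+ m.+1) ^+ 2);
  (- (K * e), fun x => - lap u x * u x `^ p * (cutoff e x ^+ m.+2) ^+ 2)]
  (conj ctop (conj clow (conj cmid Logic.I))).
rewrite /lin_I /lin_at /= -/I_top -/I_low -/I_mid => H.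
rewrite -subr_ge0; apply: (imp_trans H) => [x|].
  rewrite cutoffS2 (cutoffS1 m).
  have := @cutoff_weight_le R n tau e x e0 e1 (ltW tau0).
  have := cutoff_ge0 e x; rewrite -/K.
  have s0 : 0 < 3 `^ tau :> R by rewrite powR_gt0.
  have e0' := e0; have K0' := K0; move: s0 e0' K0'.
  move: (wt tau x) (- lap u x) (u x `^ p) K e (3 `^ tau) (cutoff e x) (_ ^+ m.+1).
  move=> w V P KK ee s z th s0 ee0 KK0 z0 h.
  have t1 : 0 <= d / s * (P ^+ 2 * z ^+ 3 * th ^+ 2) * (s * (w ^+ 2 * z) - KK * z).
    by apply: mulr_ge0; [pos|rewrite subr_ge0].
  have t2 : 0 <= KK * (d / s) * th ^+ 2 * (z ^+ 2 * P - s / (2 * d) * ee * V) ^+ 2 by pos.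
  have := addr_ge0 t1 t2; congr (_ <= _); field.
  by rewrite !gt_eqF.
move: I_low I_mid I_top => f h g.
by congr (_ <= _); move: (_ / _); clear => y; ring.
Qed.

(** The Hardy inequality times p (p - 1), plus the stability inequality times the Hardy constant,
    eliminates [I_grad]; [I_dir] and [I_mid] are then replaced by their bounds, and only [I_top] and
    [I_low] are left. *)
Lemma top_le del d : 0 < del -> 0 < d ->
  p * (p - 1) * (2 / (p + 1)) * I_top <=
  (k + 2 * (tau * (k + 1) / nu) + del) * ((1 + del) * (9 * tau ^+ 2 / Kt)) * I_top +
  (k + 2 * (tau * (k + 1) / nu) + del) * low_const n m tau del * (K * e ^+ 2 * I_low) +
  ((k + 2 * (tau * (k + 1) / nu) + del) * mid_const n m tau del +
    p * (p - 1) * hardy_const n m tau del) *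
    (d * I_top + 3 `^ tau / (4 * d) * (K * e ^+ 2 * I_low)).
Proof.
move=> d0 d'0.
have h1 := hardy_integral d0; have h2 := stability_integral.
have h3 := remainder_integral d0; have h4 := dir_integral; have h5 := mid_integral d'0.
have p0 : 0 < p * (p - 1).
  by apply: mulr_gt0; have := p1; lra.
have M0 : 0 <= M by [].
have q0 : 0 <= (1 + del^-1) * (12 * M ^+ 2 * c) * (e * K).
  by have := e0; have := c0; have := K0; move=> *; pos.
have kk0 : 0 <= k + 2 * (tau * (k + 1) / nu) + del.
  by have := k0; have := tau0; have := nu0; move=> *; pos.
have A0 : 0 <= (k + 2 * (tau * (k + 1) / nu) + del) * mid_const n m tau del +
    p * (p - 1) * hardy_const n m tau del.
  have := mid_const_ge0 n m d0 tau0; have := hardy_const_ge0 n m d0 tau0 => *; pos.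
apply: le_trans (lerD (lexx _) (ler_wpM2l A0 h5)).
have l2 : l ^+ 2 = 2 / (p + 1).
  by rewrite sqr_sqrtr// divr_ge0//; have := p1; lra.
rewrite l2 -subr_ge0 in h1; rewrite -subr_ge0 in h2; rewrite -subr_ge0 in h3; rewrite -subr_ge0 in h4.
rewrite -subr_ge0.
have t1 := mulr_ge0 (ltW p0) h1.
have t2 := mulr_ge0 kk0 h2.
have t3 := mulr_ge0 kk0 h3.
have t4 := mulr_ge0 (mulr_ge0 kk0 q0) h4.
have := addr_ge0 (addr_ge0 t1 t2) (addr_ge0 t3 t4).
congr (_ <= _); rewrite /low_const /mid_const /hardy_const -/M -/c /D4.
move: (integ _) I_top I_grad I_dir I_low I_mid => a b f g h i.
move: (9 * tau ^+ 2 / Kt) (1 + del^-1) (M ^+ 2 / del) (2 / (p + 1)) (k + 2 * _ + del).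
by clear => y1 y2 y3 y4 y5; ring.
Qed.

End main_estimate.

(** * The nonexistence criterion *)

Section criterion.
Context {R : realType}.
Implicit Types (p tau : R).

Lemma small_perturbation (k r T : R) : 0 < k -> 0 <= r -> k * r < T ->
  exists2 del : R, 0 < del & (k + del) * ((1 + del) * r) <= T - (T - k * r) / 2.
Proof.
move=> k0 r0 kr; have g0 : 0 < T - k * r by rewrite subr_gt0.
have q0 : 0 < 2 * (r * (k + 2) + 1) by spos.
exists (Num.min 1 ((T - k * r) / (2 * (r * (k + 2) + 1)))).
  by rewrite lt_min ltr01 divr_gt0.
set d := Num.min _ _.
have d1 : d <= 1 by rewrite ge_min lexx.
have d2 : d * (2 * (r * (k + 2) + 1)) <= T - k * r.
  by rewrite -ler_pdivlMr// ge_min lexx orbT.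
have d0 : 0 <= d by rewrite le_min ler01 divr_ge0 ?ltW.
clearbody d.
have : 0 <= r * (d * (1 - d)) by apply: mulr_ge0 => //; apply: mulr_ge0 => //; rewrite subr_ge0.
have -> : (k + d) * ((1 + d) * r) = k * r + d * (r * (k + 2)) - r * (d * (1 - d)) by ring.
by move: d2; rewrite mulrCA mulrDr mulr1; move: (k * r) (d * _) (r * _) => a b f; lra.
Qed.

Lemma small_power (b C A : R) : 0 < b -> 0 <= C -> 0 < A ->
  exists e : R, [/\ 0 < e, e <= 2^-1 & C * e `^ b < A].
Proof.
move=> b0 C0 A0; have C1 : 0 < C + 1 by rewrite ltr_wpDl.
have q0 : 0 < A / (C + 1) by rewrite divr_gt0.
exists (Num.min 2^-1 ((A / (C + 1)) `^ b^-1)); split.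
- by rewrite lt_min invr_gt0 ltr0n powR_gt0.
- by rewrite ge_min lexx.
set e := Num.min _ _.
have e0 : 0 <= e by rewrite le_min invr_ge0 ler0n powR_ge0.
have : e `^ b <= A / (C + 1).
  have -> : A / (C + 1) = ((A / (C + 1)) `^ b^-1) `^ b.
    by rewrite -powRrM mulVf ?gt_eqF// powRr1// ltW.
  apply: ge0_ler_powR; [exact: ltW|by []|by rewrite nnegrE powR_ge0|].
  by rewrite /e ge_min lexx orbT.
move=> h; apply: (le_lt_trans (ler_wpM2l C0 h)).
by rewrite mulrA ltr_pdivrMr// mulrC ltr_pM2l// ltrDl.
Qed.

Lemma absorb_mid (T X Y A a s k d : R) : 0 < T - k -> 0 <= A -> 0 <= X ->
  d = (T - k) / (2 * (A + 1)) ->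
  T * X <= k * X + a * Y + A * (d * X + s / (4 * d) * Y) ->
  X <= (2 / (T - k) * (a + A * (s / (4 * d)))) * Y.
Proof.
move=> g0 A0 X0 dE H.
have A1 : 0 < A + 1 by rewrite ltr_wpDl.
have h : A * d <= (T - k) / 2.
  rewrite dE; have -> : A * ((T - k) / (2 * (A + 1))) = (T - k) / 2 * (A / (A + 1)).
    by field; rewrite gt_eqF.
  apply: ler_piMr; first by rewrite divr_ge0// ltW.
  by rewrite ler_pdivrMr// mul1r lerDl.
have h2 := ler_wpM2r X0 h.
rewrite -(ler_pM2l (_ : 0 < (T - k) / 2)); last by rewrite divr_gt0.
have -> : (T - k) / 2 * (2 / (T - k) * (a + A * (s / (4 * d))) * Y) =
  (a + A * (s / (4 * d))) * Y.
  by move: (s / (4 * d)) => z; field; rewrite gt_eqF.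
move: H h2; move: (s / (4 * d)) => z.
rewrite mulrDr mulrA; move: (A * d * X) => y.
by clear=> H h2; lra.
Qed.

(** [I_top] at scale e is O(e^b) with b > 0, yet for e <= 1/2 it is at least its value at e = 1,
    which is positive. The gap between the two constants pays for the auxiliary parameters: at most
    half of it for [del], half of the rest for [d]. *)
Theorem no_stable_of_weight (n : nat) p tau : (3 <= n)%N -> 1 < p -> 0 < tau ->
  2 * tau < n%:R - 2 ->
  let Kt := 4 * (tau + 1) * (n%:R - 4 - 2 * tau) + (n%:R - 2 - tau) * (n%:R - 6 - 3 * tau) in
  let k := (3 * p - 1) / 2 in
  0 < Kt ->
  (k + 2 * (tau * (k + 1) / (n%:R - 2 - 2 * tau))) * (9 * tau ^+ 2 / Kt) <
    p * (p - 1) * (2 / (p + 1)) ->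
  n%:R < 2 * tau + 8 * p / (p - 1) ->
  no_stable_solution n p.
Proof.
move=> n3 p1 tau0 tn Kt k Kt0 NC hn [u sol st].
have nu0 : 0 < n%:R - 2 - 2 * tau by rewrite subr_gt0.
have p10 : 0 < p - 1 by rewrite subr_gt0.
have u0 x : 0 < u x by case: sol.
have Cu : Ck 4 u by case: sol => h _ _; split.
have k0 : 0 < k by rewrite /k divr_gt0//; lra.
set kk := k + _ in NC; set rho := 9 * tau ^+ 2 / Kt in NC; set T := p * _ * _ in NC.
have kk0 : 0 < kk.
  by rewrite /kk ltr_pwDl// mulr_ge0// divr_ge0 ?(ltW nu0)// mulr_ge0 ?ltW// addr_gt0.
have rho0 : 0 <= rho by rewrite /rho; pos.
have [del del0 hdel] := small_perturbation kk0 rho0 NC.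
have [m [C [C0 hE]]] := energy_bound p1 sol st.
set A := (kk + del) * mid_const n m tau del + p * (p - 1) * hardy_const n m tau del.
have A0 : 0 <= A.
  have h1 := mid_const_ge0 n m del0 tau0; have h2 := hardy_const_ge0 n m del0 tau0.
  have pp0 : 0 <= p * (p - 1) by rewrite mulr_ge0//; lra.
  by rewrite /A; pos.
have gap : 0 < T - (kk + del) * ((1 + del) * rho).
  by move: hdel NC; move: (kk * rho) ((kk + del) * _) T => a b f; clear; lra.
set d := (T - (kk + del) * ((1 + del) * rho)) / (2 * (A + 1)).
have d0 : 0 < d by rewrite /d divr_gt0// mulr_gt0// ltr_wpDl.
set B := 2 / (T - (kk + del) * ((1 + del) * rho)) *
  ((kk + del) * low_const n m tau del + A * (3 `^ tau / (4 * d))).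
have B0 : 0 <= B.
  have h1 := @low_const_ge0 R n m tau del del0 tau0 tn.
  have s0 : 0 <= 3 `^ tau / (4 * d) by rewrite divr_ge0 ?powR_ge0// mulr_ge0 ?ltW.
  have gap' := ltW gap; rewrite /B mulr_ge0 ?divr_ge0// addr_ge0// mulr_ge0//.
  by rewrite addr_ge0 ?ltW.
(* Exponent of e^(tau+2) times the energy: 2 + 2 (p + 1) / (p - 1) = 4 p / (p - 1). *)
pose b := tau + 4 * p / (p - 1) - n%:R / 2.
have b0 : 0 < b.
  have -> : b = (2 * tau + 8 * p / (p - 1) - n%:R) / 2.
    by rewrite /b; field; rewrite gt_eqF.
  by rewrite divr_gt0// subr_gt0.
have key e : 0 < e -> e <= 1 -> I_top p tau u m e <= B * C * e `^ b.
  move=> e0 e1.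
  have X0 : 0 <= I_top p tau u m e.
    by apply: I_ge0 => x; rewrite mulr_ge0 ?sqr_ge0.
  have h := top_le m n3 p1 sol st tau0 tn e0 e1 Kt0 del0 d0.
  rewrite -/k -/Kt -/kk -/rho -/T -/A in h.
  have := @absorb_mid T (I_top p tau u m e) (e `^ tau * e ^+ 2 * I_low u m e) A
    ((kk + del) * low_const n m tau del) (3 `^ tau) ((kk + del) * ((1 + del) * rho)) d
    gap A0 X0 erefl h.
  rewrite -/B => {}h.
  apply: (le_trans h); rewrite -[leRHS]mulrA; apply: ler_wpM2l => //.
  have IL : I_low u m e <= C * e `^ (2 * (p + 1) / (p - 1) - n%:R / 2).
    apply: le_trans (hE e e0); rewrite /I_low.
    have -> : (fun x => (- lap u x) ^+ 2 * (cutoff e x ^+ m.+1) ^+ 2) =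
        (fun x => lap u x ^+ 2 * (cutoff e x ^+ m.+1) ^+ 2).
      by apply/funext => x; rewrite sqrrN.
    by rewrite lerDr; apply: I_ge0 => x; rewrite mulr_ge0 ?powR_ge0 ?sqr_ge0.
  have Ke0 : 0 <= e `^ tau * e ^+ 2 by rewrite mulr_ge0 ?powR_ge0 ?sqr_ge0.
  apply: (le_trans (ler_wpM2l Ke0 IL)); rewrite mulrCA -powR_mulrn ?(ltW e0)//.
  have eD (r s : R) : e `^ r * e `^ s = e `^ (r + s).
    by rewrite -powRD//; apply/implyP => _; rewrite gt_eqF.
  rewrite !eD le_eqVlt; apply/orP; left; apply/eqP; congr (_ * _ `^ _).
  by rewrite /b; field; rewrite gt_eqF.
have c1 e : 0 < e -> cbs (fun x => (u x `^ p) ^+ 2 * (wt tau x * cutoff e x ^+ m.+3) ^+ 2).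
  by move=> e0; cb.
have I1 : 0 < I_top p tau u m 1.
  apply: I_gt0; first exact: c1.
    by move=> x; rewrite mulr_ge0 ?sqr_ge0.
  exists 0; rewrite [cutoff _ _]cutoff_in; first by rewrite expr1n mulr1; spos.
  by rewrite mul1r /r2 big1// => i _; rewrite mxE expr0n.
(* The bound e <= 1/2 makes the cutoff at scale e dominate the one at scale 1. *)
have [e [e0 e1 he]] := small_power b0 (mulr_ge0 B0 C0) I1.
have e1' : e <= 1 by move: e1; clear; lra.
have := key e e0 e1'; apply/negP; rewrite -ltNge; apply: (lt_le_trans he).
apply: I_le; [exact: c1|exact: c1|move=> x].
apply: ler_wpM2l; first exact: sqr_ge0.
have w0 := ltW (wt_gt0 tau x); have z0 := cutoff_ge0 1 x.
have z1 : cutoff 1 x <= cutoff e x by apply: le_cutoff => //; rewrite mul1r.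
have z2 : 0 <= cutoff e x by exact: le_trans z1.
have t1 : 0 <= wt tau x * cutoff 1 x ^+ m.+3 by rewrite mulr_ge0// exprn_ge0.
have t2 : 0 <= wt tau x * cutoff e x ^+ m.+3 by rewrite mulr_ge0// exprn_ge0.
by rewrite ler_sqr ?nnegrE//; apply: ler_wpM2l => //; apply: lerXn2r.
Qed.


End criterion.

(** * Admissible exponents *)

Ltac cont := lazymatch goal with
  | |- continuous (fun y => @?F y + @?G y) => apply: (@cont_add _ _ F G); cont
  | |- continuous (fun y => - @?F y) => apply: (@cont_opp _ _ F); cont
  | |- continuous (fun y => @?F y * @?G y) => apply: (@cont_mul _ _ F G); cont
  | |- continuous (fun y => @?F y ^+ ?m) => apply: (@cont_exp _ _ F m); cont
  | |- continuous (fun _ => ?c) => exact: cont_cst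
  | |- _ => by move=> ?; exact: cvg_id
  end.

Section exponents.
Context {R : realType}.
Implicit Types (p s x N : R) (n : nat).

(** For tau <= 1/100 the Hardy constant is at most 2 p and 9 tau^2 / Kt at most 12 tau^2; the
    product is quadratic in tau, while the right side of the criterion is at least p - 1. The
    smallness is dictated by n = 5, where Kt at tau = 0 is n^2 - 4 n - 4 = 1. *)
Lemma no_stable_slow_weight n p : (5 <= n)%N -> 1 < p ->
  n%:R < (p - 1) / (50 * p) + 8 * p / (p - 1) -> no_stable_solution n p.
Proof.
move=> n5 p1 hn; pose tau := (p - 1) / (100 * p).
have N5 : 5 <= n%:R :> R by rewrite ler_nat.
have p0 : 0 < p by lra.
have p10 : 0 < p - 1 by lra.
have t0 : 0 < tau by rewrite /tau divr_gt0// mulr_gt0.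
have t1 : tau <= 1 / 100.
  by rewrite /tau ler_pdivrMr ?mulr_gt0//; lra.
have tE : tau * p = (p - 1) / 100 by rewrite /tau; field; rewrite gt_eqF.
have n3 : (3 <= n)%N by apply: leq_trans n5.
have nu : 29 / 10 <= n%:R - 2 - 2 * tau by lra.
have Kt : 4 / 5 <= 4 * (tau + 1) * (n%:R - 4 - 2 * tau) +
    (n%:R - 2 - tau) * (n%:R - 6 - 3 * tau).
  clear nu tE hn; clearbody tau; move: (n%:R) tau N5 t0 t1 => N t N5 t0 t1.
  have h1 : 0 <= (N - 5) * (N + 1) by apply: mulr_ge0; lra.
  have h2 : 0 <= t * (1 / 100 - t) by apply: mulr_ge0; lra.
  have -> : 4 * (t + 1) * (N - 4 - 2 * t) + (N - 2 - t) * (N - 6 - 3 * t) =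
    (N - 5) * (N + 1) + 1 - 12 * t - 5 * t ^+ 2 by ring.
  by rewrite expr2; move: h2; rewrite mulrBr; lra.
apply: (@no_stable_of_weight _ _ _ tau) => //.
- by lra.
- by apply: lt_le_trans Kt.
- set K := 4 * (tau + 1) * _ + _ in Kt *; set v := n%:R - 2 - 2 * tau in nu *.
  have q2 : 9 * tau ^+ 2 / K <= 12 * tau ^+ 2.
    rewrite ler_pdivrMr; last by move: Kt; clear; lra.
    have := sqr_ge0 tau; move: (tau ^+ 2) => y y0.
    have := ler_wpM2l y0 Kt; lra.
  have q1 : (3 * p - 1) / 2 + 2 * (tau * ((3 * p - 1) / 2 + 1) / v) <= 2 * p.
    have : tau * ((3 * p - 1) / 2 + 1) / v <= p / 100.
      rewrite ler_pdivrMr; last by lra.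
      have h1 : p * (29 / 10) <= p * v by rewrite ler_wpM2l// ltW.
      have -> : tau * ((3 * p - 1) / 2 + 1) = (3 * (tau * p) + tau) / 2 by field.
      by rewrite tE; lra.
    by lra.
  have q10 : 0 <= (3 * p - 1) / 2 + 2 * (tau * ((3 * p - 1) / 2 + 1) / v).
    apply: addr_ge0; first by lra.
    by apply: mulr_ge0 => //; apply: divr_ge0; [apply: mulr_ge0; lra|lra].
  have q20 : 0 <= 9 * tau ^+ 2 / K by apply: divr_ge0; [pos|lra].
  apply: le_lt_trans (ler_pM q10 q20 q1 q2) _.
  have -> : 2 * p * (12 * tau ^+ 2) = 24 * tau * (tau * p) by ring.
  rewrite tE; apply: (@lt_le_trans _ _ (p - 1)).
    have -> : 24 * tau * ((p - 1) / 100) = (24 / 100 * tau) * (p - 1) by field.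
    by rewrite gtr_pMl//; lra.
  rewrite mulrA ler_pdivlMr; last by lra.
  by rewrite -mulrA mulrCA ler_pM2l//; lra.
- have -> // : 2 * tau = (p - 1) / (50 * p) by rewrite /tau; field; rewrite gt_eqF.
Qed.

(** At q = n / (n - 8) the gain (q - 1)^2 / (50 q) equals 64 / (50 n (n - 8)), and it increases with
    the exponent. Dividing by n - 8 gives the admissible excess of p over q. *)
Lemma no_stable_subcritical n p : (9 <= n)%N -> 1 < p ->
  p < n%:R / (n%:R - 8) + 64 / (50 * n%:R * (n%:R - 8) ^+ 2) -> no_stable_solution n p.
Proof.
move=> n9 p1 hp; apply: no_stable_slow_weight => //; first exact: leq_trans n9.
have N9 : 9 <= n%:R :> R by rewrite ler_nat.
move: (n%:R) N9 hp => N N9 hp.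
have p0 : 0 < p by lra.
have p10 : 0 < p - 1 by lra.
have N8 : 0 < N - 8 by lra.
have N0 : 0 < N by lra.
have [h|h] := leP p (N / (N - 8)).
  apply: ltr_pwDl; first by rewrite divr_gt0// mulr_gt0.
  by move: h; rewrite !ler_pdivlMr//; lra.
have h1 : (N - 8) * p - N < 64 / (50 * N * (N - 8)).
  have := hp; rewrite -(ltr_pM2l N8).
  have -> : (N - 8) * (N / (N - 8) + 64 / (50 * N * (N - 8) ^+ 2)) =
    N + 64 / (50 * N * (N - 8)) by field; rewrite !gt_eqF.
  by lra.
have h2 : 64 / (50 * N * (N - 8)) <= (p - 1) ^+ 2 / (50 * p).
  have -> : 64 / (50 * N * (N - 8)) = (N / (N - 8) - 1) ^+ 2 / (50 * (N / (N - 8))).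
    by field; rewrite !gt_eqF.
  have : 1 < N / (N - 8) by rewrite ltr_pdivlMr//; lra.
  move: (N / (N - 8)) h => q h q1.
  rewrite ler_pdivrMr; last by lra.
  rewrite mulrAC ler_pdivlMr; last by lra.
  have : 0 <= 50 * (p - q) * (p * q - 1).
    apply: mulr_ge0; first by lra.
    by rewrite subr_ge0; apply: mulr_ege1; lra.
  by rewrite -subr_ge0 => hh; rewrite -subr_ge0; move: hh; congr (_ <= _); ring.
rewrite -(ltr_pM2r p10).
have -> : ((p - 1) / (50 * p) + 8 * p / (p - 1)) * (p - 1) = (p - 1) ^+ 2 / (50 * p) + 8 * p.
  by field; rewrite !gt_eqF.
move: (_ / _) (_ / _) h1 h2 => y z h1 h2; lra.
Qed.

(** With n = 20 + t, multiplication by the sixth power of the denominator 12 + t leaves a polynomial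
    in t whose coefficients are all positive. *)
Lemma pstar_poly_left n : (20 <= n)%N ->
  0 < @pstar_poly R n ((n%:R - 4) / (n%:R - 8)).
Proof.
move=> n20; have N20 : 20 <= n%:R :> R by rewrite ler_nat.
rewrite /pstar_poly; move: (n%:R) N20 => N N20.
have -> : N = 20 + (N - 20) by ring.
have t0 : 0 <= N - 20 by lra.
move: (N - 20) t0 => t t0.
have d0 : 0 < 20 + t - 8 by lra.
have d0' : 0 < 12 + t by lra.
have -> : 20 + t - 4 = 16 + t by ring.
have -> : 20 + t - 8 = 12 + t by ring.
set x := (16 + t) / (12 + t).
have xd : x * (12 + t) = 16 + t by rewrite /x divfK// gt_eqF.
rewrite -(pmulr_lgt0 _ (_ : 0 < (12 + t) ^+ 6)); last by spos.
have E (a0 a1 a2 a3 a4 a5 a6 d : R) :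
  (a6 * x ^+ 6 + a5 * x ^+ 5 - a4 * x ^+ 4 + a3 * x ^+ 3 - a2 * x ^+ 2 + a1 * x - a0) * d ^+ 6 =
  a6 * (x * d) ^+ 6 + a5 * (x * d) ^+ 5 * d - a4 * (x * d) ^+ 4 * d ^+ 2 +
  a3 * (x * d) ^+ 3 * d ^+ 3 - a2 * (x * d) ^+ 2 * d ^+ 4 + a1 * (x * d) * d ^+ 5 - a0 * d ^+ 6.
  by clear; ring.
rewrite E xd; set P := (P in 0 < P).
have -> : P = (8 * t ^+ 8 + 1008 * t ^+ 7 + (54 * 1000 + 144) * t ^+ 6 + (1608 * 1000 + 448) * t ^+ 5 +
    ((28 * 1000 + 563) * 1000 + 456) * t ^+ 4 + ((303 * 1000 + 562) * 1000 + 752) * t ^+ 3 + ((1792 * 1000 + 16) * 1000 + 384) * t ^+ 2 +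
    ((4580 * 1000 + 179) * 1000 + 968) * t + ((402 * 1000 + 653) * 1000 + 184)).
  by rewrite /P; clear; ring.
by apply: ltr_wpDl; [pos|spos].
Qed.

(* The right-hand sides below are Bernstein expansions, whose coefficients are positive.
   Numerals are split because they are unary. *)
Lemma pstar_poly_right n s : 0 < s -> s <= 1 -> n%:R = 20 / s ^+ 2 ->
  @pstar_poly R n (1 + 2 * s / 5) < 0.
Proof.
move=> s0 s1 nE; have Ns : n%:R * s ^+ 2 = 20 by rewrite nE divfK// gt_eqF// exprn_gt0.
rewrite /pstar_poly -oppr_gt0 -(pmulr_lgt0 _ (_ : 0 < s ^+ 6)); last by spos.
(* The relation n s^2 = 20 makes everything a polynomial in s on (0, 1], the range that corresponds
   to n >= 20. *)
have N2 : n%:R ^+ 2 * s ^+ 6 = 20 ^+ 2 * s ^+ 2 by rewrite -Ns; ring.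
have N3 : n%:R ^+ 3 * s ^+ 6 = 20 ^+ 3 by rewrite -Ns; ring.
have N1 : n%:R * s ^+ 6 = 20 * s ^+ 4 by rewrite -Ns; ring.
move: (n%:R) N1 N2 N3 => N N1 N2 N3; set x := 1 + 2 * s / 5.
set P := (P in 0 < P).
have -> : P = - ((4 * x ^+ 5 - 26 * x ^+ 4 + 54 * x ^+ 3 - 49 * x ^+ 2 + 20 * x - 3) *
    (N ^+ 3 * s ^+ 6) -
  (240 * x ^+ 5 - 848 * x ^+ 4 + 1144 * x ^+ 3 - 772 * x ^+ 2 + 264 * x - 36) *
    (N ^+ 2 * s ^+ 6) -
  (512 * x ^+ 6 - 2880 * x ^+ 5 + 2 * 3064 * x ^+ 4 - 2 * 3264 * x ^+ 3 +
    3776 * x ^+ 2 - 1152 * x + 144) * (N * s ^+ 6) +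
  (1024 * x ^+ 6 - 4 * 1344 * x ^+ 5 + 2 * 5408 * x ^+ 4 - 2 * 5440 * x ^+ 3 +
    5888 * x ^+ 2 - 1664 * x + 192) * s ^+ 6).
  by rewrite /P; clearbody x; clear; ring.
rewrite N1 N2 N3 {P} /x.
have [r rE] : exists r, s = 5 * r by exists (s / 5); rewrite mulrCA divff ?mulr1.
have -> : 2 * s / 5 = 2 * r by rewrite rE; field.
rewrite -(pmulr_lgt0 _ (_ : 0 < 5 ^+ 6 :> R)); last by spos.
set P := (P in 0 < P).
have -> : P = s ^+ 2 * (128 * ((78 * 1000 + 125) * (1 - s) ^+ 10 + (625 * 1000) * s * (1 - s) ^+ 9 +
    (2040 * 1000 + 625) * s ^+ 2 * (1 - s) ^+ 8 + (3635 * 1000) * s ^+ 3 * (1 - s) ^+ 7 +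
    (4778 * 1000 + 750) * s ^+ 4 * (1 - s) ^+ 6 + ((7 * 1000 + 580) * 1000) * s ^+ 5 * (1 - s) ^+ 5 +
    ((12 * 1000 + 911) * 1000 + 750) * s ^+ 6 * (1 - s) ^+ 4 + ((15 * 1000 + 358) * 1000 + 800) * s ^+ 7 * (1 - s) ^+ 3 +
    ((10 * 1000 + 913) * 1000 + 845) * s ^+ 8 * (1 - s) ^+ 2 + (4206 * 1000 + 80) * s ^+ 9 * (1 - s) +
    (681 * 1000 + 273) * s ^+ 10)).
  by rewrite /P rE; clear; ring.
clear r rE P.
have r0 : 0 <= 1 - s by rewrite subr_ge0.
move: (1 - s) r0 => r r0; apply: mulr_gt0; first by spos.
apply: mulr_gt0; first by rewrite ltr0n.
by apply: ltr_wpDl; [pos|spos].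
Qed.

(** The smallest root is the infimum of the roots: a root exists by the change of sign, the infimum
    is a root by continuity, and it is not the left endpoint because the polynomial is positive
    there. *)
Lemma pstar_exists n x1 : (20 <= n)%N -> (n%:R - 4) / (n%:R - 8) < x1 ->
  @pstar_poly R n x1 < 0 -> exists2 x, is_pstar n x & x <= x1.
Proof.
move=> n20; have := pstar_poly_left n20; set x0 := _ / _ => P0 x01 P1.
have cP : continuous (@pstar_poly R n).
  by rewrite /pstar_poly; cont.
pose Z := [set y | x0 < y /\ @pstar_poly R n y = 0].
have [z Zz zx1] : exists2 z, Z z & z <= x1.
  have h1 : {within `[x0, x1], continuous (@pstar_poly R n)} by exact: continuous_subspaceT.
  have h2 : Num.min (@pstar_poly R n x0) (@pstar_poly R n x1) <= 0 <=
      Num.max (@pstar_poly R n x0) (@pstar_poly R n x1).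
    by rewrite ge_min le_max (ltW P0) (ltW P1) orbT.
  have [c] := IVT (ltW x01) h1 h2; rewrite in_itv/= => /andP[c0 c1] Pc; exists c => //; split=> //.
  rewrite lt_neqAle c0 andbT; apply/eqP => cE.
  by move: P0; rewrite cE Pc ltxx.
have lZ : lbound Z x0 by move=> y [/ltW].
have hi : has_inf Z by split; [exists z|exists x0].
have m0 : x0 <= inf Z by apply: lb_le_inf => //; exists z.
have Pm : @pstar_poly R n (inf Z) = 0.
  apply/eqP/negPn/negP => Pm0.
  have : \forall y \near inf Z, @pstar_poly R n y != 0.
    exact: (cvgr_neq0 _ (cP (inf Z)) Pm0).
  move=> /nbhs_ballP[d /= d0 hd].
  have [y [y0 Py] yd] := inf_adherent d0 hi.
  have : @pstar_poly R n y != 0.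
    apply: hd; rewrite /ball /= ltr_norml; apply/andP; split.
      by rewrite ltrNl opprB ltrBlDl.
    apply: (@le_lt_trans _ _ 0) => //; rewrite subr_le0.
    by apply: ge_inf => //; exists x0.
  by rewrite Py eqxx.
exists (inf Z); last first.
  by apply: le_trans zx1; apply: ge_inf => //; exists x0.
split=> // [|y y0 Py].
  by rewrite -/x0 lt_neqAle m0 andbT; apply/eqP => E; move: P0; rewrite E Pm ltxx.
by apply: ge_inf; [exists x0|split].
Qed.

(* The choice of tau is explained by the formula for 2 tau, where s = sqrt (20 / n). *)
Lemma supercritical_weight N s tau nu Kt : 0 < s -> s <= 1 -> N * s ^+ 2 = 20 ->
  tau = (20 - 10 * s - 8 * s ^+ 2) / (s * (5 + 2 * s)) -> nu = N - 2 - 2 * tau ->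
  Kt = 4 * (tau + 1) * (N - 4 - 2 * tau) + (N - 2 - tau) * (N - 6 - 3 * tau) ->
  [/\ 0 < tau, 0 < nu, 0 < Kt, 2 * tau = N - 8 - (N - 4) / (1 + 2 * s / 5) &
    forall q, 8 / (N - 8) <= q ->
      (1 + 3 * q / 2 + 2 * (tau * (2 + 3 * q / 2) / nu)) * (9 * tau ^+ 2 / Kt) < q].
Proof.
move=> s0 s1 Ns; pose T := 20 - 10 * s - 8 * s ^+ 2; pose m := 5 + 2 * s.
rewrite -/T -/m => tauE nuE KtE.
have ss : s ^+ 2 <= s by rewrite expr2 ler_piMl// ltW.
have NE : N = 20 / s ^+ 2 by rewrite -Ns mulfK// gt_eqF// exprn_gt0.
have T0 : 0 < T by rewrite /T; lra.
have m0 : 0 < m by rewrite /m; lra.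
pose nu1 := 100 + 10 * s ^+ 2 + 12 * s ^+ 3.
have nu1E : nu1 = 20 * m - 2 * s ^+ 2 * m - 2 * s * T by rewrite /nu1 /m /T; ring.
have nu10 : 0 < nu1 by rewrite /nu1; spos.
have {}nuE : nu = nu1 / (s ^+ 2 * m).
  by rewrite nuE tauE NE nu1E; clearbody T m; clear nu1E nu10; field; rewrite !gt_eqF.
pose K1 := 4 * (s * T + s ^+ 2 * m) * (20 * m - 4 * s ^+ 2 * m - 2 * s * T) +
  (20 * m - 2 * s ^+ 2 * m - s * T) * (20 * m - 6 * s ^+ 2 * m - 3 * s * T).
have r0 : 0 <= 1 - s by rewrite subr_ge0.
have K10 : 0 < K1.
  have -> : K1 = 16 * (625 * (1 - s) ^+ 6 + 4250 * s * (1 - s) ^+ 5 + (11 * 1000 + 725) * s ^+ 2 * (1 -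
    s) ^+ 4 + (16 * 1000 + 850) * s ^+ 3 * (1 - s) ^+ 3 + (13 * 1000 + 375) * s ^+ 4
    * (1 - s) ^+ 2 + (5 * 1000 + 590) * s ^+ 5 * (1 - s) + 956 * s ^+ 6).
    by rewrite /K1 /T /m; clear; ring.
  move: (1 - s) r0 => r r0; apply: mulr_gt0; first by rewrite ltr0n.
  by apply: ltr_wpDl; [pos|spos].
have {}KtE : Kt = K1 / (s ^+ 4 * m ^+ 2).
  by rewrite KtE /K1 tauE NE; field; rewrite !gt_eqF.
have N8 : 0 < 20 - 8 * s ^+ 2 by lra.
have N8' : N - 8 = (20 - 8 * s ^+ 2) / s ^+ 2 by rewrite NE; field; rewrite gt_eqF.
split.
- by rewrite tauE divr_gt0// mulr_gt0.
- by rewrite nuE divr_gt0// mulr_gt0// exprn_gt0.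
- by rewrite KtE divr_gt0// mulr_gt0// exprn_gt0.
- rewrite tauE /T NE; have -> : 1 + 2 * s / 5 = m / 5 by rewrite /m; field.
  rewrite /m; field; rewrite !gt_eqF//.
- move=> q hq; rewrite KtE nuE.
  have -> : 9 * tau ^+ 2 / (K1 / (s ^+ 4 * m ^+ 2)) = 9 * T ^+ 2 * s ^+ 2 / K1.
    by rewrite tauE; field; rewrite !gt_eqF.
  have -> : 1 + 3 * q / 2 + 2 * (tau * (2 + 3 * q / 2) / (nu1 / (s ^+ 2 * m))) =
    ((nu1 + 4 * (s * T)) + (3 / 2 * nu1 + 3 * (s * T)) * q) / nu1.
    by rewrite tauE; field; rewrite !gt_eqF.
  have q0 : 8 * s ^+ 2 <= q * (20 - 8 * s ^+ 2).
    by move: hq; rewrite N8' invf_div mulrA ler_pdivrMr.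
  rewrite mulrACA -invfM ltr_pdivrMr; last by rewrite mulr_gt0.
  (* The inequality is affine in q, and G is a positive multiple of its gap at the smallest value q
     = 8 / (N - 8); [h] below covers the larger ones. *)
  pose G := 8 * nu1 * K1 - 9 * T ^+ 2 * ((nu1 + 4 * (s * T)) * (20 - 8 * s ^+ 2) +
    8 * s ^+ 2 * (3 / 2 * nu1 + 3 * (s * T))).
  have G0 : 0 < G.
    have -> : G = 32 * (25 * 1000 * (1 - s) ^+ 9 + 470 * 1000 * s * (1 - s) ^+ 8 + (3151 * 1000 + 250) *
    s ^+ 2 * (1 - s) ^+ 7 + ((11 * 1000 + 78) * 1000 + 250) * s ^+ 3 * (1 - s) ^+ 6
    + ((23 * 1000 + 304) * 1000 + 375) * s ^+ 4 * (1 - s) ^+ 5 + ((30 * 1000 + 825)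
    * 1000 + 125) * s ^+ 5 * (1 - s) ^+ 4 + ((25 * 1000 + 792) * 1000 + 825) * s ^+
    6 * (1 - s) ^+ 3 + ((13 * 1000 + 227) * 1000 + 585) * s ^+ 7 * (1 - s) ^+ 2 +
    (3793 * 1000 + 30) * s ^+ 8 * (1 - s) + (463 * 1000 + 72) * s ^+ 9).
      by rewrite /G /K1 /nu1 /T /m; clear; field.
    move: (1 - s) r0 => r r0; apply: mulr_gt0; first by rewrite ltr0n.
    by apply: ltr_wpDl; [pos|spos].
  have q_gt0 : 0 < q.
    by apply: lt_le_trans hq; rewrite N8' divr_gt0// divr_gt0// exprn_gt0.
  have h : 0 <= 9 * T ^+ 2 * (nu1 + 4 * (s * T)) * (q * (20 - 8 * s ^+ 2) - 8 * s ^+ 2).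
    by apply: mulr_ge0; [pos|rewrite subr_ge0].
  have i8 : 0 < 8^-1 :> R by rewrite invr_gt0.
  have hh := mulr_gt0 i8 (ltr_wpDl h (mulr_gt0 q_gt0 G0)).
  rewrite -subr_gt0; move: hh.
  by congr (_ < _); rewrite /G; clearbody nu1 K1 T; clear; field.
Qed.

(** The criterion is checked with q = p - 1, as p (p - 1) 2 / (p + 1) >= p - 1. Its growth condition
    amounts to (n - 4) / (1 + 2 s / 5) < 8 / (p - 1), which is the upper bound on p. *)
Lemma no_stable_supercritical n p s : (20 <= n)%N -> 0 < s -> s <= 1 ->
  n%:R = 20 / s ^+ 2 -> n%:R / (n%:R - 8) <= p ->
  p < 1 + 8 * (1 + 2 * s / 5) / (n%:R - 4) -> no_stable_solution n p.
Proof.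
move=> n20 s0 s1 nE hp1 hp2; have N20 : 20 <= n%:R :> R by rewrite ler_nat.
have Ns : n%:R * s ^+ 2 = 20 by rewrite nE divfK// gt_eqF// exprn_gt0.
have [t0 nu0 K0 tE NC] := supercritical_weight s0 s1 Ns erefl erefl erefl.
set tau := _ / (s * _) in t0 nu0 K0 tE NC.
have n3 : (3 <= n)%N by apply: leq_trans n20.
have hq : 8 / (n%:R - 8) <= p - 1.
  move: hp1; have -> : n%:R / (n%:R - 8) = 1 + 8 / (n%:R - 8) :> R.
    by field; rewrite gt_eqF//; lra.
  by move: (8 / _) => y; lra.
have p1 : 1 < p.
  by rewrite -subr_gt0; apply: lt_le_trans hq; rewrite divr_gt0//; lra.
apply: (@no_stable_of_weight _ _ _ tau) => //.
- by rewrite -subr_gt0.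
- have {NC} := NC _ hq; set V := _ - 2 * tau; set r := 9 * tau ^+ 2 / _.
  have -> : (1 + 3 * (p - 1) / 2 + 2 * (tau * (2 + 3 * (p - 1) / 2) / V)) =
    (3 * p - 1) / 2 + 2 * (tau * ((3 * p - 1) / 2 + 1) / V).
    by move: (V^-1) => v; field.
  move/lt_le_trans; apply.
  rewrite mulrA ler_pdivlMr; last by lra.
  by rewrite -mulrA mulrCA ler_pM2l; lra.
- rewrite tE.
  have a0 : 0 < 1 + 2 * s / 5 by lra.
  have : (n%:R - 4) / (1 + 2 * s / 5) < 8 / (p - 1).
    rewrite ltr_pdivrMr// mulrAC ltr_pdivlMr; last by lra.
    have : (p - 1) * (n%:R - 4) < 8 * (1 + 2 * s / 5).
      by rewrite -ltr_pdivlMr; lra.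
    by rewrite mulrC.
  have -> : 8 * p / (p - 1) = 8 + 8 / (p - 1) by field; rewrite gt_eqF//; lra.
  by move: (_ / _) (_ / _) => y z; lra.
Qed.

End exponents.

Theorem theorem1p1 (R : realType) (n : nat) (hn : (5 <= n)%N) :
  [/\ (n <= 8)%N -> forall p : R, 1 < p -> no_stable_solution n p,
      (9 <= n <= 19)%N ->
        exists2 eps : R, 0 < eps &
          forall p : R, 1 < p -> p < n%:R / (n%:R - 8) + eps ->
            no_stable_solution n p
    & (20 <= n)%N ->
        exists2 pstar : R, is_pstar n pstar &
          forall p : R, 1 < p -> p < 1 + 8 * pstar / (n%:R - 4) ->
            no_stable_solution n p].
Proof.
split=> [n8 p p1|/andP[n9 _]|n20].
(* For n <= 8 the growth condition always holds, since 8 p / (p - 1) > 8. *)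
- apply: no_stable_slow_weight => //; apply: ltr_pwDl.
    by rewrite divr_gt0// ?mulr_gt0//; lra.
  have : n%:R <= 8 :> R by rewrite ler_nat.
  rewrite ler_pdivlMr; last by lra.
  move=> N8; have : (8 - n%:R) * (p - 1) >= 0 by apply: mulr_ge0; lra.
  by move: (n%:R) => N; lra.
- have N9 : 9 <= n%:R :> R by rewrite ler_nat.
  exists (64 / (50 * n%:R * (n%:R - 8) ^+ 2)).
    by rewrite divr_gt0// mulr_gt0 ?exprn_gt0//; lra.
  by move=> p p1; exact: no_stable_subcritical.
- have N20 : 20 <= n%:R :> R by rewrite ler_nat.
  (* In this variable 1 + sqrt (16 / (5 n)) is 1 + 2 s / 5, and n >= 20 becomes s <= 1. *)
  pose s : R := Num.sqrt (20 / n%:R).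
  have q0 : 0 < 20 / n%:R :> R by rewrite divr_gt0//; lra.
  have s0 : 0 < s by rewrite sqrtr_gt0.
  have s2 : s ^+ 2 = 20 / n%:R by rewrite sqr_sqrtr// ltW.
  have nE : n%:R = 20 / s ^+ 2 by rewrite s2 invf_div mulrC divfK.
  have s1 : s <= 1.
    rewrite -sqrtr1 ler_wsqrtr// ler_pdivrMr; lra.
  have ss : s ^+ 2 <= s by rewrite expr2 ler_piMl// ltW.
  have x01 : (n%:R - 4) / (n%:R - 8) < 1 + 2 * s / 5.
    rewrite ltr_pdivrMr; last by lra.
    have -> : (1 + 2 * s / 5) * (n%:R - 8) =
      n%:R - 8 + 2 / 5 * (20 - 8 * s ^+ 2) / s.
      by rewrite nE; field; rewrite gt_eqF.
    have : 10 < (20 - 8 * s ^+ 2) / s by rewrite ltr_pdivlMr//; lra.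
    by rewrite -[2 / 5 * _ / s]mulrA; move: (_ / s) => y; lra.
  have [ps hps le_ps] := pstar_exists n20 x01 (pstar_poly_right s0 s1 nE).
  exists ps => // p p1 hp.
  (* Below n / (n - 8) the slow weight suffices; above it p - 1 >= 8 / (n - 8), as the large weight
     requires. *)
  have [h|h] := ltP p (n%:R / (n%:R - 8)).
    apply: no_stable_subcritical => //; first exact: leq_trans n20.
    apply: (lt_trans h); rewrite ltrDl divr_gt0// mulr_gt0 ?exprn_gt0//; lra.
  apply: (no_stable_supercritical n20 s0 s1 nE h); apply: (lt_le_trans hp).
  by rewrite lerD2l ler_pM2r ?invr_gt0//; lra.
Qed.
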